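(* Let $k$ be a field of characteristic zero and let $A$ be a basic connected finite dimensional $k$-algebra with ordinary quiver $Q$. Assume that $Q$ has no oriented cycles and that $Q$ has no double bypasses. Then there exists an admissible ideal $I_0$ of the path algebra $kQ$ with $kQ/I_0\simeq A$ as $k$-algebras, such that for every admissible ideal $J$ of $kQ$ with $kQ/J\simeq A$ as $k$-algebras there is a surjective group morphism $\pi_1(Q,I_0)\to\pi_1(Q,J)$.
   Context: Conventions. ''Basic'' means that $A/\mathrm{rad}(A)$ is isomorphic to a finite product of copies of $k$, so that $A\simeq kQ/I$ for some admissible ideal $I$, where $Q$ is the ordinary (Gabriel) quiver of $A$ (finite and connected). Paths are oriented and composed from right to left. An ideal $I$ of $kQ$ is admissible if $(kQ^+)^n\subseteq I\subseteq (kQ^+)^2$ for some $n$, where $(kQ^+)^n$ is the ideal generated by the paths of length $n$. Bypasses. Two paths are parallel if they have the same source and the same target. A bypass of $Q$ is a pair $(\alpha,u)$ where $\alpha$ is an arrow of $Q$ and $u$ is an oriented path of $Q$ parallel to $\alpha$ and distinct from $\alpha$. A double bypass is a quadruple $(\alpha,u,\beta,v)$ where $(\alpha,u)$ and $(\beta,v)$ are bypasses such that the arrow $\beta$ appears in the path $u$. Homotopy relation and fundamental group. A walk is an unoriented path of $Q$, i.e. a composable word in arrows and formal inverses of arrows; $e_x$ denotes the stationary walk at the vertex $x$. A minimal relation of $(Q,I)$ is an element $r=t_1u_1+\dots+t_nu_n\in I$ with $n\geq 2$, $t_i\in k^*$, the $u_i$ distinct paths, such that $\sum_{i\in E}t_iu_i\notin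 I$ for every non-empty proper subset $E$ of $\{1,\dots,n\}$. The homotopy relation $\sim_I$ is the smallest equivalence relation on the set of walks of $Q$ that is compatible with concatenation of walks and satisfies: (i) $\alpha\alpha^{-1}\sim_I e_y$ and $\alpha^{-1}\alpha\sim_I e_x$ for every arrow $\alpha$ with source $x$ and target $y$; (ii) $u_1\sim_I u_2$ whenever $t_1u_1+\dots+t_nu_n$ is a minimal relation of $(Q,I)$ (in any ordering of the terms). For a vertex $x_0$, $\pi_1(Q,I,x_0)$ is the group of $\sim_I$-classes of walks starting and ending at $x_0$, with composition induced by concatenation and unit the class of $e_{x_0}$. Since $Q$ is connected, its isomorphism class does not depend on $x_0$, and it is written $\pi_1(Q,I)$. *)

(* Defs.v *)
From HB Require Import structures.
From mathcomp Require Import all_boot all_order all_algebra all_field.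
From mathcomp Require Import boolp finmap.
From mathcomp.multinomials Require Import monalg.

Set Implicit Arguments.
Unset Strict Implicit.
Unset Printing Implicit Defensive.

Import GRing.Theory.
Local Open Scope ring_scope.
Local Open Scope quotient_scope.

HB.mixin Record isTwoSided (R : nzRingType) (S : R -> bool) := {
  ideal_mull : forall a, {in S, forall x, a * x \in S};
  ideal_mulr : forall a, {in S, forall x, x * a \in S}
}.

#[short(type="tsideal")]
HB.structure Definition TwoSidedIdeal (R : nzRingType) :=
  {S of GRing.ZmodClosed R S & isTwoSided R S}.

HB.mixin Record isProperSubset (R : nzRingType) (S : R -> bool) := {
  ideal_not1 : 1 \notin S
}.

(* Properness is required because algebras are nonzero in the library;
   it is automatic for an ideal I such that B / I is a nonzero algebra. *)
#[short(type="ptsideal")]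
HB.structure Definition ProperTwoSidedIdeal (R : nzRingType) :=
  {S of TwoSidedIdeal R S & isProperSubset R S}.

Definition quot_alg (k : fieldType) (B : algType k) (I : ptsideal B) :=
  Quotient.quot I.

Section QuotientAlgebra.
Variables (k : fieldType) (B : algType k) (I : ptsideal B).

Notation Q := (quot_alg I).
Local Notation eqv := (Quotient.equiv I).

HB.instance Definition _ := GRing.Zmodule.on Q.
HB.instance Definition _ : EqQuotient B eqv Q := EqQuotient.on Q.

Definition quot_one : Q := lift_cst Q 1.
Definition quot_mul := lift_op2 Q *%R.
Definition quot_scale (c : k) := lift_op1 Q ( *:%R c).

Canonical pi_quot_one_morph := PiConst quot_one.

Lemma quot_eqP (x y : B) : reflect (x = y %[mod Q]) (x - y \in I).
Proof. by rewrite Quotient.idealrBE; apply: eqP. Qed.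

Lemma pi_quot_mul : {morph \pi_Q : x y / x * y >-> quot_mul x y}.
Proof.
move=> x y; unlock quot_mul; apply/quot_eqP.
have rP z : z - repr (\pi_Q z) \in I by apply/quot_eqP; rewrite reprK.
rewrite -[x * y](subrK (x * repr (\pi_Q y))) -mulrBr -addrA -mulrBl.
by rewrite rpredD //; [apply: ideal_mull | apply: ideal_mulr].
Qed.
Canonical pi_quot_mul_morph := PiMorph2 pi_quot_mul.

Lemma pi_quot_scale c : {morph \pi_Q : x / c *: x >-> quot_scale c x}.
Proof.
move=> x; unlock quot_scale; apply/quot_eqP.
rewrite -scalerBr -mulr_algl; apply: ideal_mull.
by apply/quot_eqP; rewrite reprK.
Qed.
Canonical pi_quot_scale_morph c := PiMorph1 (pi_quot_scale c).

Lemma pi_quot_add : {morph \pi_Q : x y / x + y}.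
Proof. exact: (Quotient.pi_add I). Qed.

Fact quot_mulA : associative quot_mul.
Proof. by move=> x y z; rewrite -[x]reprK -[y]reprK -[z]reprK !piE mulrA. Qed.

Fact quot_mul1l : left_id quot_one quot_mul.
Proof. by move=> x; rewrite -[x]reprK !piE mul1r. Qed.

Fact quot_mul1r : right_id quot_one quot_mul.
Proof. by move=> x; rewrite -[x]reprK !piE mulr1. Qed.

Fact quot_mulDl : left_distributive quot_mul +%R.
Proof.
move=> x y z; rewrite -[x]reprK -[y]reprK -[z]reprK.
by rewrite -pi_quot_add -!pi_quot_mul -pi_quot_add mulrDl.
Qed.

Fact quot_mulDr : right_distributive quot_mul +%R.
Proof.
move=> x y z; rewrite -[x]reprK -[y]reprK -[z]reprK.
by rewrite -pi_quot_add -!pi_quot_mul -pi_quot_add mulrDr.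
Qed.

Fact quot_one_neq0 : quot_one != 0.
Proof.
have -> : quot_one = \pi_Q 1 by rewrite piE.
have -> : 0 = \pi_Q 0 by apply: (addrI (\pi_Q 0)); rewrite -pi_quot_add !addr0.
by apply/eqP => /quot_eqP; rewrite subr0 (negPf ideal_not1).
Qed.

HB.instance Definition _ := GRing.Zmodule_isNzRing.Build Q
  quot_mulA quot_mul1l quot_mul1r quot_mulDl quot_mulDr quot_one_neq0.

Fact quot_scaleA a b x : quot_scale a (quot_scale b x) = quot_scale (a * b) x.
Proof. by rewrite -[x]reprK !piE scalerA. Qed.

Fact quot_scale1 : left_id 1 quot_scale.
Proof. by move=> x; rewrite -[x]reprK !piE scale1r. Qed.

Fact quot_scaleDr : right_distributive quot_scale +%R.
Proof.
move=> c x y; rewrite -[x]reprK -[y]reprK.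
by rewrite -pi_quot_add -!pi_quot_scale -pi_quot_add scalerDr.
Qed.

Fact quot_scaleDl x : {morph quot_scale^~ x : a b / a + b}.
Proof.
move=> a b; rewrite -[x]reprK.
by rewrite -!pi_quot_scale -pi_quot_add scalerDl.
Qed.

HB.instance Definition _ := GRing.Zmodule_isLmodule.Build k Q
  quot_scaleA quot_scale1 quot_scaleDr quot_scaleDl.

Fact quot_scaleAl c (x y : Q) : c *: (x * y) = (c *: x) * y.
Proof.
rewrite -[x]reprK -[y]reprK -[LHS]/(quot_scale c (quot_mul _ _)).
by rewrite -[RHS]/(quot_mul (quot_scale c _) _) !piE scalerAl.
Qed.

HB.instance Definition _ := GRing.Lmodule_isLalgebra.Build k Q quot_scaleAl.

Fact quot_scaleAr c (x y : Q) : c *: (x * y) = x * (c *: y).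
Proof.
rewrite -[x]reprK -[y]reprK -[LHS]/(quot_scale c (quot_mul _ _)).
by rewrite -[RHS]/(quot_mul _ (quot_scale c _)) !piE scalerAr.
Qed.

HB.instance Definition _ := GRing.Lalgebra_isAlgebra.Build k Q quot_scaleAr.

End QuotientAlgebra.

Section Algebras.
Variables (k : fieldType) (A : falgType k).
Implicit Types (M N : {vspace A}) (e f g : A).

Definition left_ideal M := ({:A} * M <= M)%VS.

Definition maximal_left_ideal M : Prop :=
  [/\ left_ideal M, M != fullv
    & forall N, left_ideal N -> (M <= N)%VS -> N = M \/ N = fullv].

Lemma radical_exists :
  exists J : {vspace A}, forall x,
    x \in J <-> forall M, maximal_left_ideal M -> x \in M.
Proof.
pose P n := `[< exists s : seq {vspace A},
  (forall M, M \in s -> maximal_left_ideal M) /\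
  \dim (\bigcap_(M <- s) M)%VS = n >].
have exP : exists n, P n by exists (\dim {:A}); apply/asboolP; exists [::];
  rewrite big_nil.
have [_ /asboolP[s [smax <-]] smin] := ex_minnP exP.
exists (\bigcap_(M <- s) M)%VS => x; split=> [xs M Mmax | xmax]; last first.
  elim: s smax {smin} => [|M s IHs] smax; first by rewrite big_nil memvf.
  rewrite big_cons memv_cap; apply/andP; split.
    exact/xmax/smax/mem_head.
  by apply: IHs => N Ns; apply: smax; rewrite in_cons Ns orbT.
have /smin le_dim : P (\dim (\bigcap_(N <- M :: s) N)%VS).
  apply/asboolP; exists (M :: s); split=> // N.
  by rewrite in_cons => /predU1P[-> | /smax].
have : (\bigcap_(N <- M :: s) N == \bigcap_(N <- s) N)%VS.
  by rewrite eqEdim le_dim big_cons capvSr.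
by rewrite big_cons => /eqP eqI; move: xs; rewrite -eqI memv_cap => /andP[].
Qed.

(* The Jacobson radical. Left ideals of A are k-subspaces, so quantifying over
   subspaces is no restriction. *)
Definition radical : {vspace A} := projT1 (cid radical_exists).

Lemma radicalP x :
  x \in radical <-> forall M, maximal_left_ideal M -> x \in M.
Proof. exact: (projT2 (cid radical_exists)). Qed.

Lemma left_idealP M :
  reflect (forall a x, x \in M -> a * x \in M) (left_ideal M).
Proof.
apply: (iffP prodvP) => [MP a x xM | MP a x _]; [exact/MP/xM/memvf|exact: MP].
Qed.

Lemma ex_maximal_left_ideal : exists M, maximal_left_ideal M.
Proof.
pose P n := `[< exists M, [/\ left_ideal M, M != fullv & \dim M = n] >].
have exP : exists n, P n.
  exists 0; apply/asboolP; exists 0%VS; split; last exact: dimv0.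
    by rewrite /left_ideal prodv0 subvv.
  by apply: contraNneq (oner_neq0 A) => A0; rewrite -memv0 A0 memvf.
have ubP n : P n -> (n <= \dim {:A})%N.
  by case/asboolP=> M [_ _ <-]; rewrite dimvS ?subvf.
have [_ /asboolP[M [Ml Mf <-]] Mmax] := ex_maxnP exP ubP.
exists M; split=> // N Nl MN.
have [-> | NF] := eqVneq N fullv; [by right | left].
apply/esym/eqP; rewrite eqEdim MN; apply: Mmax.
by apply/asboolP; exists N.
Qed.

Lemma radical_ideal_mull a : {in radical, forall x, a * x \in radical}.
Proof.
move=> x /radicalP xR; apply/radicalP => M Mmax; have [/left_idealP Ml _ _] := Mmax.
exact/Ml/xR.
Qed.

Lemma radical_ideal_mulr a : {in radical, forall x, x * a \in radical}.
Proof.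
move=> x /radicalP xR; apply/radicalP => M Mmax.
have [/left_idealP Ml Mf Mm] := Mmax.
have aE y : amulr a y = y * a by rewrite lfunE.
pose N := (amulr a @^-1: M)%VS.
have NE y : (y \in N) = (y * a \in M) by rewrite -memv_preim aE.
have Nl : left_ideal N.
  by apply/left_idealP=> b y; rewrite !NE -mulrA => /Ml.
rewrite -NE; have [-> | NF] := eqVneq N fullv; first exact: memvf.
apply: xR; split=> // L Ll NL; have /left_idealP Ll' := Ll.
have [LaM | /subvPn[_ /memv_imgP[l lL ->] laM]] := boolP (amulr a @: L <= M)%VS.
  left; apply/eqP; rewrite eqEsubv NL andbT; apply/subvP=> y yL.
  by rewrite NE -aE (subvP LaM) // memv_img.
right; apply/eqP; rewrite eqEsubv subvf; apply/subvP=> b _.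
pose K := (amulr a @: L + M)%VS.
have Kl : left_ideal K.
  apply/left_idealP=> c _ /memv_addP[_ /memv_imgP[y yL ->] [m mM ->]].
  rewrite mulrDr memv_add ?Ml // aE mulrA.
  by rewrite -aE memv_img // Ll'.
have [KM | KF] := Mm K Kl (addvSr _ _).
  by case/negP: laM; rewrite -KM (subvP (addvSl _ _)) // memv_img.
have : b * a \in K by rewrite KF memvf.
case/memv_addP=> _ /memv_imgP[y yL ->] [m mM /eqP].
rewrite aE addrC -subr_eq -mulrBl => /eqP bym.
by rewrite -[b](subrK y) memvD // (subvP NL) // NE bym.
Qed.

Definition in_radical : A -> bool := fun x => x \in radical.

Fact radical_zmod_closed : zmod_closed in_radical.
Proof. by split=> [|x y xR yR]; rewrite -[_ \in _]/(_ \in radical) ?rpred0 ?rpredB. Qed.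
HB.instance Definition _ := GRing.isZmodClosed.Build A in_radical
  radical_zmod_closed.
HB.instance Definition _ := isTwoSided.Build A in_radical
  radical_ideal_mull radical_ideal_mulr.

Fact radical_not1 : 1 \notin in_radical.
Proof.
have [M Mmax] := ex_maximal_left_ideal; have [/left_idealP Ml MF _] := Mmax.
apply: contraNN MF => /radicalP/(_ M Mmax) M1.
rewrite eqEsubv subvf; apply/subvP => x _; rewrite -[x]mulr1; exact: Ml.
Qed.
HB.instance Definition _ := isProperSubset.Build A in_radical radical_not1.

Definition radical_ideal : ptsideal A :=
  ProperTwoSidedIdeal.clone A in_radical _.

Definition basic : Prop :=
  exists n (f : {lrmorphism quot_alg radical_ideal -> {ffun 'I_n -> k^o}}),
    bijective f.

(* A, which is nonzero, is not a product of two nonzero algebras. *)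
Definition connected_alg : Prop :=
  forall e, e * e = e -> (forall a, e * a = a * e) -> e = 0 \/ e = 1.

Definition primitive_idempotent e : Prop :=
  [/\ e * e = e, e != 0
    & forall f g, f * f = f -> g * g = g -> f * g = 0 -> g * f = 0 ->
        e = f + g -> f = 0 \/ g = 0].

End Algebras.
(* Quivers are nonempty so that path algebras are nonzero. *)
Record quiver := Quiver {
  vertex : finType;
  arrow : finType;
  asrc : arrow -> vertex;
  atgt : arrow -> vertex;
  vertex_gt0 : (0 < #|vertex|)%N
}.

Section Paths.
Variable Q : quiver.
Implicit Types (x y : vertex Q) (s : seq (arrow Q)).

(* [s] lists the arrows in the order in which they are traversed. *)
Fixpoint is_path x s y : bool :=
  if s is a :: s' then (asrc a == x) && is_path (atgt a) s' y else x == y.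

Record qpath := QPath {
  path_data : vertex Q * seq (arrow Q) * vertex Q;
  _ : is_path path_data.1.1 path_data.1.2 path_data.2
}.

HB.instance Definition _ := [isSub for path_data].
(* These structures are opaque on purpose: otherwise unification unfolds the
   finite supports of elements of path algebras and diverges. *)
HB.instance Definition _ := gen_eqMixin qpath.
HB.instance Definition _ := gen_choiceMixin qpath.

Definition psrc (u : qpath) := (path_data u).1.1.
Definition parrows (u : qpath) := (path_data u).1.2.
Definition ptgt (u : qpath) := (path_data u).2.

Definition parallel (u v : qpath) := psrc u = psrc v /\ ptgt u = ptgt v.

Definition stationary x : qpath := @QPath (x, [::], x) (eqxx x).

Fact arrow_path_subproof a : is_path (asrc a) [:: a] (atgt a).
Proof. by rewrite /= !eqxx. Qed.
Definition arrow_path a : qpath := @QPath (_, _, _) (arrow_path_subproof a).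

(* Composition is from right to left: [v] is traversed first. *)
Definition pcomp (u v : qpath) : option qpath :=
  if ptgt v == psrc u then insub (psrc v, parrows v ++ parrows u, ptgt u)
  else None.

Lemma is_path_cat x s y t z :
  is_path x s y -> is_path y t z -> is_path x (s ++ t) z.
Proof.
elim: s x => [|a s IHs] x /=; first by move/eqP=> ->.
by case/andP=> -> /IHs sP /sP.
Qed.

Lemma is_path_eq x s y z : is_path x s y -> is_path x s z -> y = z.
Proof.
elim: s x => [|a s IHs] x /=; first by move/eqP=> <- /eqP.
by case/andP=> _ /IHs sP /andP[_ /sP].
Qed.

Lemma pcompP u v : ptgt v = psrc u ->
  exists2 w, pcomp u v = Some w
    & path_data w = (psrc v, parrows v ++ parrows u, ptgt u).
Proof.
move=> vu; rewrite /pcomp vu eqxx.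
have wP : is_path (psrc v) (parrows v ++ parrows u) (ptgt u).
  by apply: is_path_cat (valP v) _; rewrite -/(ptgt v) vu; apply: (valP u).
exists (@QPath (_, _, _) wP) => //.
by case: insubP => [w _ wE | /negP[]//]; congr Some; apply: val_inj.
Qed.

Lemma pcomp_eq u v w : ptgt v = psrc u ->
  path_data w = (psrc v, parrows v ++ parrows u, ptgt u) -> pcomp u v = Some w.
Proof.
by move=> /pcompP[w' -> w'E] wE; congr Some; apply: val_inj; rewrite /= wE.
Qed.

Lemma pcompN u v : ptgt v != psrc u -> pcomp u v = None.
Proof. by rewrite /pcomp => /negPf ->. Qed.

Lemma pcompA u v w : obind (pcomp u) (pcomp v w) = obind (pcomp^~ w) (pcomp u v).
Proof.
have [wv | wv] := eqVneq (ptgt w) (psrc v); have [vu | vu] := eqVneq (ptgt v) (psrc u).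
- have [p -> pE] := pcompP wv; have [q -> qE] := pcompP vu => /=.
  have pu : ptgt p = psrc u by rewrite /ptgt pE.
  have wq : ptgt w = psrc q by rewrite /psrc qE.
  have [l -> lE] := pcompP pu; have [r -> rE] := pcompP wq.
  congr Some; apply: val_inj; rewrite /= lE rE.
  by rewrite /psrc /parrows /ptgt pE qE /= catA.
- have [p -> pE] := pcompP wv; rewrite (pcompN vu) /= pcompN //.
  by rewrite /ptgt pE.
- have [q -> qE] := pcompP vu; rewrite (pcompN wv) /= pcompN //.
  by rewrite /psrc qE.
- by rewrite !pcompN.
Qed.

Lemma pcomp1l u : pcomp (stationary (ptgt u)) u = Some u.
Proof.
have [|w -> wE] := @pcompP (stationary (ptgt u)) u; first by [].
congr Some; apply: val_inj; rewrite /= wE /= cats0 /psrc /parrows /ptgt.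
by case: (path_data u) => [[]].
Qed.

Lemma pcomp1r u : pcomp u (stationary (psrc u)) = Some u.
Proof.
have [|w -> wE] := @pcompP u (stationary (psrc u)); first by [].
congr Some; apply: val_inj; rewrite /= wE /= /psrc /parrows /ptgt.
by case: (path_data u) => [[]].
Qed.

Definition no_oriented_cycle : Prop :=
  forall u : qpath, psrc u = ptgt u -> parrows u = [::].

Definition bypass (a : arrow Q) (u : qpath) : Prop :=
  parallel u (arrow_path a) /\ u <> arrow_path a.

Definition double_bypass a u b v : Prop :=
  [/\ bypass a u, bypass b v & b \in parrows u].

Definition no_double_bypass : Prop :=
  forall a u b v, ~ double_bypass a u b v.

End Paths.

Definition path_alg (k : fieldType) (Q : quiver) := {malg k[qpath Q]}.

HB.instance Definition _ (k : fieldType) (Q : quiver) :=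
  GRing.Lmodule.on (path_alg k Q).

HB.lock Definition pbasis (k : fieldType) (Q : quiver) (u : qpath Q) :
  path_alg k Q := << u >>.

Definition pbasis_mul (k : fieldType) (Q : quiver) (u v : qpath Q) :
  path_alg k Q := oapp (@pbasis k Q) 0 (pcomp u v).

HB.lock Definition path_mul (k : fieldType) (Q : quiver) (f g : path_alg k Q) :
    path_alg k Q :=
  \sum_(u <- msupp f) \sum_(v <- msupp g) (f@_u * g@_v) *: pbasis_mul k u v.

Section PathAlgebra.
Variables (k : fieldType) (Q : quiver).

Notation kQ := (path_alg k Q).
Implicit Types (u v w : qpath Q) (f g h : kQ).

Notation pbasis := (@pbasis k Q).
Notation pbasis_mul := (@pbasis_mul k Q).
Notation path_mul := (@path_mul k Q).

Lemma pbasis_coef u v : (pbasis u)@_v = (u == v)%:R.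
Proof. by rewrite pbasis.unlock; apply: mcoeffU. Qed.

Lemma pbasisZ (c : k) u : << c *g u >> = c *: pbasis u.
Proof.
by apply/malgP => v; rewrite mcoeffZ pbasis_coef mcoeffU mulr_natr.
Qed.

Lemma msupp_pbasis u : (msupp (pbasis u) `<=` [fset u])%fset.
Proof. by rewrite pbasis.unlock; apply: msuppU_le. Qed.

Definition path_one : kQ := \sum_(x : vertex Q) pbasis (stationary x).

Section Lift.
Variables (V : lmodType k) (F : qpath Q -> V).

Definition plift f : V := \sum_(u <- msupp f) f@_u *: F u.

Lemma plift_widen (d : {fset qpath Q}) f :
  (msupp f `<=` d)%fset -> plift f = \sum_(u <- d) f@_u *: F u.
Proof.
move=> fd; apply: big_fset_incl => // u _ /mcoeff_outdom ->.
by rewrite scale0r.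
Qed.

Lemma plift_linear : linear plift.
Proof.
move=> c f g; pose d := (msupp f `|` msupp g `|` msupp (c *: f + g))%fset.
have fd : (msupp f `<=` d)%fset by rewrite /d -fsetUA fsubsetUl.
have gd : (msupp g `<=` d)%fset.
  by rewrite /d fsetUAC fsubsetUr.
have cd : (msupp (c *: f + g) `<=` d)%fset by rewrite fsubsetUr.
rewrite (plift_widen fd) (plift_widen gd) (plift_widen cd).
rewrite scaler_sumr -big_split; apply: eq_bigr => u _ /=.
by rewrite mcoeffD mcoeffZ scalerDl scalerA.
Qed.

Lemma plift_basis u : plift (pbasis u) = F u.
Proof.
rewrite (plift_widen (msupp_pbasis u)) big_seq_fset1 pbasis_coef eqxx.
by rewrite scale1r.
Qed.

Lemma linear_plift (G : kQ -> V) :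
  linear G -> (forall u, G (pbasis u) = F u) -> G =1 plift.
Proof.
move=> Glin GF f.
pose L : {linear kQ -> V} := HB.pack G (GRing.isLinear.Build _ _ _ _ G Glin).
have LZ c x : c *: G x = L (c *: x) by rewrite linearZ.
rewrite -[LHS]/(L f) [in LHS](monalgE f) linear_sum; apply: eq_bigr => u _.
by rewrite -GF LZ pbasisZ.
Qed.

End Lift.

Lemma linear_basis_eq (V : lmodType k) (F G : kQ -> V) :
  linear F -> linear G -> (forall u, F (pbasis u) = G (pbasis u)) -> F =1 G.
Proof.
move=> Fl Gl FG f; rewrite (linear_plift Fl FG).
by rewrite (linear_plift Gl (fun u => erefl)).
Qed.

Lemma path_mulE f g : path_mul f g = plift (fun u => plift (pbasis_mul u) g) f.
Proof.
rewrite path_mul.unlock; apply: eq_bigr => u _; rewrite scaler_sumr.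
by apply: eq_bigr => v _; rewrite scalerA.
Qed.

Lemma path_mul_linearl g : linear (path_mul^~ g).
Proof. by move=> c f h; rewrite !path_mulE plift_linear. Qed.

Lemma path_mul_linearr f : linear (path_mul f).
Proof.
move=> c g h; rewrite !path_mulE scaler_sumr -big_split.
by apply: eq_bigr => u _ /=; rewrite plift_linear scalerDr !scalerA mulrC.
Qed.

Lemma path_mul_basis u v : path_mul (pbasis u) (pbasis v) = pbasis_mul u v.
Proof. by rewrite path_mulE !plift_basis. Qed.

Fact path_mulDl : left_distributive path_mul +%R.
Proof.
by move=> f g h; have := path_mul_linearl h 1 f g; rewrite !scale1r.
Qed.

Fact path_mulDr : right_distributive path_mul +%R.
Proof.
by move=> f g h; have := path_mul_linearr f 1 g h; rewrite !scale1r.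
Qed.

Fact path_mul0l g : path_mul 0 g = 0.
Proof. by apply: (addrI (path_mul 0 g)); rewrite -path_mulDl !addr0. Qed.

Fact path_mul0r f : path_mul f 0 = 0.
Proof. by apply: (addrI (path_mul f 0)); rewrite -path_mulDr !addr0. Qed.

Fact path_mulA : associative path_mul.
Proof.
move=> f g h; move: f; apply: linear_basis_eq.
- exact: path_mul_linearl.
- by move=> c f f'; rewrite !path_mul_linearl.
move=> u; move: g; apply: linear_basis_eq.
- by move=> c g g'; rewrite path_mul_linearl path_mul_linearr.
- by move=> c g g'; rewrite path_mul_linearr path_mul_linearl.
move=> v; move: h; apply: linear_basis_eq.
- by move=> c g g'; rewrite !path_mul_linearr.
- exact: path_mul_linearr.
move=> w; rewrite !path_mul_basis.
transitivity (oapp pbasis 0 (obind (pcomp u) (pcomp v w))).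
  rewrite /pbasis_mul; case: (pcomp v w) => [p|] /=; last exact: path_mul0r.
  exact: path_mul_basis.
rewrite pcompA /pbasis_mul; case: (pcomp u v) => [p|] /=.
  by rewrite path_mul_basis.
by rewrite path_mul0l.
Qed.

Fact path_mul1l : left_id path_one path_mul.
Proof.
apply: linear_basis_eq; [exact: path_mul_linearr | by [] | move=> u].
pose L : {linear kQ -> kQ} := HB.pack (path_mul^~ (pbasis u))
  (GRing.isLinear.Build _ _ _ _ _ (path_mul_linearl (pbasis u))).
rewrite -[LHS]/(L path_one) linear_sum (bigD1 (ptgt u)) //= big1 => [|x xu].
  by rewrite addr0 path_mul_basis /pbasis_mul pcomp1l.
by rewrite path_mul_basis /pbasis_mul pcompN // eq_sym.
Qed.

Fact path_mul1r : right_id path_one path_mul.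
Proof.
apply: linear_basis_eq; [exact: path_mul_linearl | by [] | move=> u].
pose L : {linear kQ -> kQ} := HB.pack (path_mul (pbasis u))
  (GRing.isLinear.Build _ _ _ _ _ (path_mul_linearr (pbasis u))).
rewrite -[LHS]/(L path_one) linear_sum (bigD1 (psrc u)) //= big1 => [|x xu].
  by rewrite addr0 path_mul_basis /pbasis_mul pcomp1r.
by rewrite path_mul_basis /pbasis_mul pcompN.
Qed.

Fact path_one_neq0 : path_one != 0.
Proof.
have /card_gt0P[x _] := vertex_gt0 Q.
apply/eqP => /malgP/(_ (stationary x))/eqP.
rewrite mcoeff0 raddf_sum (bigD1 x) //= pbasis_coef eqxx big1 => [|y yx].
  by rewrite addr0 oner_eq0.
rewrite pbasis_coef; case: eqP => // yxE.
by move: yx; rewrite -[y]/(psrc (stationary y)) yxE eqxx.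
Qed.

HB.instance Definition _ := GRing.Zmodule_isNzRing.Build kQ
  path_mulA path_mul1l path_mul1r path_mulDl path_mulDr path_one_neq0.

Fact path_scaleAl c (f g : kQ) : c *: (f * g) = (c *: f) * g.
Proof.
have := path_mul_linearl g c f 0.
by rewrite path_mul0l !addr0 => /esym.
Qed.

HB.instance Definition _ := GRing.Lmodule_isLalgebra.Build k kQ path_scaleAl.

Fact path_scaleAr c (f g : kQ) : c *: (f * g) = f * (c *: g).
Proof.
have := path_mul_linearr f c g 0.
by rewrite path_mul0r !addr0 => /esym.
Qed.

HB.instance Definition _ := GRing.Lalgebra_isAlgebra.Build k kQ path_scaleAr.

(* Membership in (kQ^+)^n, the ideal generated by the paths of length n. *)
Definition path_power (n : nat) (f : kQ) : Prop :=
  forall S : tsideal kQ,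
    (forall u, size (parrows u) = n -> pbasis u \in S) -> f \in S.

Definition admissible (I : ptsideal kQ) : Prop :=
  (exists n, forall f, path_power n f -> f \in I)
  /\ (forall f, f \in I -> path_power 2 f).

Definition minimal_relation (I : ptsideal kQ) (n : nat)
    (t : 'I_n -> k) (u : 'I_n -> qpath Q) : Prop :=
  [/\ (2 <= n)%N,
      forall i, t i != 0,
      injective u,
      \sum_i t i *: pbasis (u i) \in I
    & forall E : {set 'I_n}, E != set0 -> E \proper setT ->
        \sum_(i in E) t i *: pbasis (u i) \notin I].

End PathAlgebra.

Definition alg_isomorphic (k : fieldType) (B C : algType k) : Prop :=
  exists f : {lrmorphism B -> C}, bijective f.

(* With paths composed from right to left, arrows x -> y correspond to a basis
   of e_y (rad A / rad^2 A) e_x, which is e_y (rad A) e_x / e_y (rad^2 A) e_x.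
   As A is basic, the vertices are indexed by a complete set of primitive
   orthogonal idempotents. *)
Definition ordinary_quiver (k : fieldType) (A : falgType k) (Q : quiver) :
    Prop :=
  exists e : vertex Q -> A,
    [/\ forall x, primitive_idempotent (e x),
        forall x y, x != y -> e x * e y = 0,
        \sum_x e x = 1
      & forall x y,
          #|[set a : arrow Q | (asrc a == x) && (atgt a == y)]| =
          (\dim (<[e y]> * radical A * <[e x]>)%VS -
           \dim (<[e y]> * (radical A * radical A) * <[e x]>)%VS)%N].

(* The arrows [inr a] are the formal inverses. *)
Definition double_quiver (Q : quiver) : quiver :=
  @Quiver (vertex Q) (arrow Q + arrow Q)%type
    (fun b => match b with inl a => asrc a | inr a => atgt a end)
    (fun b => match b with inl a => atgt a | inr a => asrc a end)
    (vertex_gt0 Q).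

Definition walk (Q : quiver) := qpath (double_quiver Q).

Section Walks.
Variable Q : quiver.
Implicit Types (a : arrow Q) (u v w : walk Q).

Definition walk1 (x : vertex Q) : walk Q := @stationary (double_quiver Q) x.
Definition fwd a : walk Q := @arrow_path (double_quiver Q) (inl a).
Definition bwd a : walk Q := @arrow_path (double_quiver Q) (inr a).

Fact walk_of_path_subproof (u : qpath Q) :
  @is_path (double_quiver Q) (psrc u) (map inl (parrows u)) (ptgt u).
Proof.
case: u => [[[x s] y] /= uP]; rewrite /psrc /parrows /ptgt /=.
by elim: s x uP => //= a s IHs x /andP[-> /IHs].
Qed.

Definition walk_of_path (u : qpath Q) : walk Q :=
  @QPath (double_quiver Q) (_, _, _) (walk_of_path_subproof u).

Definition inv_step (b : arrow (double_quiver Q)) : arrow (double_quiver Q) :=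
  match b with inl a => inr a | inr a => inl a end.

Definition inv_steps (s : seq (arrow (double_quiver Q))) :=
  rev (map inv_step s).

Lemma asrc_inv b : asrc (inv_step b) = atgt b.
Proof. by case: b. Qed.

Lemma atgt_inv b : atgt (inv_step b) = asrc b.
Proof. by case: b. Qed.

Lemma inv_stepsK : involutive inv_steps.
Proof.
move=> s; rewrite /inv_steps map_rev revK -map_comp map_id_in // => b _ /=.
by case: b.
Qed.

Lemma inv_steps_path x s y :
  @is_path (double_quiver Q) x s y ->
  @is_path (double_quiver Q) y (inv_steps s) x.
Proof.
elim: s x => [|b s IHs] x; first by rewrite /= eq_sym.
case/andP=> /eqP <- /IHs sP; rewrite /inv_steps map_cons rev_cons -cats1.
by apply: is_path_cat sP _; case: b => a /=; rewrite !eqxx.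
Qed.

Definition walk_inv w : walk Q :=
  @QPath (double_quiver Q) (ptgt w, inv_steps (parrows w), psrc w)
    (inv_steps_path (valP w)).

End Walks.

Section Homotopy.
Variables (k : fieldType) (Q : quiver) (I : ptsideal (path_alg k Q)).

Inductive homotopic : walk Q -> walk Q -> Prop :=
| homotopic_refl u : homotopic u u
| homotopic_sym u v : homotopic u v -> homotopic v u
| homotopic_trans u v w : homotopic u v -> homotopic v w -> homotopic u w
| homotopic_cat u u' v v' w w' :
    homotopic u u' -> homotopic v v' ->
    pcomp u v = Some w -> pcomp u' v' = Some w' -> homotopic w w'
| homotopic_arrV a w :
    pcomp (fwd a) (bwd a) = Some w -> homotopic w (walk1 (atgt a))
| homotopic_Varr a w :
    pcomp (bwd a) (fwd a) = Some w -> homotopic w (walk1 (asrc a))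
| homotopic_rel n (t : 'I_n -> k) (u : 'I_n -> qpath Q) (i j : 'I_n) :
    minimal_relation I t u ->
    homotopic (walk_of_path (u i)) (walk_of_path (u j)).

Lemma homotopic_step (b : arrow (double_quiver Q)) (w : walk Q) :
  pcomp (arrow_path (inv_step b)) (arrow_path b) = Some w ->
  homotopic w (@walk1 Q (asrc b)).
Proof. case: b => a; [exact: homotopic_Varr | exact: homotopic_arrV]. Qed.

Lemma homotopic_inv_steps x s y (z : walk Q) :
  @is_path (double_quiver Q) x s y ->
  path_data z = (x, s ++ inv_steps s, x) -> homotopic z (@walk1 Q x).
Proof.
elim: s x z => [|b s IHs] x z /=.
  move=> _ zE; have -> : z = @walk1 Q x by exact: val_inj.
  exact: homotopic_refl.
case/andP=> /eqP <- sP zE.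
have z'P := is_path_cat sP (inv_steps_path sP).
pose z' : walk Q := @QPath (double_quiver Q) (_, _, _) z'P.
have z'1 : homotopic z' (@walk1 Q (atgt b)) by exact: IHs sP _.
have [|m mS mE] := @pcompP _ z' (arrow_path b); first by [].
have mb : homotopic m (arrow_path b).
  apply: homotopic_cat z'1 (homotopic_refl (arrow_path b)) mS _.
  exact: (pcomp1l (arrow_path b)).
have msrc : psrc m = asrc b by rewrite /psrc mE.
have mtgt : ptgt m = psrc (arrow_path (inv_step b)).
  by rewrite /ptgt mE; exact: esym (asrc_inv b).
have [|c cS cE] := @pcompP _ (arrow_path (inv_step b)) (arrow_path b).
  exact: esym (asrc_inv b).
apply: homotopic_trans (homotopic_step cS).
apply: homotopic_cat (homotopic_refl _) mb _ cS.
apply: pcomp_eq mtgt _; rewrite zE msrc /parrows mE /=.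
rewrite /inv_steps map_cons rev_cons -cats1 catA.
by congr (_, _, _); exact: esym (atgt_inv b).
Qed.

Lemma homotopic_invl (w z : walk Q) :
  pcomp (walk_inv w) w = Some z -> homotopic z (@walk1 Q (psrc w)).
Proof.
have [|z' -> zE [<-]] := @pcompP _ (walk_inv w) w; first by [].
exact: homotopic_inv_steps (valP w) zE.
Qed.

Lemma homotopic_invr (w z : walk Q) :
  pcomp w (walk_inv w) = Some z -> homotopic z (@walk1 Q (ptgt w)).
Proof.
have [|z' -> zE [<-]] := @pcompP _ w (walk_inv w); first by [].
apply: homotopic_inv_steps (valP (walk_inv w)) _.
by rewrite zE [inv_steps _]inv_stepsK.
Qed.

End Homotopy.

Section FundamentalGroup.
Variables (k : fieldType) (Q : quiver) (I : ptsideal (path_alg k Q)).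
Variable x0 : vertex Q.

Record loop := Loop {
  loop_walk : walk Q;
  _ : (psrc loop_walk == x0) && (ptgt loop_walk == x0)
}.

HB.instance Definition _ := [isSub for loop_walk].
HB.instance Definition _ := [Choice of loop by <:].

Implicit Types p q r : loop.

Lemma loop_src p : psrc (loop_walk p) = x0.
Proof. by case/andP: (valP p) => /eqP. Qed.

Lemma loop_tgt p : ptgt (loop_walk p) = x0.
Proof. by case/andP: (valP p) => _ /eqP. Qed.

Fact loop1_subproof : (psrc (walk1 x0) == x0) && (ptgt (walk1 x0) == x0).
Proof. by rewrite !eqxx. Qed.
Definition loop1 : loop := Loop loop1_subproof.

Fact loop_mul_subproof p q :
  let w := odflt (walk1 x0) (pcomp (loop_walk p) (loop_walk q)) in
  (psrc w == x0) && (ptgt w == x0).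
Proof.
have [|w -> wE] /= := @pcompP _ (loop_walk p) (loop_walk q).
  by rewrite loop_src loop_tgt.
by rewrite /psrc /ptgt wE /= loop_src loop_tgt !eqxx.
Qed.
Definition loop_mul p q : loop := Loop (loop_mul_subproof p q).

Lemma loop_mulE p q :
  pcomp (loop_walk p) (loop_walk q) = Some (loop_walk (loop_mul p q)).
Proof.
have [|w wS wE] /= := @pcompP _ (loop_walk p) (loop_walk q).
  by rewrite loop_src loop_tgt.
by rewrite wS.
Qed.

Fact loop_inv_subproof p :
  (psrc (walk_inv (loop_walk p)) == x0) && (ptgt (walk_inv (loop_walk p)) == x0).
Proof.
by rewrite -[psrc _]/(ptgt (loop_walk p)) -[ptgt (walk_inv _)]/(psrc (loop_walk p))
  loop_src loop_tgt eqxx.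
Qed.
Definition loop_inv p : loop := Loop (loop_inv_subproof p).

Definition loop_homotopic p q := `[< homotopic I (loop_walk p) (loop_walk q) >].

Fact loop_homotopic_equiv : equiv_class_of loop_homotopic.
Proof.
split=> [p | p q | q p r].
- exact/asboolP/homotopic_refl.
- by apply/asboolP/asboolP; apply: homotopic_sym.
- by move=> /asboolP pq /asboolP qr; apply/asboolP/homotopic_trans/qr.
Qed.

Canonical loop_equiv_rel := EquivRelPack loop_homotopic_equiv.

Definition fundamental_group := {eq_quot loop_homotopic}.

Local Notation pi1 := fundamental_group.

HB.instance Definition _ := Choice.on pi1.

Definition pi1_one : pi1 := \pi_pi1 loop1.
Definition pi1_mul (a b : pi1) : pi1 := \pi_pi1 (loop_mul (repr a) (repr b)).
Definition pi1_inv (a : pi1) : pi1 := \pi_pi1 (loop_inv (repr a)).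

Lemma pi1_eqP p q :
  reflect (homotopic I (loop_walk p) (loop_walk q)) (p == q %[mod pi1]).
Proof. by rewrite eqmodE; apply: asboolP. Qed.

Lemma pi1_mulE p q : pi1_mul (\pi_pi1 p) (\pi_pi1 q) = \pi_pi1 (loop_mul p q).
Proof.
apply/eqP/pi1_eqP; apply: homotopic_cat (loop_mulE _ _) (loop_mulE _ _).
  by apply/pi1_eqP; rewrite reprK.
by apply/pi1_eqP; rewrite reprK.
Qed.

Fact pi1_mulA : associative pi1_mul.
Proof.
move=> a b c; rewrite -[a]reprK -[b]reprK -[c]reprK.
move: (repr a) (repr b) (repr c) => p q r.
rewrite (pi1_mulE q r) (pi1_mulE p q) (pi1_mulE p) (pi1_mulE _ r).
congr (\pi_pi1 _); apply: val_inj; apply: Some_inj.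
have := pcompA (loop_walk p) (loop_walk q) (loop_walk r).
by rewrite (loop_mulE q r) (loop_mulE p q) /= !loop_mulE.
Qed.

Fact pi1_mul1l : left_id pi1_one pi1_mul.
Proof.
move=> a; rewrite -[a]reprK pi1_mulE; congr (\pi_pi1 _); apply: val_inj.
by apply: Some_inj; rewrite -loop_mulE -[RHS]pcomp1l loop_tgt.
Qed.

Fact pi1_mul1r : right_id pi1_one pi1_mul.
Proof.
move=> a; rewrite -[a]reprK pi1_mulE; congr (\pi_pi1 _); apply: val_inj.
by apply: Some_inj; rewrite -loop_mulE -[RHS]pcomp1r loop_src.
Qed.

Fact pi1_mulVl : left_inverse pi1_one pi1_inv pi1_mul.
Proof.
move=> a; rewrite -[in X in pi1_mul _ X](reprK a) pi1_mulE.
apply/eqP/pi1_eqP; move: (repr a) => p.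
have := @homotopic_invl _ _ I (loop_walk p) _ (loop_mulE (loop_inv p) p).
by rewrite loop_src.
Qed.

Fact pi1_mulVr : right_inverse pi1_one pi1_inv pi1_mul.
Proof.
move=> a; rewrite -[in X in pi1_mul X _](reprK a) pi1_mulE.
apply/eqP/pi1_eqP; move: (repr a) => p.
have := @homotopic_invr _ _ I (loop_walk p) _ (loop_mulE p (loop_inv p)).
by rewrite loop_tgt.
Qed.

HB.instance Definition _ := isGroup.Build pi1
  pi1_mulA pi1_mul1l pi1_mul1r pi1_mulVl pi1_mulVr.

End FundamentalGroup.

(* Main.v *)
From HB Require Import structures.
Require Import Defs.
From mathcomp Require Import all_boot all_order all_algebra all_field.
From mathcomp Require Import boolp finmap.
From mathcomp.multinomials Require Import monalg.
From mathcomp Require Import ring.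

Set Implicit Arguments.
Unset Strict Implicit.
Unset Printing Implicit Defensive.

Import GRing.Theory.
Local Open Scope ring_scope.
Local Open Scope quotient_scope.

Local Notation pcomp := Defs.pcomp.

(** A presentation of [A] determines a morphism [g : kQ -> A] up to conjugation,
    and two presentations differ by a relabelling of the quiver (with nonzero
    scalars) and by a transvection [a |-> a + t a], where [t a] is a combination
    of the bypasses of the arrow [a]. As there are no double bypasses, the arrows
    occurring in a bypass are fixed by every transvection; hence transvections
    form a vector group, and the transvection along [t] is the exponential of the
    nilpotent derivation [a |-> t a].

    Choose [t0] such that the homotopy relation of [I = exp(t0)(ker g)] has the
    fewest homotopic pairs of paths, and let [J = exp(t)(ker g)]. Split
    [t - t0 = d1 + d2 + d3], where [d1] collects the bypasses [(a, u)] with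
    [a ~_I u] and [d2] the other ones with [a ~_J u]. An ideal is graded by its
    own homotopy classes, and the homotopy relation of an ideal graded by the
    classes of [~] is contained in [~]. So [I' = exp(d1)(I)] is graded by [~_I],
    and by minimality has the same homotopy relation, while
    [J' = exp(-d2)(J)] is graded by [~_J]. Now [J' = exp(d3)(I')], and the
    derivation [d3] changes the classes of both gradings; in characteristic zero
    this forces [d3] to preserve [I'], whence [I' = J'] and [~_I] is contained in
    [~_J]. *)

(** Walks depend on the quiver alone, so once the homotopy relation of one ideal is contained in
    that of another, sending the class of a loop to its class is a surjection of fundamental groups.
    What has to be found is a relation lying below all others. A relation with the fewest pairs is a
    priori only minimal; the splitting of [t - t0] turns minimal into least, by isolating in [d3]
    the part of the difference that is incompatible with both gradings. A transvection whose
    bypasses are homotopic to their arrows is harmless, since it commutes with the projections of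
    the grading. For [d3] the opposite extreme holds: homotopy of walks is cancellative, so
    replacing one arrow of a path by a bypass not homotopic to it gives a path not homotopic to the
    original, and [d3] has no component that keeps a class. Characteristic zero enters through the
    division by [i!] that makes the degree [i] part of a transvection a power of its linear part.
    Acyclicity bounds the length of a path by the number of vertices: this cuts off the exponential
    series, ends the filtration by length and makes the set of pairs of paths finite. *)

(** * Subspaces as predicates, and exponentials on a filtered space with two gradings *)

Section Subspaces.
Variables (k : fieldType) (V : lmodType k).
Implicit Types (M G : V -> Prop) (x y : V).

Definition subspace M : Prop :=
  M 0 /\ forall c x y, M x -> M y -> M (c *: x + y).

Lemma subspace0 M : subspace M -> M 0. Proof. by case. Qed.

Lemma subspaceD M x y : subspace M -> M x -> M y -> M (x + y).
Proof. by case=> _ MP xM; rewrite -[x]scale1r; apply: MP. Qed.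

Lemma subspaceZ M c x : subspace M -> M x -> M (c *: x).
Proof. by case=> M0 MP xM; rewrite -[_ *: _]addr0; apply: MP. Qed.

Lemma subspaceN M x : subspace M -> M x -> M (- x).
Proof. by move=> Ms xM; rewrite -scaleN1r; apply: subspaceZ. Qed.

Lemma subspaceB M x y : subspace M -> M x -> M y -> M (x - y).
Proof. by move=> Ms xM yM; apply: subspaceD => //; apply: subspaceN. Qed.

Lemma subspace_sum M (I : Type) (r : seq I) (P : pred I) (f : I -> V) :
  subspace M -> (forall i, P i -> M (f i)) -> M (\sum_(i <- r | P i) f i).
Proof.
move=> Ms fM; apply: big_ind => //; first exact: subspace0.
by move=> x y; apply: subspaceD.
Qed.

Definition subspace_add M G x : Prop :=
  exists2 y, M y & G (x - y).

Lemma subspace_addP M G : subspace M -> subspace G -> subspace (subspace_add M G).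
Proof.
move=> Ms Gs; split=> [|c x y [x1 x1M x2G] [y1 y1M y2G]].
  by exists 0; [apply: subspace0 | rewrite subr0; apply: subspace0].
exists (c *: x1 + y1); first by apply: Ms.2.
have -> : c *: x + y - (c *: x1 + y1) = c *: (x - x1) + (y - y1).
  by rewrite scalerBr opprD addrACA.
exact: Gs.2.
Qed.

Lemma subspace_addl M G x : subspace G -> M x -> subspace_add M G x.
Proof. by move=> Gs xM; exists x => //; rewrite subrr; apply: subspace0. Qed.

Lemma subspace_addr M G x : subspace M -> G x -> subspace_add M G x.
Proof. by move=> Ms xG; exists 0; rewrite ?subr0 //; apply: subspace0. Qed.

Lemma subspace_add_stable M M' G (h : {linear V -> V}) x :
  (forall y, M y -> M' (h y)) -> (forall y, G y -> G (h y)) ->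
  subspace_add M G x -> subspace_add M' G (h x).
Proof.
by move=> hM hG [y yM yG]; exists (h y); [apply: hM | rewrite -linearB; apply: hG].
Qed.

End Subspaces.

(* Descending induction on the filtration: if [x] in [I] has degree [i] for [p],
   then [y := p i (Psi (q j (Phi x)))] has degree [i] for [p], and [Phi y] has
   degree [j] for [q] up to the part [M] of [I] lying deeper in the filtration.
   Modulo [M], the leading terms of [Phi y - y] then lie in components which [N]
   cannot reach, so that [N y] vanishes. *)
Section GradedExponential.
Variables (k : fieldType) (V : lmodType k) (L m : nat).
Variables (N : {linear V -> V}) (Phi Psi : {linear V -> V}).
Variables (p q : 'I_m -> {linear V -> V}) (F : nat -> V -> Prop).
Variable I : V -> Prop.

Hypothesis PhiE : forall x,
  Phi x = x + N x + \sum_(i < L) (i.+2)`!%:R^-1 *: iter i.+2 N x.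
Hypothesis PsiE : forall x,
  Psi x = \sum_(i < L) ((-1) ^+ i / i`!%:R) *: iter i N x.
Hypothesis PhiK : cancel Phi Psi.
Hypothesis PsiK : cancel Psi Phi.

Hypothesis F_sub : forall i, subspace (F i).
Hypothesis F_top : forall x, F 0 x.
Hypothesis F_bot : forall x, F L x -> x = 0.
Hypothesis F_mono : forall i x, F i.+1 x -> F i x.
Hypothesis N_F : forall i x, F i x -> F i.+1 (N x).

Hypothesis p_id : forall i x, p i (p i x) = p i x.
Hypothesis q_id : forall i x, q i (q i x) = q i x.
Hypothesis p_sum : forall x, \sum_i p i x = x.
Hypothesis q_sum : forall x, \sum_i q i x = x.
Hypothesis pq_comm : forall i j x, p i (q j x) = q j (p i x).
Hypothesis p_F : forall i j x, F j x -> F j (p i x).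
Hypothesis q_F : forall i j x, F j x -> F j (q i x).
Hypothesis pNp : forall i x, p i (N (p i x)) = 0.
Hypothesis qNq : forall i x, q i (N (q i x)) = 0.

Hypothesis I_sub : subspace I.
Hypothesis I_p : forall i x, I x -> I (p i x).
(** The second grading is one of the image of [I] under [Phi], transported back by [Psi]; it is not
    a grading of [I] itself. *)
Hypothesis I_q : forall i x, I x -> I (Psi (q i (Phi x))).

Lemma sub_sub_sub (a b c d : V) : (a - c) - (b - d) = (a - b) - (c - d).
Proof. by rewrite !opprB addrACA [RHS]addrACA [- b - c]addrC. Qed.

Lemma stable_iter (M : V -> Prop) i x :
  (forall x, M x -> M (N x)) -> M x -> M (iter i N x).
Proof. by move=> NM xM; elim: i => //= i; apply: NM. Qed.

Lemma stable_Phi (M : V -> Prop) x :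
  subspace M -> (forall x, M x -> M (N x)) -> M x -> M (Phi x).
Proof.
move=> Ms NM xM; rewrite PhiE; apply: subspaceD => //.
  by apply: subspaceD => //; apply: NM.
apply: subspace_sum => // i _; apply: subspaceZ => //; exact: stable_iter.
Qed.

Lemma stable_Psi (M : V -> Prop) x :
  subspace M -> (forall x, M x -> M (N x)) -> M x -> M (Psi x).
Proof.
move=> Ms NM xM; rewrite PsiE.
apply: subspace_sum => // i _; apply: subspaceZ => //; exact: stable_iter.
Qed.

Lemma F_stable i x : F i x -> F i (N x).
Proof. by move=> /N_F/F_mono. Qed.

(** If [N y] lies in [F l + M], the higher terms of the exponential lie in [F l.+1 + M], and modulo
    that space [y + N y] may replace [Phi y]. Applying [p i], which kills [N y], gives [y = q j y];
    then [N y = q j (N y)] and [q j (N y) = q j (N (q j y)) = 0], all modulo [F l.+1 + M]. *)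
Lemma nilpotent_of_almost_homogeneous (M : V -> Prop) i j y :
  subspace M -> (forall x, M x -> M (N x)) ->
  (forall x, M x -> M (p i x)) -> (forall x, M x -> M (q j x)) ->
  p i y = y -> M (Phi y - q j (Phi y)) -> M (N y).
Proof.
move=> Ms NM pM qM py qy.
pose G l := subspace_add (F l) M.
have Gs l : subspace (G l) by apply: subspace_addP.
have pG l x : G l x -> G l (p i x) by apply: subspace_add_stable => //; apply: p_F.
have qG l x : G l x -> G l (q j x) by apply: subspace_add_stable => //; apply: q_F.
have NG l x : G l x -> G l.+1 (N x) by apply: subspace_add_stable => //; apply: N_F.
have NG' l x : G l x -> G l (N x).
  by apply: subspace_add_stable => //; apply: F_stable.
suff NyG l : G l (N y).
  by have [f /F_bot ->] := NyG L; rewrite subr0.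
elim: l => [|l IHl]; first exact: subspace_addl.
have restG : G l.+1 (Phi y - (y + N y)).
  rewrite PhiE addrC addKr; apply: subspace_sum => // r _; apply: subspaceZ => //.
  rewrite iterS -iterS iterSr iterS; apply: NG.
  by elim: (nat_of_ord r) => //= r' IHr; apply: NG'.
have Gdiff : G l.+1 (y + N y - q j (y + N y)).
  have -> : y + N y - q j (y + N y) = (Phi y - q j (Phi y))
     - ((Phi y - (y + N y)) - q j (Phi y - (y + N y))).
    by rewrite [q j (_ - _ :> V)]linearB [X in _ = _ - X]sub_sub_sub subKr.
  apply: subspaceB => //; first exact: subspace_addr.
  by apply: subspaceB => //; apply: qG.
have Gqy : G l.+1 (y - q j y).
  have := pG _ _ Gdiff; rewrite linearB linearD /= py pq_comm linearD /= py.
  by rewrite -[in N y]py pNp addr0.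
have GqN : G l.+1 (N y - q j (N y)).
  have -> : N y - q j (N y) = (y + N y - q j (y + N y)) - (y - q j y).
    by rewrite linearD /= opprD addrACA addrC addrK.
  exact: subspaceB.
have := subspaceD (Gs _) GqN (qG _ _ (NG' _ _ Gqy)).
by rewrite [N (_ - _)]linearB [q j (_ - _)]linearB /= qNq subr0 subrK.
Qed.

Lemma graded_exponential_stable x : I x -> I (N x).
Proof.
suff PL r : forall l x, (r + l)%N = L -> I x -> F l x -> I (N x).
  by move=> xI; apply: (PL L 0) => //; rewrite addn0.
elim: r => [|r IHr] l {}x.
  by rewrite add0n => -> _ /F_bot ->; rewrite linear0; apply: subspace0.
rewrite addSnnS => rl xI xF.
pose M y := I y /\ F l.+1 y.
have Ms : subspace M.
  split=> [|c y z [yI yF] [zI zF]]; first by split; apply: subspace0.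
  by split; [apply: I_sub.2 | apply: (F_sub _).2].
have NM y : M y -> M (N y).
  by case=> yI yF; split; [apply: (IHr l.+1) | apply: F_stable].
have pM i y : M y -> M (p i y) by case=> yI yF; split; [apply: I_p | apply: p_F].
have PhiM y : M y -> M (Phi y) by apply: stable_Phi.
(* The induction hypothesis makes [M] stable under [N], hence under [Phi] and [Psi]; so [q i] on [M]
   is conjugate to [Psi \o q i \o Phi], which preserves [I]. *)
have qM i y : M y -> M (q i y).
  move=> yM; have yM' : M (Psi y) by apply: stable_Psi.
  rewrite -[q i y]PsiK -[in q i y](PsiK y); apply: PhiM; split.
    by apply: I_q; case: yM'.
  apply: stable_Psi => [//|z|]; first exact: F_stable.
  by apply: q_F; rewrite PsiK; case: yM.
have homogP i z : I z -> F l z -> p i z = z -> I (N z).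
  move=> zI zF pz; pose w j := Psi (q j (Phi z)).
  have wI j : I (w j) by apply: I_q.
  have PhiF y : F l y -> F l (Phi y) by apply: stable_Phi => // y'; apply: F_stable.
  have PsiF y : F l y -> F l (Psi y) by apply: stable_Psi => // y'; apply: F_stable.
  have Phi1 y : F l y -> F l.+1 (Phi y - y).
    move=> yF; rewrite PhiE addrC -addrA addKr.
    apply: subspaceD => //; first exact: N_F.
    apply: subspace_sum => // r' _; apply: subspaceZ => //; rewrite iterS.
    by apply: N_F; apply: stable_iter => // y'; apply: F_stable.
  have Psi1 y : F l y -> F l.+1 (Psi y - y).
    move=> yF; rewrite -[X in _ - X]PsiK -opprB; apply: subspaceN => //.
    by apply: Phi1; apply: PsiF.
  have wF j : F l (w j) by apply: PsiF; apply: q_F; apply: PhiF.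
  have zE : z = \sum_j p i (w j).
    by rewrite -linear_sum -linear_sum q_sum PhiK pz.
  rewrite zE linear_sum; apply: subspace_sum => // j _.
  suff : M (N (p i (w j))) by case.
  (* The leading term of [w j] is [q j z], which has degree [i] for [p] because the two gradings
     commute. *)
  have dM : M (w j - p i (w j)).
    split; first by apply: subspaceB => //; apply: I_p.
    have -> : w j - p i (w j) = (w j - q j z) - p i (w j - q j z).
      by rewrite linearB sub_sub_sub pq_comm pz subrr subr0.
    suff wq : F l.+1 (w j - q j z) by apply: subspaceB => //; apply: p_F.
    rewrite -(subrK (q j (Phi z)) (w j)) -addrA -linearB.
    apply: subspaceD => //; last by apply: q_F; apply: Phi1.
    by apply: Psi1; apply: q_F; apply: PhiF.
  apply: (nilpotent_of_almost_homogeneous Ms NM (pM i) (qM j)).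
    exact: p_id.
  (* [Phi (w j) = q j (Phi z)] is fixed by [q j], so only the error term [w j - p i (w j)]
     contributes. *)
  have -> : Phi (p i (w j)) - q j (Phi (p i (w j))) =
     q j (Phi (w j - p i (w j))) - Phi (w j - p i (w j)).
    rewrite [Phi (_ - _)]linearB [q j (_ - _)]linearB.
    have -> : Phi (w j) = q j (Phi z) by apply: PsiK.
    by rewrite q_id opprB [RHS]addrC addrA subrK.
  by apply: subspaceB => //; [apply: qM|]; apply: PhiM.
rewrite -[x]p_sum linear_sum; apply: subspace_sum => // i _.
by apply: (homogP i) => //; [apply: I_p | apply: p_F].
Qed.

End GradedExponential.

(** * Paths of a quiver, and their finiteness in the acyclic case *)

Section QuiverPaths.
Variable Q : quiver.
Implicit Types (a b : arrow Q) (u v w : qpath Q) (x y : vertex Q).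

Lemma pcomp_Some u v w : pcomp u v = Some w ->
  ptgt v = psrc u /\
  [/\ psrc w = psrc v, ptgt w = ptgt u & parrows w = parrows v ++ parrows u].
Proof.
have [vu | /pcompN->//] := eqVneq (ptgt v) (psrc u).
have [w' -> w'E] := pcompP vu; case=> <-.
by rewrite /psrc /ptgt /parrows w'E.
Qed.

Lemma qpath_eq u v :
  psrc u = psrc v -> ptgt u = ptgt v -> parrows u = parrows v -> u = v.
Proof.
case: u => [[[x s] y] us]; case: v => [[[x' s'] y'] vs].
rewrite /psrc /ptgt /parrows /= => xx yy ss.
by subst; congr QPath; apply: bool_irrelevance.
Qed.

Lemma qpath_nil u : parrows u = [::] -> u = stationary (psrc u).
Proof.
move=> u0; apply: qpath_eq => //; case: u u0 => [[[x s] y] us].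
by rewrite /psrc /ptgt /parrows /= => s0; move: us; rewrite /= s0 => /= /eqP.
Qed.

Lemma qpath_cons u a s : parrows u = a :: s ->
  exists v, [/\ parrows v = s, psrc v = atgt a & pcomp v (arrow_path a) = Some u].
Proof.
case: u => [[[x s'] y] us]; rewrite /parrows /= => s'E; subst s'.
have /= /andP[/eqP ax sP] := us; subst x.
exists (@QPath Q (atgt a, s, y) sP); split=> //.
by apply: pcomp_eq.
Qed.

(** The induction peels off the arrow traversed first, which is the rightmost factor of the path in
    the algebra. *)
Lemma qpath_ind (P : qpath Q -> Prop) :
  (forall x, P (stationary x)) ->
  (forall a v u, pcomp v (arrow_path a) = Some u -> P v -> P u) ->
  forall u, P u.
Proof.
move=> P0 PS u; move sE: (parrows u) => s; elim: s => [|a s IHs] in u sE *.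
  by rewrite (qpath_nil sE).
by have [v [/IHs Pv _ /PS]] := qpath_cons sE; apply.
Qed.

Lemma pcomp_arrow a v : psrc v = atgt a -> exists u, pcomp v (arrow_path a) = Some u.
Proof. by move=> va; have [|u uE _] := @pcompP Q v (arrow_path a); [|exists u]. Qed.

Lemma arrow_path_inj : injective (@arrow_path Q).
Proof. by move=> a b /(congr1 (@parrows Q)) []. Qed.

Lemma qpath_arrow u a : parrows u = [:: a] -> u = arrow_path a.
Proof.
move=> uE; have [v [v0 va]] := qpath_cons uE.
have vE : v = stationary (ptgt (arrow_path a)).
  by rewrite -[ptgt _]/(atgt a) -va; apply: qpath_nil.
by rewrite vE pcomp1l => -[].
Qed.

Section Acyclic.
Hypothesis Qacyclic : no_oriented_cycle Q.

(** A vertex visited twice would cut out a closed subpath of positive length. *)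
Lemma is_path_uniq x s y : is_path x s y -> uniq (x :: map (@atgt Q) s).
Proof.
have prefix : forall s x y z, is_path x s y -> z \in map (@atgt Q) s ->
    exists2 s1, is_path x s1 z & s1 != [::].
  elim=> //= a t IH x' y' z /andP[/eqP <- tP].
  rewrite inE => /predU1P[-> | /(IH _ _ _ tP)[s1 s1P _]].
    by exists [:: a]; rewrite //= !eqxx.
  by exists (a :: s1); rewrite //= eqxx.
elim: s x => //= a s IHs x /andP[/eqP ax sP]; have := IHs _ sP; rewrite /= => ->.
rewrite andbT; apply/negP => xs.
have asP : is_path x (a :: s) y by rewrite /= ax eqxx.
have [s1 s1P /eqP[]] := prefix _ _ _ _ asP xs.
exact: (@Qacyclic (@QPath Q (x, s1, x) s1P)).
Qed.

Lemma parrows_lt u : (size (parrows u) < #|vertex Q|)%N.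
Proof.
have := uniq_leq_size (is_path_uniq (valP u)) (fun x _ => mem_enum (vertex Q) x).
by rewrite -cardE /= size_map.
Qed.

Lemma ex_all_paths : exists r : seq (qpath Q), forall u, u \in r.
Proof.
pose words := flatten [seq [seq tval t | t : n.-tuple (arrow Q)] | n <- iota 0 #|vertex Q|].
pose xs := [seq (x, s) | x <- enum (vertex Q), s <- words].
exists (pmap insub [seq (p, y) | p <- xs, y <- enum (vertex Q)]) => u.
rewrite mem_pmap_sub; have := parrows_lt u; rewrite /psrc /parrows.
case: (u) => [[[x s] y] /= _] s_lt.
apply: allpairs_f; last exact: mem_enum.
apply: allpairs_f; first exact: mem_enum.
apply/flattenP; exists [seq tval t | t : (size s).-tuple (arrow Q)].
  by apply: map_f; rewrite mem_iota.
by apply/imageP; exists (in_tuple s).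
Qed.

End Acyclic.
End QuiverPaths.

(** * Coefficients, supports and linear extension in path algebras *)

Section PathAlgebraBasics.
Variables (k : fieldType) (Q : quiver).
Notation kQ := (path_alg k Q).
Notation pb := (@pbasis k Q).
Implicit Types (f g : kQ) (u v w : qpath Q) (P : qpath Q -> Prop).

HB.instance Definition _ (V : lmodType k) (F : qpath Q -> V) :=
  GRing.isLinear.Build k kQ V _ (plift F) (plift_linear F).

Lemma pbasisM u v : pb u * pb v = oapp pb 0 (pcomp u v).
Proof. exact: path_mul_basis. Qed.

Lemma pbasis_comp u v w : pcomp u v = Some w -> pb u * pb v = pb w.
Proof. by rewrite pbasisM => ->. Qed.

Definition coef f u : k := f@_u.

Lemma coefP f g : (forall u, coef f u = coef g u) <-> f = g.
Proof. by split=> [fg | ->//]; apply/malgP => u; apply: fg. Qed.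

Lemma coef0 u : coef 0 u = 0. Proof. exact: mcoeff0. Qed.

Lemma coefD f g u : coef (f + g) u = coef f u + coef g u.
Proof. exact: mcoeffD. Qed.

Lemma coefZ c f u : coef (c *: f) u = c * coef f u.
Proof. exact: mcoeffZ. Qed.

Lemma coef_basis u v : coef (pb u) v = (u == v)%:R.
Proof. exact: pbasis_coef. Qed.

Lemma coef_sum (I : Type) (r : seq I) (P : pred I) (F : I -> kQ) u :
  coef (\sum_(i <- r | P i) F i) u = \sum_(i <- r | P i) coef (F i) u.
Proof. by apply: (big_morph (coef^~ u)) => [f g|]; rewrite ?coefD ?coef0. Qed.

Definition supp_on P f : Prop := forall u, coef f u != 0 -> P u.

Lemma supp_on_subspace P : subspace (supp_on P).
Proof.
split=> [u|c f g fP gP u]; first by rewrite coef0 eqxx.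
rewrite coefD coefZ; case: (eqVneq (coef f u) 0) => [fu0 | /fP//].
by rewrite fu0 mulr0 add0r => /gP.
Qed.

Lemma supp_on0 P : supp_on P 0.
Proof. exact: subspace0 (supp_on_subspace P). Qed.

Lemma supp_onD P f g : supp_on P f -> supp_on P g -> supp_on P (f + g).
Proof. exact: subspaceD (supp_on_subspace P). Qed.

Lemma supp_onN P f : supp_on P f -> supp_on P (- f).
Proof. exact: subspaceN (supp_on_subspace P). Qed.

Lemma supp_onZ P c f : supp_on P f -> supp_on P (c *: f).
Proof. exact: subspaceZ (supp_on_subspace P). Qed.

Lemma supp_on_basis P u : P u -> supp_on P (pb u).
Proof.
by move=> Pu v; rewrite coef_basis; case: (u =P v) => [<-//|_]; rewrite eqxx.
Qed.

(** Linear extension from the paths of the support. With [M] a subspace it proves memberships; with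
    [M] the zero subspace and [h] a difference of linear maps it proves identities. *)
Lemma supp_on_ind (V : lmodType k) P (M : V -> Prop) (h : {linear kQ -> V}) f :
  subspace M -> (forall u, P u -> M (h (pb u))) -> supp_on P f -> M (h f).
Proof.
move=> Ms PM fP.
rewrite [f in h f]monalgE linear_sum big_seq; apply: subspace_sum => // u uf.
rewrite pbasisZ linearZ; apply: subspaceZ => //; apply: PM; apply: fP.
by rewrite /coef mcoeff_neq0.
Qed.

Lemma supp_on_map P P' (h : {linear kQ -> kQ}) f :
  (forall u, P u -> supp_on P' (h (pb u))) -> supp_on P f -> supp_on P' (h f).
Proof. exact: supp_on_ind (supp_on_subspace P'). Qed.

Lemma kQ_ind (V : lmodType k) (M : V -> Prop) (h : {linear kQ -> V}) f :
  subspace M -> (forall u, M (h (pb u))) -> M (h f).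
Proof.
move=> Ms PM; apply: (@supp_on_ind V (fun=> True) M h f Ms) => [u _|u _ //].
exact: PM.
Qed.

Lemma supp_onS P P' f : (forall u, P u -> P' u) -> supp_on P f -> supp_on P' f.
Proof. by move=> PP' fP u /fP/PP'. Qed.

Lemma supp_onM P1 P2 P f g :
  (forall u v w, P1 u -> P2 v -> pcomp u v = Some w -> P w) ->
  supp_on P1 f -> supp_on P2 g -> supp_on P (f * g).
Proof.
move=> PP fP gP; have Ps := supp_on_subspace P.
pose hr g' : {linear kQ -> kQ} := HB.pack ( *%R^~ g')
  (GRing.isLinear.Build _ _ _ _ _ (path_mul_linearl g')).
pose hl f' : {linear kQ -> kQ} := HB.pack ( *%R f')
  (GRing.isLinear.Build _ _ _ _ _ (path_mul_linearr f')).
apply: (supp_on_ind (h := hr g) Ps _ fP) => u Pu.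
apply: (supp_on_ind (h := hl (pb u)) Ps _ gP) => v Pv /=.
rewrite pbasisM; case E: Defs.pcomp => [w|] /=; last exact: subspace0.
by apply: supp_on_basis; apply: PP Pu Pv E.
Qed.

Definition ppart (P : pred (qpath Q)) : {linear kQ -> kQ} :=
  plift (fun u => if P u then pb u else 0).

Lemma ppart_basis (P : pred (qpath Q)) u : ppart P (pb u) = if P u then pb u else 0.
Proof. exact: plift_basis. Qed.

Lemma ppart_coef (P : pred (qpath Q)) f u : coef (ppart P f) u = if P u then coef f u else 0.
Proof.
pose M (f : kQ) := coef (ppart P f) u = if P u then coef f u else 0.
apply: (@kQ_ind _ M idfun).
  split=> [|c f1 f2]; rewrite /M; first by rewrite linear0 !coef0; case: ifP.
  rewrite linearP !coefD !coefZ => -> ->.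
  by case: ifP; rewrite ?mulr0 ?addr0.
move=> v; rewrite /M /= ppart_basis; case Pv: (P v); rewrite !(coef_basis, coef0).
  by case: (v =P u) => [<-|]; rewrite ?Pv //; case: ifP.
by case: (v =P u) => [<-|]; rewrite ?Pv //; case: ifP.
Qed.

Lemma ppart_supp P (P' : pred (qpath Q)) f :
  supp_on P f -> supp_on (fun u => P u /\ P' u) (ppart P' f).
Proof. by move=> fP u; rewrite ppart_coef; case: ifP => [? /fP|]; rewrite ?eqxx. Qed.

Lemma ppart_id (P : pred (qpath Q)) f : supp_on P f -> ppart P f = f.
Proof.
move=> fP; apply/coefP => u; rewrite ppart_coef; case: ifP => // Pu.
by apply/esym/eqP; apply: contraFT Pu => /fP.
Qed.

Lemma ppart0 (P : pred (qpath Q)) f : supp_on (fun u => ~~ P u) f -> ppart P f = 0.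
Proof.
move=> fP; apply/coefP => u; rewrite ppart_coef coef0; case: ifP => // Pu.
by apply/eqP; apply: contraTT Pu => /fP.
Qed.

Lemma ppart_comm (P P' : pred (qpath Q)) f : ppart P (ppart P' f) = ppart P' (ppart P f).
Proof. by apply/coefP => u; rewrite !ppart_coef; case: ifP => //; case: ifP. Qed.

Lemma ppart_grading m (c : qpath Q -> 'I_m) f :
  \sum_i ppart (fun u => c u == i) f = f.
Proof.
apply/coefP => u; rewrite coef_sum (bigD1 (c u)) //= ppart_coef eqxx.
by rewrite big1 ?addr0 // => i ci; rewrite ppart_coef eq_sym (negPf ci).
Qed.

End PathAlgebraBasics.

(** * Algebra morphisms out of a path algebra *)

Section UniversalProperty.
Variables (k : fieldType) (Q : quiver) (B : algType k).
Notation kQ := (path_alg k Q).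
Notation pb := (@pbasis k Q).
Variables (E : vertex Q -> B) (G : arrow Q -> B).

(** The head of a word is traversed first and so becomes the rightmost factor. *)
Fixpoint word_eval x s : B :=
  if s is a :: s' then word_eval (atgt a) s' * G a else E x.

Definition path_eval (u : qpath Q) : B := word_eval (psrc u) (parrows u).

Hypothesis EE : forall x y, E x * E y = if x == y then E x else 0.
Hypothesis sumE : \sum_x E x = 1.
Hypothesis GE : forall a, G a * E (asrc a) = G a.
Hypothesis EG : forall a, E (atgt a) * G a = G a.

Lemma word_eval_src x s y : is_path x s y -> word_eval x s * E x = word_eval x s.
Proof.
case: s => [|a s] /=; first by rewrite EE eqxx.
by case/andP=> /eqP <- _; rewrite -mulrA GE.
Qed.

Lemma word_eval_tgt x s y : is_path x s y -> E y * word_eval x s = word_eval x s.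
Proof.
elim: s x => [|a s IHs] x /=; first by move/eqP->; rewrite EE eqxx.
by case/andP=> _ /IHs sE; rewrite mulrA sE.
Qed.

Lemma word_eval_cat x s y t z : is_path x s y -> is_path y t z ->
  word_eval x (s ++ t) = word_eval y t * word_eval x s.
Proof.
move=> + tP; elim: s x => [|a s IHs] x /=.
  by move/eqP->; rewrite (word_eval_src tP).
by case/andP=> _ /IHs ->; rewrite mulrA.
Qed.

Lemma path_evalM u v : path_eval u * path_eval v = oapp path_eval 0 (pcomp u v).
Proof.
rewrite /path_eval; have [vu | vu] := eqVneq (ptgt v) (psrc u).
  have [w -> wE] := pcompP vu; rewrite /= /psrc /parrows wE /=.
  have uP := valP u; rewrite /= -/(psrc u) -vu in uP.
  by rewrite (word_eval_cat (valP v) uP) -/(psrc u) -vu.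
rewrite pcompN // -(word_eval_src (valP u)) -(word_eval_tgt (valP v)).
by rewrite mulrA -[_ * E _ * E _]mulrA EE eq_sym (negPf vu) mulr0 mul0r.
Qed.

(** The universal property of [kQ]: the hypotheses say that [E] is a complete family of orthogonal
    idempotents and that each [G a] lies in the corner [E (atgt a) B E (asrc a)]. *)
Lemma ex_path_morphism : exists g : {lrmorphism kQ -> B},
  (forall x, g (pb (stationary x)) = E x) /\ (forall a, g (pb (arrow_path a)) = G a).
Proof.
pose g0 : kQ -> B := plift path_eval.
have gM : {morph g0 : x y / x * y}.
  move=> f h; pose M f := g0 (f * h) = g0 f * g0 h.
  have linl (h' : kQ) : linear (fun f : kQ => g0 (f * h') - g0 f * g0 h').
    move=> c f1 f2; rewrite mulrDl -scalerAl /g0 !linearP mulrDl -scalerAl.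
    by rewrite scalerBr opprD addrACA.
  have linr (f' : kQ) : linear (fun h : kQ => g0 (f' * h) - g0 f' * g0 h).
    move=> c f1 f2; rewrite mulrDr -scalerAr /g0 !linearP mulrDr -scalerAr.
    by rewrite scalerBr opprD addrACA.
  have lin0 : linear (fun _ : kQ => 0 : B) by move=> c f1 f2; rewrite scaler0 addr0.
  apply/eqP; rewrite -subr_eq0; apply/eqP.
  apply: (linear_basis_eq (linl h) lin0) => u /=.
  apply: (linear_basis_eq (linr _) lin0) => v /=.
  rewrite pbasisM /g0 !plift_basis path_evalM.
  by case: Defs.pcomp => [w|] /=; [rewrite plift_basis | rewrite linear0]; rewrite subrr.
have g1 : g0 1 = 1.
  rewrite -sumE -[1 : kQ]/(path_one k Q) /path_one /g0 linear_sum.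
  by apply: eq_bigr => x _; exact: (plift_basis path_eval (stationary x)).
pose g : {lrmorphism kQ -> B} := HB.pack g0
  (GRing.isLinear.Build _ _ _ _ _ (plift_linear path_eval))
  (GRing.isMonoidMorphism.Build kQ B g0 (g1, gM)).
exists g; split=> [x|a]; rewrite /= /g0 plift_basis /path_eval //=.
Qed.

End UniversalProperty.

Section PathMorphismExt.
Variables (k : fieldType) (Q : quiver) (B : algType k).
Notation kQ := (path_alg k Q).
Notation pb := (@pbasis k Q).

Lemma eq_path_morphism (g h : {lrmorphism kQ -> B}) :
  (forall x, g (pb (stationary x)) = h (pb (stationary x))) ->
  (forall a, g (pb (arrow_path a)) = h (pb (arrow_path a))) -> g =1 h.
Proof.
move=> ghE ghG; apply: linear_basis_eq; try exact: linearP.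
elim/qpath_ind => // a v u vaE IHv.
by rewrite -(pbasis_comp k vaE) !rmorphM /= IHv ghG.
Qed.

Lemma pbasis_stationaryM x y :
  pb (stationary x) * pb (stationary y) = if x == y then pb (stationary x) else 0.
Proof.
case: eqP => [-> | xy]; first by rewrite (pbasis_comp k (pcomp1l (stationary y))).
rewrite pbasisM pcompN //; apply/eqP => /esym; exact: xy.
Qed.

Lemma pbasis_tgt u : pb (stationary (ptgt u)) * pb u = pb u.
Proof. exact/pbasis_comp/pcomp1l. Qed.

Lemma pbasis_src u : pb u * pb (stationary (psrc u)) = pb u.
Proof. exact/pbasis_comp/pcomp1r. Qed.

Lemma pbasis_sum1 : \sum_x pb (stationary x) = 1.
Proof. by []. Qed.

End PathMorphismExt.

(** * Quotients isomorphic to an algebra, and kernels of surjections onto it *)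

Section Kernels.
Variables (k : fieldType) (C B : algType k).

Definition ker (g : C -> B) : C -> bool := fun x => g x == 0.

Section KernelIdeal.
Variable g : {lrmorphism C -> B}.

Lemma kerE x : (x \in ker g) = (g x == 0). Proof. by []. Qed.

Fact ker_zmod_closed : zmod_closed (ker g).
Proof.
split=> [|x y]; rewrite !kerE ?linear0 // => /eqP gx /eqP gy.
by rewrite rmorphB /= gx gy subrr.
Qed.
HB.instance Definition _ := GRing.isZmodClosed.Build C (ker g) ker_zmod_closed.

Fact ker_mull a : {in ker g, forall x, a * x \in ker g}.
Proof. by move=> x; rewrite !kerE rmorphM /= => /eqP ->; rewrite mulr0. Qed.
Fact ker_mulr a : {in ker g, forall x, x * a \in ker g}.
Proof. by move=> x; rewrite !kerE rmorphM /= => /eqP ->; rewrite mul0r. Qed.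
HB.instance Definition _ := isTwoSided.Build C (ker g) ker_mull ker_mulr.

Fact ker_not1 : 1 \notin ker g.
Proof. by rewrite kerE rmorph1 oner_eq0. Qed.
HB.instance Definition _ := isProperSubset.Build C (ker g) ker_not1.

Definition ker_ideal : ptsideal C := ProperTwoSidedIdeal.clone C (ker g) _.

Lemma ker_idealE x : (x \in ker_ideal) = (g x == 0). Proof. by []. Qed.

Lemma quot_ker_isomorphic : (forall b, exists x, g x = b) ->
  alg_isomorphic (quot_alg ker_ideal) B.
Proof.
move=> gsurj; pose q := quot_alg ker_ideal.
pose h (x : q) : B := g (repr x).
have hE x : h (\pi_q x) = g x.
  apply/eqP; rewrite -subr_eq0 -linearB -ker_idealE; apply/quot_eqP.
  by rewrite reprK.
have hL : linear h.
  move=> c x y; rewrite -[x]reprK -[y]reprK.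
  rewrite -[c *: _](pi_quot_scale ker_ideal) -(pi_quot_add ker_ideal) !hE.
  exact: linearP.
have hM : {morph h : x y / x * y}.
  move=> x y; rewrite -[x]reprK -[y]reprK.
  by rewrite -[_ * _](pi_quot_mul ker_ideal) !hE rmorphM.
have h1 : h 1 = 1.
  have -> : (1 : q) = \pi_q 1 by rewrite -[LHS]/(quot_one ker_ideal) piE.
  by rewrite hE rmorph1.
pose hm : {lrmorphism q -> B} := HB.pack h
  (GRing.isLinear.Build _ _ _ _ _ hL) (GRing.isMonoidMorphism.Build q B h (h1, hM)).
exists hm; have [s sK] := choice gsurj.
exists (fun b => \pi_q (s b)) => [x | b] /=; last by rewrite hE.
rewrite -[RHS]reprK; apply/quot_eqP.
by rewrite ker_idealE rmorphB /= sK -/(h x) subrr.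
Qed.

End KernelIdeal.

Lemma quot_isomorphic_surjection (J : ptsideal C) : alg_isomorphic (quot_alg J) B ->
  exists g : {lrmorphism C -> B},
    (forall b, exists x, g x = b) /\ (forall x, (x \in J) = (g x == 0)).
Proof.
case=> f [f' fK f'K]; pose q := quot_alg J.
pose g x : B := f (\pi_q x).
have gL : linear g.
  move=> c x y; rewrite /g (pi_quot_add J) (pi_quot_scale J) -linearP.
  by [].
have gM : {morph g : x y / x * y} by move=> x y; rewrite /g (pi_quot_mul J) -rmorphM.
have g1 : g 1 = 1.
  by rewrite /g -(rmorph1 f); congr (f _); rewrite -[RHS]/(quot_one J) piE.
pose gm : {lrmorphism C -> B} := HB.pack g
  (GRing.isLinear.Build _ _ _ _ _ gL) (GRing.isMonoidMorphism.Build C B g (g1, gM)).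
exists gm; split=> [b | x] /=.
  by exists (repr (f' b)); rewrite /g reprK f'K.
have g0 : g 0 = 0 by rewrite -[LHS]/(gm 0) linear0.
rewrite -{1}[x]subr0; apply/quot_eqP/eqP => [xE | gx].
  by rewrite -[RHS]g0 /g xE.
by rewrite -[LHS]fK -[RHS]fK; congr (f' _); rewrite -/(g x) -/(g 0) gx g0.
Qed.

End Kernels.

(** * Transvections and the derivations of which they are exponentials *)

Section Transvections.
Variables (k : fieldType) (Q : quiver).
Hypothesis Qacyclic : no_oriented_cycle Q.
Hypothesis Qbypass : no_double_bypass Q.
Notation kQ := (path_alg k Q).
Notation pb := (@pbasis k Q).
Implicit Types (f g : kQ) (u v w : qpath Q) (a b : arrow Q) (s t : arrow Q -> kQ).

(** Two distinct parallel arrows are bypasses of each other and so form a double bypass. *)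
Lemma no_parallel_arrows a b : asrc a = asrc b -> atgt a = atgt b -> a = b.
Proof.
move=> ab_src ab_tgt; have [//|/eqP ab] := eqVneq a b.
case: (@Qbypass a (arrow_path b) b (arrow_path a)); split.
- by split=> [|/arrow_path_inj/esym//]; split; rewrite /psrc /ptgt.
- by split=> [|/arrow_path_inj//]; split; rewrite /psrc /ptgt.
- by rewrite /parrows mem_head.
Qed.

(** Length zero would make the arrow a loop, and length one would give two parallel arrows. *)
Lemma bypass_size a u : bypass a u -> (1 < size (parrows u))%N.
Proof.
case=> [[u_src u_tgt] ua]; case uE: (parrows u) => [|b [|c s]] //.
  have u0 := qpath_nil uE; have := @Qacyclic (arrow_path a).
  by rewrite -u_src -u_tgt u0 /psrc /ptgt /parrows /= => /(_ erefl).
case: ua; rewrite (qpath_arrow uE) in u_src u_tgt *.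
congr arrow_path; exact: no_parallel_arrows.
Qed.

Definition transv t : Prop := forall a, supp_on (bypass a) (t a).

Lemma transv0 : transv (fun=> 0).
Proof. by move=> a u; rewrite coef0 eqxx. Qed.

Lemma transvD s t : transv s -> transv t -> transv (fun a => s a + t a).
Proof.
by move=> sb tb a; apply: supp_onD.
Qed.

Lemma transvN t : transv t -> transv (fun a => - t a).
Proof.
by move=> tb a; apply: supp_onN.
Qed.

Lemma supp_on_src x f : supp_on (fun u => psrc u = x) f -> f * pb (stationary x) = f.
Proof.
pose h : {linear kQ -> kQ} := HB.pack ( *%R^~ (pb (stationary x)))
  (GRing.isLinear.Build _ _ _ _ _ (path_mul_linearl (pb (stationary x)))).
move=> fx; apply/eqP; rewrite -subr_eq0; apply/eqP.
pose h' : {linear kQ -> kQ} := h \- idfun.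
apply: (supp_on_ind (M := fun z => z = 0) (h := h') _ _ fx) => [|u ux].
  by split=> // c y z -> ->; rewrite scaler0 addr0.
by rewrite /= -ux pbasis_src subrr.
Qed.

Lemma supp_on_tgt x f : supp_on (fun u => ptgt u = x) f -> pb (stationary x) * f = f.
Proof.
pose h : {linear kQ -> kQ} := HB.pack ( *%R (pb (stationary x)))
  (GRing.isLinear.Build _ _ _ _ _ (path_mul_linearr (pb (stationary x)))).
move=> fx; apply/eqP; rewrite -subr_eq0; apply/eqP.
pose h' : {linear kQ -> kQ} := h \- idfun.
apply: (supp_on_ind (M := fun z => z = 0) (h := h') _ _ fx) => [|u ux].
  by split=> // c y z -> ->; rewrite scaler0 addr0.
by rewrite /= -ux pbasis_tgt subrr.
Qed.

Lemma transv_src t a : transv t -> t a * pb (stationary (asrc a)) = t a.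
Proof. by move=> tb; apply: supp_on_src => u /tb[[->]]. Qed.

Lemma transv_tgt t a : transv t -> pb (stationary (atgt a)) * t a = t a.
Proof. by move=> tb; apply: supp_on_tgt => u /tb[[_ ->]]. Qed.

Lemma ex_transvection t : transv t -> exists g : {lrmorphism kQ -> kQ},
  (forall x, g (pb (stationary x)) = pb (stationary x)) /\
  (forall a, g (pb (arrow_path a)) = pb (arrow_path a) + t a).
Proof.
move=> tb; apply: ex_path_morphism => [x y||a|a].
- exact: pbasis_stationaryM.
- exact: pbasis_sum1.
- by rewrite mulrDl (pbasis_src k (arrow_path a)) transv_src.
- by rewrite mulrDr (pbasis_tgt k (arrow_path a)) transv_tgt.
Qed.

Definition transvection t (tb : transv t) : {lrmorphism kQ -> kQ} :=
  projT1 (cid (ex_transvection tb)).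

Lemma transvectionE t (tb : transv t) x :
  transvection tb (pb (stationary x)) = pb (stationary x).
Proof. by rewrite /transvection; case: cid => g []. Qed.

Lemma transvectionA t (tb : transv t) a :
  transvection tb (pb (arrow_path a)) = pb (arrow_path a) + t a.
Proof. by rewrite /transvection; case: cid => g []. Qed.

(** An arrow on a bypass has no bypass of its own. Hence every transvection fixes all bypasses,
    which is why composing transvections adds their parameters. *)
Lemma bypass_unmoved s a u : transv s -> bypass a u ->
  {in parrows u, forall b, s b = 0}.
Proof.
move=> sb au b bu; apply/coefP => v; rewrite coef0.
by apply: contrapT => /eqP/sb bv; apply: (@Qbypass a u b v).
Qed.

Lemma transvection_fix s (sb : transv s) u :
  {in parrows u, forall b, s b = 0} -> transvection sb (pb u) = pb u.
Proof.
elim/qpath_ind: u => [x|a v u vaE IHv] us; first exact: transvectionE.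
have [_ [_ _ uE]] := pcomp_Some vaE.
rewrite -(pbasis_comp k vaE) rmorphM /= transvectionA us ?addr0; last first.
  by rewrite uE inE eqxx.
by rewrite IHv // => b bv; apply: us; rewrite uE inE bv orbT.
Qed.

Lemma transvection_bypass s t (sb : transv s) a : transv t ->
  transvection sb (t a) = t a.
Proof.
move=> tb; apply/eqP; rewrite -subr_eq0; apply/eqP.
pose h : {linear kQ -> kQ} := transvection sb \- idfun.
apply: (supp_on_ind (M := fun z => z = 0) (h := h) _ _ (tb a)) => [|u au].
  by split=> // c y z -> ->; rewrite scaler0 addr0.
by rewrite /h /= transvection_fix ?subrr //; apply: bypass_unmoved au.
Qed.

Lemma transvection_comp s t r (sb : transv s) (tb : transv t) (rb : transv r) f :
  (forall a, r a = s a + t a) ->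
  transvection sb (transvection tb f) = transvection rb f.
Proof.
move=> rE; pose g : {lrmorphism kQ -> kQ} := transvection sb \o transvection tb.
apply: (@eq_path_morphism k Q kQ g (transvection rb)) => [x|a] /=.
  by rewrite !transvectionE.
by rewrite !transvectionA rmorphD /= transvectionA transvection_bypass // rE addrA.
Qed.

Lemma transvection_id t (tb : transv t) f : (forall a, t a = 0) -> transvection tb f = f.
Proof.
move=> t0; apply: (@eq_path_morphism k Q kQ (transvection tb) idfun) => [x|a] /=.
  exact: transvectionE.
by rewrite transvectionA t0 addr0.
Qed.

Lemma transvectionK s t (sb : transv s) (tb : transv t) :
  (forall a, s a = - t a) -> cancel (transvection tb) (transvection sb).
Proof.
move=> st f; rewrite (transvection_comp _ _ transv0) => [|a].
  by rewrite transvection_id.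
by rewrite st addNr.
Qed.

Section Derivation.
Variables (t : arrow Q -> kQ) (tb : transv t).

(** The sum, over the choices of [i] positions in the word, of the products in which the arrow [a]
    at each chosen position is replaced by [t a]. *)
Fixpoint dword i x (s : seq (arrow Q)) : kQ :=
  if s is a :: s' then
    dword i (atgt a) s' * pb (arrow_path a)
    + (if i is j.+1 then dword j (atgt a) s' * t a else 0)
  else if i is 0 then pb (stationary x) else 0.

(* The component of degree [i] in [t] of the transvection along [t]; in
   characteristic zero it is [N^i / i!], where [N] is the component of degree 1. *)
Definition dpow i : {linear kQ -> kQ} :=
  plift (fun u => dword i (psrc u) (parrows u)).

Lemma dpow_stationary i x :
  dpow i (pb (stationary x)) = if i is 0 then pb (stationary x) else 0.
Proof. exact: (plift_basis _ (stationary x)). Qed.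

Lemma dpow_cons i a v u : pcomp v (arrow_path a) = Some u ->
  dpow i (pb u) = dpow i (pb v) * pb (arrow_path a)
    + (if i is j.+1 then dpow j (pb v) * t a else 0).
Proof.
move=> /pcomp_Some[av [_ _ uE]]; rewrite /dpow /= !plift_basis uE /=.
by rewrite -[ptgt _]/(atgt a) in av; case: i => [|i]; rewrite ?plift_basis /= av.
Qed.

Lemma dpow0 f : dpow 0 f = f.
Proof.
apply: (linear_basis_eq (F := dpow 0) (G := idfun)); try exact: linearP.
elim/qpath_ind => [x|a v u vaE IHv]; first exact: dpow_stationary.
by rewrite (dpow_cons 0 vaE) IHv addr0 (pbasis_comp k vaE).
Qed.

(** Expansion of the product of the factors [a + t a]; a path shorter than [n] leaves room for fewer
    than [n] replacements. *)
Lemma transvection_dpow n u : (size (parrows u) < n)%N ->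
  transvection tb (pb u) = \sum_(i < n) dpow i (pb u).
Proof.
elim/qpath_ind: u n => [x|a v u vaE IHv] [|n] //.
  rewrite transvectionE big_ord_recl dpow_stationary big1 ?addr0 // => i _.
  exact: dpow_stationary.
have [_ [_ _ uE]] := pcomp_Some vaE; rewrite uE ltnS => vn.
rewrite -(pbasis_comp k vaE) rmorphM /= transvectionA mulrDr (pbasis_comp k vaE).
under eq_bigr => i _ do rewrite (dpow_cons _ vaE).
rewrite big_split /= -mulr_suml -IHv ?ltnS 1?ltnW //; congr (_ + _).
rewrite big_ord_recl add0r /= -mulr_suml; congr (_ * _); exact: IHv.
Qed.

(** Each term arises by replacing exactly one arrow. [S] may thus be irreflexive: it is taken to be
    parallelism, strict growth of length and non-homotopy. *)
Lemma dpow_compat (S : qpath Q -> qpath Q -> Prop) :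
  (forall a w, coef (t a) w != 0 -> S (arrow_path a) w) ->
  (forall u v v' w w', S v v' -> pcomp u v = Some w -> pcomp u v' = Some w' -> S w w') ->
  (forall u v v' w w', S v v' -> pcomp v u = Some w -> pcomp v' u = Some w' -> S w w') ->
  forall u, supp_on (S u) (dpow 1 (pb u)).
Proof.
move=> St Sl Sr; elim/qpath_ind => [x|a v u vaE IHv].
  by rewrite dpow_stationary; apply: supp_on0.
rewrite (dpow_cons _ vaE) dpow0; apply: supp_onD.
  apply: supp_onM IHv (@supp_on_basis k Q (eq (arrow_path a)) _ erefl).
  by move=> v' _ w vv' <-; apply: Sr vv' vaE.
apply: supp_onM (@supp_on_basis k Q (eq v) _ erefl) (St a).
by move=> _ v' w <- av'; apply: Sl av' vaE.
Qed.

(** Several arrows, or none, may be replaced at once, whence the transitivity and reflexivity;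
    parallelism makes the intermediate path [z] composable. *)
Lemma transvection_compat (S : qpath Q -> qpath Q -> Prop) :
  (forall u, S u u) -> (forall u v w, S u v -> S v w -> S u w) ->
  (forall u v, S u v -> parallel u v) ->
  (forall a w, coef (t a) w != 0 -> S (arrow_path a) w) ->
  (forall u v v' w w', S v v' -> pcomp u v = Some w -> pcomp u v' = Some w' -> S w w') ->
  (forall u v v' w w', S v v' -> pcomp v u = Some w -> pcomp v' u = Some w' -> S w w') ->
  forall u, supp_on (S u) (transvection tb (pb u)).
Proof.
move=> S1 S2 Sp St Sl Sr; elim/qpath_ind => [x|a v u vaE IHv].
  by rewrite transvectionE; apply: supp_on_basis.
rewrite -(pbasis_comp k vaE) rmorphM /= transvectionA.
have [va _] := pcomp_Some vaE.
apply: (supp_onM (P2 := S (arrow_path a))) IHv _ => [v' w w' vv' aw w'E|].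
  have [v_src _] := Sp _ _ vv'.
  have [|z zE _] := @pcompP Q v' (arrow_path a); first by rewrite va.
  by apply: (S2 _ z); [apply: Sr vv' vaE zE | apply: Sl aw zE w'E].
apply: supp_onD (St a).
by apply: supp_on_basis.
Qed.

Lemma bypass_parallel a w : coef (t a) w != 0 -> parallel (arrow_path a) w.
Proof. by case/tb => -[ws wt] _; split. Qed.

Lemma dpow_parallel u : supp_on (parallel u) (dpow 1 (pb u)).
Proof.
apply: dpow_compat; first exact: bypass_parallel.
  move=> {}u v v' w w' [vs vt] /pcomp_Some[_ [ws wt _]] /pcomp_Some[_ [ws' wt' _]].
  by split; rewrite ?ws ?ws' ?wt ?wt'.
move=> {}u v v' w w' [vs vt] /pcomp_Some[_ [ws wt _]] /pcomp_Some[_ [ws' wt' _]].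
by split; rewrite ?ws ?ws' ?wt ?wt'.
Qed.

Lemma dpow_longer u :
  supp_on (fun v => size (parrows u) < size (parrows v))%N (dpow 1 (pb u)).
Proof.
apply: (@dpow_compat (fun u v => size (parrows u) < size (parrows v))%N).
- by move=> a w /tb; apply: bypass_size.
- move=> {}u v v' w w' vv' /pcomp_Some[_ [_ _ ->]] /pcomp_Some[_ [_ _ ->]].
  by rewrite !size_cat ltn_add2r.
move=> {}u v v' w w' vv' /pcomp_Some[_ [_ _ ->]] /pcomp_Some[_ [_ _ ->]].
by rewrite !size_cat ltn_add2l.
Qed.

Lemma mul_pbasis0 u v f : supp_on (parallel u) f -> ptgt v != psrc u -> f * pb v = 0.
Proof.
move=> fu vu; rewrite -(@supp_on_src (psrc u) f) => [|w /fu[->]//].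
by rewrite -(pbasis_tgt k v) mulrA -[_ * _ * pb (stationary (ptgt v))]mulrA
  pbasis_stationaryM eq_sym (negPf vu) mulr0 mul0r.
Qed.

Lemma dpow_mul_arrow f a :
  dpow 1 (f * pb (arrow_path a)) = dpow 1 f * pb (arrow_path a) + f * t a.
Proof.
have lin0 : linear (fun _ : kQ => 0 : kQ) by move=> c f1 f2; rewrite scaler0 addr0.
apply/eqP; rewrite -subr_eq0; apply/eqP.
pose h f := dpow 1 (f * pb (arrow_path a)) - (dpow 1 f * pb (arrow_path a) + f * t a).
have hl : linear h.
  move=> c f1 f2; rewrite /h !mulrDl -!scalerAl !linearP !mulrDl -!scalerAl.
  by rewrite [X in _ - X]addrACA -scalerDr opprD addrACA -scalerBr.
apply: (linear_basis_eq hl lin0) => u; rewrite /h.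
have [ua | ua] := eqVneq (psrc u) (atgt a).
  have [w wE] := pcomp_arrow ua.
  by rewrite (pbasis_comp k wE) (dpow_cons _ wE) dpow0 subrr.
have ua' : ptgt (arrow_path a) != psrc u by rewrite eq_sym.
rewrite pbasisM pcompN // linear0 (mul_pbasis0 (@dpow_parallel u)) //.
rewrite -(transv_tgt a tb) mulrA pbasisM pcompN //= mul0r.
by rewrite addr0 subrr.
Qed.

Lemma dpowM f u : dpow 1 (f * pb u) = dpow 1 f * pb u + f * dpow 1 (pb u).
Proof.
elim/qpath_ind: u f => [x f|a v u vaE IHv f]; last first.
  rewrite -(pbasis_comp k vaE) mulrA !dpow_mul_arrow IHv mulrDr mulrDl.
  by rewrite !mulrA addrA.
rewrite dpow_stationary mulr0 addr0.
have lin0 : linear (fun _ : kQ => 0 : kQ) by move=> c f1 f2; rewrite scaler0 addr0.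
apply/eqP; rewrite -subr_eq0; apply/eqP.
pose h f := dpow 1 (f * pb (stationary x)) - dpow 1 f * pb (stationary x).
have hl : linear h.
  move=> c f1 f2; rewrite /h !mulrDl -!scalerAl !linearP !mulrDl -!scalerAl.
  by rewrite opprD addrACA -scalerBr.
apply: (linear_basis_eq hl lin0) => u; rewrite /h.
have [<- | xu] := eqVneq (psrc u) x.
  rewrite pbasis_src supp_on_src ?subrr // => v; exact: (fun vu => esym (dpow_parallel vu).1).
have xu' : ptgt (stationary x) != psrc u by rewrite eq_sym.
by rewrite pbasisM pcompN // linear0 (mul_pbasis0 (@dpow_parallel u)) // subrr.
Qed.

Lemma dpow_fix u : {in parrows u, forall b, t b = 0} -> dpow 1 (pb u) = 0.
Proof.
elim/qpath_ind: u => [x|a v u vaE IHv] us; first by rewrite dpow_stationary.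
have [_ [_ _ uE]] := pcomp_Some vaE.
rewrite (dpow_cons _ vaE) us ?uE ?inE ?eqxx // mulr0 addr0.
by rewrite IHv ?mul0r // => b bv; apply: us; rewrite uE inE bv orbT.
Qed.

(** The derivation kills [t a], whose paths consist of arrows that [t] does not move. *)
Lemma dpow_mul_bypass f a : dpow 1 (f * t a) = dpow 1 f * t a.
Proof.
apply/eqP; rewrite -subr_eq0; apply/eqP.
pose h g := dpow 1 (f * g) - dpow 1 f * g.
have hl : linear h.
  move=> c f1 f2; rewrite /h !mulrDr -!scalerAr [dpow 1 (_ + _)]linearP.
  by rewrite opprD addrACA -scalerBr.
pose hL : {linear kQ -> kQ} := HB.pack h (GRing.isLinear.Build _ _ _ _ _ hl).
rewrite -[LHS]/(hL (t a)).
apply: (@supp_on_ind k Q kQ (bypass a) (fun z => z = 0) hL (t a)) => [|u au|]; last exact: tb.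
  by split=> // c y z -> ->; rewrite scaler0 addr0.
rewrite /= /h dpowM dpow_fix ?mulr0 ?addr0 ?subrr //.
exact: bypass_unmoved au.
Qed.

(** A set of [i.+1] replaced positions arises once for each choice of the position replaced last.
    Nothing is replaced twice, because the derivation kills [t a]. *)
Lemma dpowS i f : dpow 1 (dpow i f) = dpow i.+1 f *+ i.+1.
Proof.
suff dpowS_basis u : dpow 1 (dpow i (pb u)) = dpow i.+1 (pb u) *+ i.+1.
  rewrite -scaler_nat; pose h : {linear kQ -> kQ} := (i.+1%:R : k) \*: dpow i.+1.
  apply: (linear_basis_eq (F := fun f => dpow 1 (dpow i f)) (G := h)).
  - by move=> c f1 f2; rewrite !linearP.
  - by move=> c f1 f2; rewrite linearP.
  by move=> u; rewrite dpowS_basis -scaler_nat.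
elim/qpath_ind: u i => [x|a v u vaE IHv] [|i].
- by rewrite dpow0.
- by rewrite !dpow_stationary linear0 mul0rn.
- by rewrite dpow0.
rewrite !(dpow_cons _ vaE) (linearD (dpow 1)) dpow_mul_arrow dpow_mul_bypass !IHv.
by rewrite !mulrnAl -addrA mulrnDl; congr (_ + _).
Qed.

Hypothesis char0 : [pchar k] =i pred0.

Lemma dpow_iter i f : dpow i f = (i`!)%:R^-1 *: iter i (dpow 1) f.
Proof.
have nat_unit n : (n.+1%:R : k) != 0 by rewrite (pcharf0P _).1.
elim: i => [|i IHi]; first by rewrite dpow0 invr1 scale1r.
apply: (@scalerI _ _ (i.+1%:R : k)) => //.
rewrite scaler_nat -dpowS IHi linearZ /= scalerA factS natrM invfM mulrA.
by rewrite mulfV // mul1r.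
Qed.

(** Paths are shorter than the number of vertices, so the series may be cut anywhere from there on;
    this freedom is used to split off its initial terms. *)
Lemma transvection_exp n f : (#|vertex Q| <= n)%N ->
  transvection tb f = \sum_(i < n) (i`!)%:R^-1 *: iter i (dpow 1) f.
Proof.
move=> Qn; pose h f := \sum_(i < n) dpow i f.
under eq_bigr => i _ do rewrite -dpow_iter.
apply: (linear_basis_eq (G := h)) => [|c f1 f2|u]; first exact: linearP.
  by rewrite /h scaler_sumr -big_split; apply: eq_bigr => i _; exact: linearP.
by apply: transvection_dpow; apply: leq_trans Qn; apply: parrows_lt.
Qed.

End Derivation.
End Transvections.

(** * Homotopy of oriented paths, and gradings of ideals by homotopy classes *)

Section HomotopyOfPaths.
Variables (k : fieldType) (Q : quiver).
Notation kQ := (path_alg k Q).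
Notation pb := (@pbasis k Q).
Implicit Types (f g : kQ) (u v w : qpath Q) (I J : ptsideal kQ).

Lemma ideal_subspace I : subspace (fun f => f \in I).
Proof.
split=> [|c f g fI gI]; first exact: rpred0.
by rewrite rpredD // -mulr_algl; apply: ideal_mull.
Qed.

Definition path_homotopic I u v := homotopic I (walk_of_path u) (walk_of_path v).

Lemma path_homotopic_refl I u : path_homotopic I u u.
Proof. exact: homotopic_refl. Qed.

Lemma path_homotopic_sym I u v : path_homotopic I u v -> path_homotopic I v u.
Proof. exact: homotopic_sym. Qed.

Lemma path_homotopic_trans I u v w :
  path_homotopic I u v -> path_homotopic I v w -> path_homotopic I u w.
Proof. exact: homotopic_trans. Qed.

(** A part of a minimal relation that lies in the ideal is empty or everything. So a projection onto
    a set of paths that preserves [I] cannot separate the terms of a minimal relation. *)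
Lemma minimal_relation_part I n (t : 'I_n -> k) (u : 'I_n -> qpath Q)
    (P : pred (qpath Q)) i j :
  minimal_relation I t u -> ppart k P (\sum_i t i *: pb (u i)) \in I ->
  P (u i) -> P (u j).
Proof.
case=> _ _ _ _ Imin; pose E := [set i | P (u i)].
have -> : ppart k P (\sum_i t i *: pb (u i)) = \sum_(i in E) t i *: pb (u i).
  rewrite linear_sum [RHS]big_mkcond; apply: eq_bigr => l _.
  by rewrite linearZ /= ppart_basis inE; case: ifP => //; rewrite scaler0.
move=> EI Pi; apply: contrapT => Pj.
have E0 : E != set0 by apply/set0Pn; exists i; rewrite inE.
have ET : E \proper setT.
  by apply/properP; split; [apply: subsetT | exists j; rewrite ?inE //; apply/negP].
by have := Imin E E0 ET; rewrite EI.
Qed.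

Lemma ppart_ends x y f :
  ppart k (fun u => (psrc u == x) && (ptgt u == y)) f =
    pb (stationary y) * f * pb (stationary x).
Proof.
pose h f := pb (stationary y) * f * pb (stationary x).
apply: (linear_basis_eq (G := h)) => [c f1 f2|c f1 f2|u]; first exact: linearP.
  by rewrite /h mulrDr mulrDl -scalerAr -scalerAl.
rewrite ppart_basis /h; case: (eqVneq (psrc u) x) => [<- | ux] /=.
  rewrite -mulrA pbasis_src; case: (eqVneq (ptgt u) y) => [<- | uy].
    by rewrite pbasis_tgt.
  by rewrite pbasisM pcompN.
by rewrite -mulrA pbasisM pcompN ?mulr0 // eq_sym.
Qed.

Lemma minimal_relation_parallel I n (t : 'I_n -> k) (u : 'I_n -> qpath Q) i j :
  minimal_relation I t u -> parallel (u i) (u j).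
Proof.
move=> tu; pose P v := (psrc v == psrc (u i)) && (ptgt v == ptgt (u i)).
suff : P (u j) by case/andP=> /eqP us /eqP ut; split.
apply: (@minimal_relation_part I n t u P i j tu); last by rewrite /P !eqxx.
rewrite ppart_ends; case: tu => _ _ _ tuI _.
by apply: ideal_mulr; apply: ideal_mull.
Qed.

Lemma homotopic_parallel I (u v : walk Q) : homotopic I u v -> parallel u v.
Proof.
elim=> {u v} [//|u v _ [us ut]|u v w _ [us ut] _ [vs vt]||||n t u i j tu].
- by split.
- by split; [rewrite us | rewrite ut].
- move=> u u' v v' w w' _ [us ut] _ [vs vt].
  move=> /pcomp_Some[_ [ws wt _]] /pcomp_Some[_ [ws' wt' _]].
  by split; rewrite ?ws ?wt ?ws' ?wt'.
- by move=> a w /pcomp_Some[_ [ws wt _]]; split; rewrite ?ws ?wt.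
- by move=> a w /pcomp_Some[_ [ws wt _]]; split; rewrite ?ws ?wt.
exact: minimal_relation_parallel tu.
Qed.

Lemma path_homotopic_parallel I u v : path_homotopic I u v -> parallel u v.
Proof. exact: homotopic_parallel. Qed.

Lemma walk_of_path_comp u v w : pcomp u v = Some w ->
  pcomp (walk_of_path u) (walk_of_path v) = Some (walk_of_path w).
Proof.
move=> /pcomp_Some[vu [ws wt wE]]; apply: pcomp_eq => //.
by rewrite /= ws wt wE map_cat.
Qed.

Lemma path_homotopic_compl I u v v' w w' :
  pcomp u v = Some w -> pcomp u v' = Some w' ->
  path_homotopic I v v' -> path_homotopic I w w'.
Proof.
move=> /walk_of_path_comp wE /walk_of_path_comp wE' vv'.
exact: homotopic_cat (homotopic_refl I _) vv' wE wE'.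
Qed.

Lemma path_homotopic_compr I u v v' w w' :
  pcomp v u = Some w -> pcomp v' u = Some w' ->
  path_homotopic I v v' -> path_homotopic I w w'.
Proof.
move=> /walk_of_path_comp wE /walk_of_path_comp wE' vv'.
exact: homotopic_cat vv' (homotopic_refl I _) wE wE'.
Qed.

Lemma homotopic_cancell I (u v w : walk Q) :
  pcomp u v = Some w -> exists2 z, pcomp (walk_inv u) w = Some z & homotopic I z v.
Proof.
move=> wE; have [vu [ws wt _]] := pcomp_Some wE.
have [|z zE _] := @pcompP _ (walk_inv u) w; first by rewrite wt.
exists z => //.
have [|r rE _] := @pcompP _ (walk_inv u) u; first by [].
have := pcompA (walk_inv u) u v; rewrite wE rE /= zE => /esym rz.
apply: homotopic_cat (homotopic_invl I rE) (homotopic_refl I v) rz _.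
by rewrite -vu; apply: pcomp1l.
Qed.

Lemma homotopic_cancelr I (u v w : walk Q) :
  pcomp v u = Some w -> exists2 z, pcomp w (walk_inv u) = Some z & homotopic I z v.
Proof.
move=> wE; have [uv [ws wt _]] := pcomp_Some wE.
have [|z zE _] := @pcompP _ w (walk_inv u); first by rewrite ws.
exists z => //.
have [|r rE _] := @pcompP _ u (walk_inv u); first by [].
have := pcompA v u (walk_inv u); rewrite wE rE /= zE => rz.
apply: homotopic_cat (homotopic_refl I v) (homotopic_invr I rE) rz _.
by rewrite uv; apply: pcomp1r.
Qed.

(** A path has no inverse path but has an inverse walk, and composing with it cancels [u]. *)
Lemma path_homotopic_cancell I u v v' w w' :
  pcomp u v = Some w -> pcomp u v' = Some w' ->
  path_homotopic I w w' -> path_homotopic I v v'.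
Proof.
move=> /walk_of_path_comp wE /walk_of_path_comp wE' ww'.
have [z zE zv] := homotopic_cancell I wE; have [z' zE' zv'] := homotopic_cancell I wE'.
apply: homotopic_trans (homotopic_sym zv) (homotopic_trans _ zv').
exact: homotopic_cat (homotopic_refl I _) ww' zE zE'.
Qed.

Lemma path_homotopic_cancelr I u v v' w w' :
  pcomp v u = Some w -> pcomp v' u = Some w' ->
  path_homotopic I w w' -> path_homotopic I v v'.
Proof.
move=> /walk_of_path_comp wE /walk_of_path_comp wE' ww'.
have [z zE zv] := homotopic_cancelr I wE; have [z' zE' zv'] := homotopic_cancelr I wE'.
apply: homotopic_trans (homotopic_sym zv) (homotopic_trans _ zv').
exact: homotopic_cat ww' (homotopic_refl I _) zE zE'.
Qed.

(** The ideal is graded by the fibres of [c]. Degrees are named by paths [u], so [C] can be any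
    type, in particular the type of predicates on paths. *)
Definition homogeneous (C : Type) (c : qpath Q -> C) I : Prop :=
  forall f u, f \in I -> ppart k (fun v => `[< c v = c u >]) f \in I.

(** A minimal relation of a graded ideal has all its terms in one degree, and minimal relations are
    the only generators of the homotopy relation that depend on the ideal. *)
Lemma homogeneous_homotopic I J (C : Type) (c : qpath Q -> C) :
  (forall u v, c u = c v -> path_homotopic J u v) -> homogeneous c I ->
  forall u v : walk Q, homotopic I u v -> homotopic J u v.
Proof.
move=> cJ cI u v; elim=> {u v}.
- by move=> u; apply: homotopic_refl.
- by move=> u v _; apply: homotopic_sym.
- by move=> u v w _ uv _; apply: homotopic_trans.
- by move=> u u' v v' w w' _ uu' _ vv'; apply: homotopic_cat.
- by move=> a w; apply: homotopic_arrV.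
- by move=> a w; apply: homotopic_Varr.
move=> n t u i j tu; apply: cJ; apply: esym.
suff : `[< c (u j) = c (u i) >] by move/asboolP.
apply: (@minimal_relation_part I n t u (fun v => `[< c v = c (u i) >]) i j tu).
  by apply: cI; case: tu.
exact/asboolP.
Qed.

Lemma supportP f u : reflect (coef f u != 0) (u \in msupp f).
Proof. by rewrite /coef mcoeff_neq0; apply: idP. Qed.

(** The last hypothesis says that no nonempty proper part of [f] lies in [I]; then [f], indexed by
    its support, is a minimal relation. *)
Lemma support_relation I f u v : f \in I -> coef f u != 0 -> coef f v != 0 -> u != v ->
  (forall P : pred (qpath Q), ppart k P f \in I ->
     forall w w', coef f w != 0 -> P w -> coef f w' != 0 -> P w') ->
  path_homotopic I u v.
Proof.
move=> fI fu fv uv fmin; pose s : seq (qpath Q) := msupp f; pose n := size s.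
pose p (i : 'I_n) : qpath Q := tnth (in_tuple s) i.
pose t i := coef f (p i).
have fE : f = \sum_i t i *: pb (p i).
  rewrite [LHS]monalgE -[RHS](big_tnth _ _ s predT (fun w => coef f w *: pb w)).
  by apply: eq_bigr => w _; rewrite pbasisZ.
have s_uniq : uniq s by apply: fset_uniq.
have p_inj : injective p by apply/tuple_uniqP.
have t0 i : t i != 0 by apply/supportP; apply: mem_tnth.
have p_surj w : coef f w != 0 -> exists i, p i = w.
  by move=> /supportP fw; have /tnthP[i wi] : w \in in_tuple s by []; exists i.
have [i iu] := p_surj _ fu; have [j jv] := p_surj _ fv.
rewrite -iu -jv; apply: (@homotopic_rel _ _ _ n t); split=> //.
- rewrite ltnNge; apply: contraNN uv => n1; rewrite -iu -jv; apply/eqP; congr p.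
  apply: val_inj; case: (i) (j) n1 => [x xn] [y yn] /=; clear -xn yn.
  by move: (n) xn yn => [|[|//]] //; case: x => // _; case: y.
- by rewrite -fE.
move=> E /set0Pn[l lE] /properP[_ [r _ rE]]; apply/negP => EI.
pose P w := [exists i in E, p i == w].
have PE m : P (p m) = (m \in E).
  apply/exists_inP/idP => [[m' m'E /eqP/p_inj <-//] | mE]; by exists m.
suff : P (p r) by rewrite PE (negPf rE).
apply: (fmin P _ (p l) _ (t0 l) _ (t0 r)); last by rewrite PE.
rewrite fE linear_sum [X in X \in I](_ : _ = \sum_(i in E) t i *: pb (p i)) //.
rewrite [RHS]big_mkcond; apply: eq_bigr => m _.
by rewrite linearZ /= ppart_basis PE; case: ifP => //; rewrite scaler0.
Qed.

(** As long as some predicate cuts a proper part in [I] out of [f], split [f] and use induction on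
    the size of the support. A piece that cannot be split has its support in a single homotopy
    class, so its projection is itself or zero. *)
Lemma homotopic_homogeneous I (C : Type) (c : qpath Q -> C) :
  (forall u v, path_homotopic I u v -> c u = c v) -> homogeneous c I.
Proof.
move=> cI f u; have [n] := ubnP #|` msupp f|; elim: n f => // n IHn f fn fI.
set P0 : pred (qpath Q) := fun v => _.
have [[P [PI [u1 [u2 [fu1 fu2 Pu1 Pu2]]]]] | fmin] := pselect (exists P : pred (qpath Q),
  ppart k P f \in I /\ exists u1 u2, [/\ coef f u1 != 0, coef f u2 != 0, P u1 & ~~ P u2]).
  have lt_supp (P' : pred (qpath Q)) w : coef f w != 0 -> ~~ P' w ->
      (#|` msupp (ppart k P' f)| < n)%N.
    move=> fw Pw; rewrite ltnS in fn; apply: leq_trans fn.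
    rewrite [X in (_ < X)%N](cardfsD1 w) (introT (supportP _ _) fw) add1n ltnS.
    apply: fsubset_leq_card; apply/fsubsetP => v /supportP.
    rewrite ppart_coef !inE; case: ifP; last by rewrite eqxx.
    move=> Pv fv; rewrite (introT (supportP _ _) fv) andbT.
    by apply: contraTneq Pv => ->.
  have fE : f = ppart k P f + ppart k (predC P) f.
    apply/coefP => w; rewrite coefD !ppart_coef /=.
    by case: (P w); rewrite ?addr0 ?add0r.
  rewrite [f in ppart _ _ f]fE linearD rpredD //; first by apply: IHn PI; apply: lt_supp Pu2.
  apply: IHn; first by apply: (lt_supp _ u1); rewrite //= Pu1.
  by rewrite (_ : ppart k _ f = f - ppart k P f) ?rpredB // {2}fE addrC addKr.
have cf u1 u2 : coef f u1 != 0 -> coef f u2 != 0 -> c u1 = c u2.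
  move=> fu1 fu2; have [-> // | u12] := eqVneq u1 u2.
  apply: cI; apply: (support_relation fI) => // P PI w1 w fw1 Pw1 fw.
  apply: contrapT => Pw; apply: fmin; exists P; split=> //.
  by exists w1, w; split=> //; apply/negP.
have [[v fv /asboolP vP] | noP] := pselect (exists2 v, coef f v != 0 & P0 v).
  by rewrite ppart_id // => w fw; apply/asboolP; rewrite -vP; apply: cf.
by rewrite ppart0 ?rpred0 // => w fw; apply/negP => wP; apply: noP; exists w.
Qed.

End HomotopyOfPaths.

(** The predicate [path_homotopic I u] is the class of [u], so that [path_homotopic I] itself can
    serve as the degree map in [homogeneous]. *)
Lemma path_homotopic_class (k : fieldType) (Q : quiver) (I : ptsideal (path_alg k Q)) u v :
  path_homotopic I u = path_homotopic I v <-> path_homotopic I u v.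
Proof.
split=> [-> | uv]; first exact: path_homotopic_refl.
apply/funext => w; apply/propext; split; first exact: path_homotopic_trans (path_homotopic_sym uv).
exact: path_homotopic_trans uv.
Qed.

Section HomotopyClasses.
Variables (k : fieldType) (Q : quiver) (r : seq (qpath Q)).
Hypothesis r_all : forall u, u \in r.
Implicit Type I : ptsideal (path_alg k Q).

(** A class is numbered by its first member in [r]: the projections of a grading are summed over a
    finite index set. The successor is there for [inord], the search always succeeding. *)
Definition hclass I (u : qpath Q) : 'I_(size r).+1 :=
  inord (find (fun v => `[< path_homotopic I u v >]) r).

Lemma hclassP I u v : hclass I u = hclass I v <-> path_homotopic I u v.
Proof.
split=> [/(congr1 val) /= | uv]; last first.
  congr inord; apply: eq_find => w; apply/asboolP/asboolP.
    exact: path_homotopic_trans (path_homotopic_sym uv).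
  exact: path_homotopic_trans uv.
rewrite !inordK ?ltnS ?find_size // => uvE.
have hasr w : has (fun v => `[< path_homotopic I w v >]) r.
  by apply/hasP; exists w => //; apply/asboolP; apply: path_homotopic_refl.
have /asboolP := nth_find u (hasr u); have /asboolP := nth_find u (hasr v).
rewrite uvE => vw uw; exact: path_homotopic_trans uw (path_homotopic_sym vw).
Qed.

End HomotopyClasses.

(** * Ideals related by a transvection that changes the classes of two gradings *)

Section Comparison.
Variables (k : fieldType) (Q : quiver).
Hypothesis char0 : [pchar k] =i pred0.
Hypothesis Qacyclic : no_oriented_cycle Q.
Hypothesis Qbypass : no_double_bypass Q.
Notation kQ := (path_alg k Q).
Notation pb := (@pbasis k Q).

Lemma homogeneous_ppart (I : ptsideal kQ) m (c : qpath Q -> 'I_m) i f :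
  homogeneous c I -> f \in I -> ppart k (fun u => c u == i) f \in I.
Proof.
move=> cI fI; have [[v vi] | nov] := pselect (exists v, c v = i).
  rewrite (_ : ppart k _ f = ppart k (fun u => `[< c u = c v >]) f); first exact: cI.
  apply/coefP => u; rewrite !ppart_coef vi.
  by case: eqP => ui; [rewrite asboolT | rewrite asboolF].
by rewrite ppart0 ?rpred0 // => u _; apply/eqP => ui; apply: nov; exists u.
Qed.

Lemma dpow_opp (t : arrow Q -> kQ) (tb : transv t) f :
  dpow (fun a => - t a) 1 f = - dpow t 1 f.
Proof.
pose h : {linear kQ -> kQ} := \- dpow t 1.
apply: (linear_basis_eq (F := dpow (fun a => - t a) 1) (G := h)); try exact: linearP.
elim/qpath_ind => [x|a v u vaE IHv]; rewrite /h /=.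
  by rewrite !dpow_stationary oppr0.
rewrite !(dpow_cons _ _ vaE) IHv !dpow0 /h /=.
by rewrite mulNr mulrN opprD.
Qed.

Section Stable.
Variables (d : arrow Q -> kQ) (db : transv d) (K1 K2 I J : ptsideal kQ).
Hypothesis d1 : forall a w, coef (d a) w != 0 -> ~ path_homotopic K1 (arrow_path a) w.
Hypothesis d2 : forall a w, coef (d a) w != 0 -> ~ path_homotopic K2 (arrow_path a) w.
Hypothesis IJ : forall f, (f \in I) = (transvection db f \in J).
Hypothesis I1 : homogeneous (path_homotopic K1) I.
Hypothesis J2 : homogeneous (path_homotopic K2) J.

Lemma derivation_changes_class (K : ptsideal kQ) u :
  (forall a w, coef (d a) w != 0 -> ~ path_homotopic K (arrow_path a) w) ->
  supp_on (fun v => ~ path_homotopic K u v) (dpow d 1 (pb u)).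
Proof.
move=> dK; apply: (dpow_compat (S := fun u v => ~ path_homotopic K u v)) => //.
  by move=> {}u v v' w w' nvv' wE wE' /(path_homotopic_cancell wE wE').
by move=> {}u v v' w w' nvv' wE wE' /(path_homotopic_cancelr wE wE').
Qed.

(** The filtered argument applied to the filtration by length of paths, with [I] graded by the
    classes of [K1] and its image [J] by those of [K2]. *)
Lemma derivation_stable f : f \in I -> dpow d 1 f \in I.
Proof.
have [r r_all] := ex_all_paths Qacyclic.
pose c1 := hclass r K1; pose c2 := hclass r K2.
pose F i (f : kQ) := supp_on (fun u => i <= size (parrows u))%N f.
pose p (c : qpath Q -> 'I_(size r).+1) i := ppart k (fun u => c u == i).
pose db' := transvN db.
have c_homog (K K' : ptsideal kQ) :
    homogeneous (path_homotopic K) K' -> homogeneous (hclass r K) K'.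
  move=> KK' g u gK'; have := KK' g u gK'; congr (_ \in K'); congr (ppart k _ g).
  apply/funext => v; apply/asboolP/asboolP => [/path_homotopic_class|].
    by move/(hclassP r_all).
  by move/(hclassP r_all)/path_homotopic_class.
have pNp (K : ptsideal kQ) i g : (forall a w, coef (d a) w != 0 -> ~ path_homotopic K (arrow_path a) w) ->
    p (hclass r K) i (dpow d 1 (p (hclass r K) i g)) = 0.
  move=> dK; apply: ppart0.
  have : supp_on (fun u => hclass r K u = i) (p (hclass r K) i g).
    by move=> u; rewrite ppart_coef; case: ifP => [/eqP //|_]; rewrite eqxx.
  apply: supp_on_map => u ui; apply: supp_onS (derivation_changes_class dK) => v nuv.
  by apply/eqP => vi; apply: nuv; apply/(hclassP r_all); rewrite ui vi.
apply: (@graded_exponential_stable k kQ #|vertex Q| _ (dpow d 1) (transvection db)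
  (transvection db') (p c1) (p c2) F (fun f => f \in I)).
- move=> x; rewrite -[LHS]/(transvection db x).
  (* The series is cut two terms later than necessary, so that splitting off its first two terms
     leaves a sum over [#|vertex Q|] indices. *)
  rewrite (transvection_exp Qacyclic Qbypass db char0 _ (leqW (leqW (leqnn _)))).
  by rewrite !big_ord_recl /= !invr1 !scale1r addrA.
- move=> x; rewrite -[LHS]/(transvection db' x).
  rewrite (transvection_exp Qacyclic Qbypass db' char0 _ (leqnn _)).
  apply: eq_bigr => i _; rewrite mulrC -scalerA; congr (_ *: _).
  elim: (nat_of_ord i) => [|j IHj] /=; first by rewrite expr0 scale1r.
  by rewrite IHj (dpow_opp db) linearZ /= exprS mulN1r scaleNr.
- by apply: transvectionK.
- by apply: transvectionK => // a; rewrite opprK.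
- by move=> i; apply: supp_on_subspace.
- by [].
- move=> x xF; apply/coefP => u; rewrite coef0; apply: contrapT => /eqP/xF.
  by rewrite leqNgt (parrows_lt Qacyclic).
- by move=> i x; apply: supp_onS => u; apply: ltnW.
- move=> i x xF; apply: supp_on_map xF => u iu.
  apply: supp_onS (dpow_longer Qacyclic Qbypass db (u := u)) => v; exact: leq_ltn_trans iu.
- by move=> i x; apply/coefP => u; rewrite !ppart_coef; case: (c1 u == i).
- by move=> i x; apply/coefP => u; rewrite !ppart_coef; case: (c2 u == i).
- by move=> x; apply: ppart_grading.
- by move=> x; apply: ppart_grading.
- by move=> i j x; apply: ppart_comm.
- by move=> i j x /ppart_supp xF; apply: supp_onS (xF _) => u [].
- by move=> i j x /ppart_supp xF; apply: supp_onS (xF _) => u [].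
- by move=> i x; apply: pNp.
- by move=> i x; apply: pNp.
- exact: ideal_subspace.
- by move=> i x; apply: homogeneous_ppart; apply: c_homog.
- move=> i x xI; rewrite IJ transvectionK => [|//|a]; last by rewrite opprK.
  by apply: homogeneous_ppart; [apply: c_homog | rewrite -IJ].
Qed.

(** Stability under the derivation gives stability under the exponentials of [d] and [- d], which
    are inverse to each other; so the image [J] of [I] is [I]. *)
Lemma transvected_ideal_eq : forall f, (f \in I) = (f \in J).
Proof.
pose M f := f \in I.
have Isub : subspace M by apply: ideal_subspace.
have stable t (tb : transv t) : (forall f, f \in I -> dpow t 1 f \in I) ->
    forall f, f \in I -> transvection tb f \in I.
  move=> tI f fI; rewrite (transvection_exp Qacyclic Qbypass tb char0 _ (leqnn _)).
  apply: rpred_sum => i _; apply: (subspaceZ _ Isub); rewrite /M.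
  by elim: (nat_of_ord i) => //= j; apply: tI.
have db'K : cancel (transvection db) (transvection (transvN db)) by apply: transvectionK.
have dbK : cancel (transvection (transvN db)) (transvection db).
  by apply: transvectionK => // a; rewrite opprK.
have stableN f : f \in I -> transvection (transvN db) f \in I.
  by apply: stable => g gI; rewrite dpow_opp // rpredN; apply: derivation_stable.
move=> f; apply/idP/idP => [fI | fJ].
  by rewrite -(dbK f) -IJ; apply: stableN.
rewrite -(dbK f); apply: stable; first exact: derivation_stable.
by rewrite IJ dbK.
Qed.

End Stable.
End Comparison.

Lemma subpred_count_eq (T : eqType) (a b : pred T) (s : seq T) :
  subpred a b -> (count b s <= count a s)%N -> {in s, subpred b a}.
Proof.
move=> ab; elim: s => //= x s IHs le_ba.
have le_s : (count b s <= count a s)%N.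
  by move: le_ba; case: (boolP (a x)) => [/ab -> | _]; rewrite ?leq_add2l // add0n;
    apply: leq_trans; apply: leq_addl.
have le_x : (b x <= a x)%N.
  rewrite -(leq_add2r (count b s)); apply: leq_trans le_ba _.
  by rewrite leq_add2l; apply: sub_count.
move=> y; rewrite inE => /predU1P[-> bx | /(IHs le_s)//].
by move: le_x; rewrite bx; case: (a x).
Qed.

(** * The transvected kernel with the least homotopy relation *)

Section TransvectedKernels.
Variables (k : fieldType) (Q : quiver) (B : algType k).
Hypothesis char0 : [pchar k] =i pred0.
Hypothesis Qacyclic : no_oriented_cycle Q.
Hypothesis Qbypass : no_double_bypass Q.
Notation kQ := (path_alg k Q).
Notation pb := (@pbasis k Q).
Variable g : {lrmorphism kQ -> B}.

(** Comparing oriented paths is enough, because the relations by which two ideals differ on walks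
    join oriented paths. *)
Lemma path_homotopic_mono (I J : ptsideal kQ) :
  (forall u v, path_homotopic I u v -> path_homotopic J u v) ->
  forall u v : walk Q, homotopic I u v -> homotopic J u v.
Proof.
move=> IJ; apply: (@homogeneous_homotopic _ _ _ _ _ (path_homotopic I)).
  by move=> u v /path_homotopic_class/IJ.
by apply: homotopic_homogeneous => u v uv; apply/path_homotopic_class.
Qed.

Lemma homotopic_eq_ideal (I J : ptsideal kQ) : (forall f, (f \in I) = (f \in J)) ->
  forall u v, path_homotopic I u v -> path_homotopic J u v.
Proof.
move=> IJ u v; apply: (@homogeneous_homotopic _ _ _ _ _ (path_homotopic J)).
  by move=> {}u {}v /path_homotopic_class.
have : homogeneous (path_homotopic J) J.
  by apply: homotopic_homogeneous => {}u {}v uv; apply/path_homotopic_class.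
by move=> Jh f w; rewrite !IJ; apply: Jh.
Qed.

(** Replacing arrows by bypasses homotopic to them keeps every path in its class. *)
Lemma ppart_transvection (K : ptsideal kQ) t (tb : transv t) w f :
  (forall a u, coef (t a) u != 0 -> path_homotopic K (arrow_path a) u) ->
  ppart k (fun v => `[< path_homotopic K v = path_homotopic K w >]) (transvection tb f) =
  transvection tb (ppart k (fun v => `[< path_homotopic K v = path_homotopic K w >]) f).
Proof.
move=> tK; set P := fun v => _.
apply: (linear_basis_eq (F := fun f => ppart k P (transvection tb f))
  (G := fun f => transvection tb (ppart k P f))) => [c f1 f2|c f1 f2|u].
- by rewrite !linearP.
- by rewrite !linearP.
have uS : supp_on (path_homotopic K u) (transvection tb (pb u)).
  apply: transvection_compat => //.
  - exact: path_homotopic_refl.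
  - exact: path_homotopic_trans.
  - exact: path_homotopic_parallel.
  - by move=> v v' v'' w' w'' h h1 h2; apply: path_homotopic_compl h1 h2 h.
  - by move=> v v' v'' w' w'' h h1 h2; apply: path_homotopic_compr h1 h2 h.
rewrite ppart_basis; case: ifP => [/asboolP uw | /asboolP uw].
  rewrite ppart_id // => v /uS uv; apply/asboolP; rewrite -uw.
  by apply/path_homotopic_class/path_homotopic_sym.
rewrite linear0 ppart0 // => v /uS uv; apply/asboolP => vw; apply: uw.
by rewrite -vw; apply/path_homotopic_class.
Qed.

Lemma homogeneous_transvection (K I J : ptsideal kQ) t (tb : transv t) :
  (forall a u, coef (t a) u != 0 -> path_homotopic K (arrow_path a) u) ->
  (forall f, (f \in I) = (transvection tb f \in J)) ->
  homogeneous (path_homotopic K) J -> homogeneous (path_homotopic K) I.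
Proof.
move=> tK IJ Jh f w; rewrite !IJ -ppart_transvection //; exact: Jh.
Qed.

(* The image of [ker g] under the transvection along [t]. *)
Definition transvected_ker t (tb : transv t) : ptsideal kQ :=
  ker_ideal (g \o transvection (transvN tb)).

Lemma transvected_kerE t (tb : transv t) f :
  (f \in transvected_ker tb) = (g (transvection (transvN tb) f) == 0).
Proof. exact: ker_idealE. Qed.

Lemma transvected_ker_transvection r s t (rb : transv r) (sb : transv s) (tb : transv t) f :
  (forall a, t a = s a + r a) ->
  (f \in transvected_ker sb) = (transvection rb f \in transvected_ker tb).
Proof.
move=> tE; rewrite !transvected_kerE; congr (g _ == 0); apply/esym.
by apply: transvection_comp => // a; rewrite tE opprD subrK.
Qed.

Lemma transv_ppart t (P : arrow Q -> pred (qpath Q)) : transv t ->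
  transv (fun a => ppart k (P a) (t a)).
Proof. by move=> tb a; apply: supp_onS (ppart_supp (tb a)) => u []. Qed.

Lemma ex_minimal_transvected_ker : exists t0 (tb0 : transv t0), forall t (tb : transv t),
  forall u v : walk Q, homotopic (transvected_ker tb0) u v -> homotopic (transvected_ker tb) u v.
Proof.
have [r r_all] := ex_all_paths Qacyclic.
pose pairs := [seq (u, v) | u <- r, v <- r].
pose rel t (tb : transv t) (uv : qpath Q * qpath Q) := `[< path_homotopic (transvected_ker tb) uv.1 uv.2 >].
pose size_is n := `[< exists t (tb : transv t), count (rel t tb) pairs = n >].
have size_ex : exists n, size_is n.
  by exists (count (rel _ (@transv0 k Q)) pairs); apply/asboolP; exists (fun=> 0), (@transv0 k Q).
have [n0 /asboolP[t0 [tb0 n0E]] n0_min] := ex_minnP size_ex.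
(* A relation contained in that of [t0] has at least as many pairs by minimality, hence is equal to
   it. *)
have t0_min s (sb : transv s) :
    (forall u v, path_homotopic (transvected_ker sb) u v -> path_homotopic (transvected_ker tb0) u v) ->
    forall u v, path_homotopic (transvected_ker tb0) u v -> path_homotopic (transvected_ker sb) u v.
  move=> st u v uv; apply/asboolP.
  apply: (@subpred_count_eq _ (rel s sb) (rel t0 tb0) pairs _ _ (u, v)).
  - by move=> p /asboolP/st st0; apply/asboolP.
  - by rewrite n0E; apply: n0_min; apply/asboolP; exists s, sb.
  - exact: allpairs_f.
  exact/asboolP.
exists t0, tb0 => t tb; apply: path_homotopic_mono.
pose I0 := transvected_ker tb0; pose J := transvected_ker tb.
pose d a := t a - t0 a.
have db : transv d by apply: transvD => //; apply: transvN.
pose P1 a w := `[< path_homotopic I0 (arrow_path a) w >].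
pose P2 a w := ~~ P1 a w && `[< path_homotopic J (arrow_path a) w >].
pose P3 a w := ~~ P1 a w && ~~ `[< path_homotopic J (arrow_path a) w >].
pose d1 a := ppart k (P1 a) (d a); have db1 : transv d1 by apply: transv_ppart.
pose d2 a := ppart k (P2 a) (d a); have db2 : transv d2 by apply: transv_ppart.
pose d3 a := ppart k (P3 a) (d a); have db3 : transv d3 by apply: transv_ppart.
have dE a : d a = d1 a + d2 a + d3 a.
  apply/coefP => u; rewrite !coefD /d1 /d2 /d3 !ppart_coef /P2 /P3.
  by case: (P1 a u); case: `[< path_homotopic J _ _ >] => /=; rewrite ?addr0 ?add0r -?coefD.
(* The ideals [I'] and [J'] of the overview are the kernels transvected along [sb1] and [sb3]: as
   [t0 + d = t], the parameter of [sb3] is [t - d2]. *)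
have sb1 : transv (fun a => t0 a + d1 a) by apply: transvD.
have sb3 : transv (fun a => t0 a + d1 a + d3 a) by apply: transvD.
have I0h : homogeneous (path_homotopic I0) I0.
  by apply: homotopic_homogeneous => u v uv; apply/path_homotopic_class.
have Jh : homogeneous (path_homotopic J) J.
  by apply: homotopic_homogeneous => u v uv; apply/path_homotopic_class.
have I1h : homogeneous (path_homotopic I0) (transvected_ker sb1).
  apply: (homogeneous_transvection (tb := transvN db1)) I0h => [a u|f].
    rewrite -scaleN1r coefZ /d1 ppart_coef.
    by case: ifP => [/asboolP | _]; rewrite ?mulr0 ?eqxx.
  by apply: transvected_ker_transvection => a; rewrite addrK.
have J1h : homogeneous (path_homotopic J) (transvected_ker sb3).
  apply: (homogeneous_transvection (tb := db2)) Jh => [a u|f].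
    by rewrite /d2 ppart_coef; case: ifP => [/andP[_ /asboolP]|]; rewrite ?eqxx.
  apply: transvected_ker_transvection => a.
  have aux (x y z w : kQ) : x + (y + z + w) = x + y + w + z by rewrite addrAC !addrA.
  by rewrite -aux -dE /d addrC subrK.
have IJ : forall f, (f \in transvected_ker sb1) = (f \in transvected_ker sb3).
  have d3I a w : coef (d3 a) w != 0 -> ~ path_homotopic I0 (arrow_path a) w.
    by rewrite ppart_coef; case: ifP => [/andP[/asboolP]|]; rewrite ?eqxx.
  have d3J a w : coef (d3 a) w != 0 -> ~ path_homotopic J (arrow_path a) w.
    by rewrite ppart_coef; case: ifP => [/andP[_ /asboolP]|]; rewrite ?eqxx.
  have I1J f : (f \in transvected_ker sb1) = (transvection db3 f \in transvected_ker sb3).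
    exact: transvected_ker_transvection.
  exact: (transvected_ideal_eq char0 Qacyclic Qbypass d3I d3J I1J I1h J1h).
move=> u v uv.
have uv1 : path_homotopic (transvected_ker sb1) u v.
  apply: t0_min uv => {}u {}v.
  apply: (@homogeneous_homotopic _ _ _ _ _ (path_homotopic I0)) => // {}u {}v.
  by move/path_homotopic_class.
have uv3 := homotopic_eq_ideal IJ uv1.
apply: (homogeneous_homotopic _ J1h uv3) => u' v'.
by move/path_homotopic_class.
Qed.

End TransvectedKernels.

(** * The radical of a finite dimensional algebra *)

Section Radical.
Variables (k : fieldType) (A : falgType k).
Implicit Types (a b e f : A) (M N L : {vspace A}).
Local Notation R := (radical A).

Lemma radical_mull a x : x \in R -> a * x \in R.
Proof. exact: radical_ideal_mull. Qed.

Lemma radical_mulr a x : x \in R -> x * a \in R.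
Proof. exact: radical_ideal_mulr. Qed.

Lemma sub_maximal_left_ideal L : left_ideal L -> L != fullv ->
  exists2 M, maximal_left_ideal M & (L <= M)%VS.
Proof.
move=> Ll Lf; pose P n := `[< exists M, [/\ left_ideal M, M != fullv, (L <= M)%VS & \dim M = n] >].
have exP : exists n, P n by exists (\dim L); apply/asboolP; exists L; split.
have ubP n : P n -> (n <= \dim {:A})%N.
  by case/asboolP=> M [_ _ _ <-]; rewrite dimvS ?subvf.
have [_ /asboolP[M [Ml Mf LM <-]] Mmax] := ex_maxnP exP ubP.
exists M => //; split=> // N Nl MN.
have [-> | NF] := eqVneq N fullv; [by right | left].
apply/esym/eqP; rewrite eqEdim MN; apply: Mmax.
by apply/asboolP; exists N; split=> //; apply: subv_trans LM MN.
Qed.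

(** Otherwise the left ideal generated by [1 - r] lies in a maximal one, which contains [r] as well
    and hence [1]. *)
Lemma radical_quasi_invertible r : r \in R -> exists b, b * (1 - r) = 1.
Proof.
move=> rR; pose L := ({:A} * <[1 - r]>)%VS.
have Ll : left_ideal L by rewrite /left_ideal /L prodvA prodvSl ?subvf.
have [Lf | /(sub_maximal_left_ideal Ll)[M Mmax LM]] := eqVneq L fullv.
  have : 1 \in L by rewrite Lf memvf.
  by case/memv_cosetP=> b _ bE; exists b.
have [/left_idealP Ml Mf _] := Mmax; case/eqP: Mf.
have M1 : 1 \in M.
  rewrite -(subrK r 1); apply: memvD; last exact: (radicalP r).1 rR M Mmax.
  apply: (subvP LM); rewrite -[1 - r]mul1r; apply: memv_mul; first exact: memvf.
  exact: memv_line.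
by apply/eqP; rewrite eqEsubv subvf; apply/subvP => x _; rewrite -[x]mulr1; apply: Ml.
Qed.

(** The left inverse [b = 1 + b * r] is again of the form [1] minus a radical element, so it has a
    left inverse [c]; then [c = c * b * (1 - r) = 1 - r]. *)
Lemma radical_invertible r : r \in R -> exists b, b * (1 - r) = 1 /\ (1 - r) * b = 1.
Proof.
move=> rR; have [b br] := radical_quasi_invertible rR.
have [|c cb] := @radical_quasi_invertible (- (b * r)).
  by rewrite rpredN; apply: radical_mull.
have bE : 1 - - (b * r) = b by rewrite opprK -{1}br mulrBr mulr1 subrK.
exists b; split=> //; rewrite bE in cb.
by rewrite -[1 - r]mul1r -[X in X * (1 - r)]cb -[c * b * _]mulrA br mulr1.
Qed.

(** Exponents are successors because [R ^+ 0] is the line spanned by [1], which does not belong to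
    the decreasing chain. *)
Lemma radical_expD m n : (R ^+ (m + n).+1 <= R ^+ m.+1)%VS.
Proof.
elim: m => [|m IHm]; last by rewrite addSn expvSl [X in (_ <= X)%VS]expvSl prodvSr.
elim: n => [|n IHn]; first exact: subvv.
by rewrite expvSl; apply/prodvP => u v uR _; apply: radical_mulr.
Qed.

(* A power of the radical that equals its square vanishes: it acts non-trivially
   on some minimal left ideal, which is then generated by a vector fixed by an
   element of the radical. *)
Lemma idempotent_subradical_eq0 M : (M <= R)%VS -> left_ideal M -> (M * M)%VS = M -> M = 0%VS.
Proof.
move=> MR Ml MM; apply/eqP; apply: contrapT => /negP M0.
pose P n := `[< exists L, [/\ left_ideal L, (L <= M)%VS, (M * L)%VS != 0%VS & \dim L = n] >].
have exP : exists n, P n.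
  by exists (\dim M); apply/asboolP; exists M; rewrite MM; split.
have [_ /asboolP[L [Ll LM ML <-]] Lmin] := ex_minnP exP.
have [l lL Ml0] : exists2 l, l \in L & (M * <[l]>)%VS != 0%VS.
  apply: contrapT => nol; case/eqP: ML; apply/eqP; rewrite -subv0.
  apply/prodvP => u v uM vL; rewrite memv0; apply: contrapT => /negP uv.
  apply: nol; exists v => //; apply: contraNneq uv => Mv.
  by rewrite -memv0 -Mv memv_mul ?memv_line.
have MlL : (M * <[l]> <= L)%VS.
  have /left_idealP Ll' := Ll.
  by apply/prodvP => u v _ /vlineP[c ->]; rewrite -scalerAr memvZ ?Ll'.
have lM : l \in (M * <[l]>)%VS.
  suff -> : (M * <[l]>)%VS = L by [].
  apply/eqP; rewrite eqEdim MlL; apply: Lmin; apply/asboolP; exists (M * <[l]>)%VS.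
  split=> //; last by rewrite prodvA MM.
    by rewrite /left_ideal prodvA prodvSl.
  exact: subv_trans MlL LM.
have [m mM lE] := memv_cosetP lM.
have [b bm] := radical_quasi_invertible (subvP MR _ mM).
have l0 : l = 0 by rewrite -[l]mul1r -bm -mulrA mulrBl mul1r -lE subrr mulr0.
case/negP: Ml0; rewrite l0 -subv0; apply/prodvP => u v _ /vlineP[c ->].
by rewrite scaler0 mulr0 mem0v.
Qed.

(** The powers decrease, so one of least dimension equals its square. *)
Lemma radical_nilpotent : exists n, (R ^+ n.+1)%VS = 0%VS.
Proof.
pose P d := `[< exists n, \dim (R ^+ n.+1)%VS = d >].
have exP : exists d, P d by exists (\dim R); apply/asboolP; exists 0%N.
have [_ /asboolP[n <-] nmin] := ex_minnP exP; exists n.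
apply: idempotent_subradical_eq0.
- exact: (radical_expD 0 n).
- apply/left_idealP => a x; elim: n x {nmin} => [|n _] x; first exact: radical_mull.
  rewrite expvSl; set N := (R ^+ n.+1)%VS; pose T := (amull a @^-1: (R * N))%VS.
  have aE y : amull a y = a * y by rewrite lfunE.
  rewrite -aE memv_preim; apply: subvP; apply/prodvP => u v uR vN.
  by rewrite -memv_preim aE mulrA memv_mul // radical_mull.
apply/eqP; rewrite -expvD addSn eqEdim radical_expD /=.
by apply: nmin; apply/asboolP; exists (n + n.+1)%N.
Qed.

Lemma idempotent_radical0 e : e * e = e -> e \in R -> e = 0.
Proof.
move=> ee eR; have [n Rn] := radical_nilpotent.
apply/eqP; rewrite -memv0 -Rn; elim: (n) => [|m IHm] //.
by rewrite expvSl -ee memv_mul.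
Qed.

End Radical.

(** * Characters of a basic algebra and its idempotents *)

Section Characters.
Variables (k : fieldType) (A : falgType k).
Local Notation R := (radical A).

(** The [chi i] are the coordinates of the isomorphism from [A] modulo its radical to [k^n]. *)
Lemma basic_characters : basic A -> exists n (chi : 'I_n -> {lrmorphism A -> k^o}),
  (forall a, a \in R <-> forall i, chi i a = 0) /\
  (forall c : 'I_n -> k, exists a, forall i, chi i a = c i).
Proof.
case=> n [f [f' fK f'K]]; exists n; pose q := quot_alg (radical_ideal A).
pose g i (a : A) : k^o := f (\pi_q a) i.
have gL i : linear (g i).
  move=> c x y; rewrite /g (pi_quot_add (radical_ideal A)) (pi_quot_scale (radical_ideal A)).
  by rewrite (_ : f _ = c *: f (\pi_q x) + f (\pi_q y)) ?ffunE //; apply: linearP.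
have gM i : {morph g i : x y / x * y}.
  move=> x y; rewrite /g (pi_quot_mul (radical_ideal A)) (_ : f _ = f (\pi_q x) * f (\pi_q y)).
    by rewrite ffunE.
  exact: rmorphM.
have g1 i : g i 1 = 1.
  have -> : g i 1 = f 1 i by rewrite /g; congr (f _ i); rewrite -[RHS]/(quot_one _) piE.
  by rewrite rmorph1 !ffunE.
pose chi i : {lrmorphism A -> k^o} := HB.pack (g i)
  (GRing.isLinear.Build _ _ _ _ _ (gL i))
  (GRing.isMonoidMorphism.Build A k^o (g i) (g1 i, gM i)).
exists chi; split=> [a | c].
  rewrite -[a \in R]/(a \in radical_ideal A) -{1}[a]subr0.
  have g0 i : g i 0 = 0 by rewrite -[LHS]/(chi i 0) linear0.
  split=> [/quot_eqP aE i | chi0]; first by rewrite /= -(g0 i) /g aE.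
  apply/quot_eqP; apply: (can_inj fK); apply/ffunP => i.
  by rewrite -/(g i a) -/(g i 0) g0; exact: chi0.
exists (repr (f' [ffun i => c i])) => i.
by rewrite /= /g reprK f'K ffunE.
Qed.

(** Lifting inside the corner [e A e] by Newton's iteration for [X^2 - X], with the inverse of
    [2 f - 1] approximated by [2 f - 1] itself. With [y = f^2 - f] the step gives [f + y - 2 y f],
    that is [3 f^2 - 2 f^3], and the new defect is [y^2 (4 y - 3)]. Gaining one power of the radical
    at each step is enough. *)
Lemma idempotent_lift (e b : A) n : e * e = e -> e * b = b -> b * e = b ->
  b * b - b \in R -> exists f : A,
  [/\ e * f = f, f * e = f, f - b \in R & f * f - f \in (R ^+ n.+1)%VS].
Proof.
move=> ee eb be bR; elim: n => [|n [f [ef fe fb fn]]].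
  by exists b; rewrite subrr rpred0.
set y := f * f - f in fn; exists (f + y - y * f *+ 2).
have fy : f * y = y * f by rewrite /y mulrBr mulrBl mulrA.
have yR : y \in R by apply: subvP fn; exact: (radical_expD A 0 n).
have ey : e * y = y by rewrite /y mulrBr mulrA ef.
have ye : y * e = y by rewrite /y mulrBl -mulrA fe.
have ffE : f * f = f + y by rewrite /y addrC subrK.
split.
- by rewrite mulrBr mulrDr mulrnAr mulrA ef ey.
- by rewrite mulrBl mulrDl mulrnAl -mulrA fe ye.
- rewrite -[f + y - _]addrA addrAC; apply: rpredD => //; apply: rpredB => //.
  by rewrite rpredMn // radical_mulr.
have -> : (f + y - y * f *+ 2) * (f + y - y * f *+ 2) - (f + y - y * f *+ 2) =
    y * y * (y *+ 4 - 3%:R).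
  (* Both sides are polynomials in [f], so the identity is checked by [ring] in the commutative ring
     [{poly k}]. *)
  pose h := horner_alg f.
  have [Y YE] : exists Y : {poly k}, Y = 'X * 'X - 'X by exists ('X * 'X - 'X).
  have hX : h 'X = f by rewrite /h /= horner_algX.
  have hY : h Y = y by rewrite /h YE rmorphB rmorphM /= -/h hX.
  have -> : f + y - y * f *+ 2 = h ('X + Y - Y * 'X *+ 2).
    by rewrite /h rmorphB rmorphD rmorphMn rmorphM /= -/h hX hY.
  rewrite /h -rmorphM -rmorphB -/h.
  have -> : y * y * (y *+ 4 - 3%:R) = h (Y * Y * (Y *+ 4 - 3%:R)).
    by rewrite /h !rmorphM rmorphB rmorphMn rmorph_nat /= -/h hY.
  by congr (h _); rewrite YE; ring.
have yyn : y * y * (y *+ 4 - 3%:R) = y * (y * (y *+ 4 - 3%:R)) by rewrite mulrA.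
rewrite yyn expvSr; apply: memv_mul => //; exact: radical_mulr.
Qed.

Lemma idempotent_field (c : k) : c * c = c -> c = 0 \/ c = 1.
Proof.
move/eqP; rewrite -subr_eq0 -{3}[c]mulr1 -mulrBr mulf_eq0 subr_eq0.
by case/orP=> /eqP ->; [left | right].
Qed.

Lemma character_idempotent (chi : {lrmorphism A -> k^o}) (e : A) : e * e = e ->
  chi e = 0 \/ chi e = 1.
Proof. by move=> ee; apply: idempotent_field; rewrite -[LHS]rmorphM ee. Qed.

Variable V : finType.

(** A nonzero idempotent is outside the radical, so some character is [1] on [e x]. Primitivity
    makes it unique, orthogonality separates the vertices, and [\sum_x e x = 1] makes every
    character occur. *)
Lemma vertex_characters (e : V -> A) : basic A ->
  (forall x, primitive_idempotent (e x)) ->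
  (forall x y, x != y -> e x * e y = 0) -> \sum_x e x = 1 ->
  exists chi : V -> {lrmorphism A -> k^o},
  (forall a, a \in R <-> forall x, chi x a = 0) /\
  (forall x y, chi x (e y) = (x == y)%:R).
Proof.
move=> /basic_characters[n [chi [chiR chi_surj]]] eP e_ort e_sum.
have e_one x : exists i, chi i (e x) = 1.
  have [ee e0 _] := eP x; apply: contrapT => no1; case/eqP: e0.
  apply: idempotent_radical0 => //; apply/chiR => i.
  by have [//|ei] := character_idempotent (chi i) ee; case: no1; exists i.
(* Lift to the corner of [e x] an idempotent that is [1] under [chi i] and [0] under [chi j]: it
   would split [e x]. *)
have e_uniq x i j : chi i (e x) = 1 -> chi j (e x) = 1 -> i = j.
  move=> ix jx; have [//|/eqP ij] := eqVneq i j.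
  have [ee e0 e_prim] := eP x.
  have [a aE] := chi_surj (fun l => (l == i)%:R); pose b := e x * a * e x.
  have chib l : chi l b = chi l (e x) * (l == i)%:R.
    rewrite !rmorphM /= aE mulrAC -rmorphM /= ee; exact: erefl.
  have [m Rm] := radical_nilpotent A.
  have [|||f [ef fe fb]] := @idempotent_lift (e x) b m ee.
  - by rewrite /b !mulrA ee.
  - by rewrite /b -mulrA ee.
  - apply/chiR => l; rewrite rmorphB rmorphM /= chib.
    have [->|->] := character_idempotent (chi l) ee; first by rewrite !mul0r subr0.
    by rewrite !mul1r; case: eqP; rewrite ?mul1r ?mul0r subrr.
  rewrite Rm memv0 subr_eq0 => /eqP ff.
  have chif l : chi l f = chi l b.
    by apply/eqP; rewrite -subr_eq0 -rmorphB; apply/eqP; apply: (chiR _).1.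
  have [||||f0|f0] := e_prim f (e x - f) ff.
  - by rewrite mulrBr !mulrBl ee ef fe ff subrr subr0.
  - by rewrite mulrBr fe ff subrr.
  - by rewrite mulrBl ef ff subrr.
  - by rewrite addrC subrK.
  - by have := chif i; rewrite chib f0 ix rmorph0 eqxx mulr1 => /eqP; rewrite eq_sym oner_eq0.
  have := chif j; move/eqP: f0; rewrite subr_eq0 => /eqP <-.
  by rewrite chib jx; case: eqP ij => [->//|_ _]; rewrite mulr0 => /eqP; rewrite oner_eq0.
have [iota iotaP] := choice e_one.
have chiE i x : chi i (e x) = (i == iota x)%:R.
  have [ee _ _] := eP x; case: eqP => [->|ix]; first exact: iotaP.
  have [//|ix1] := character_idempotent (chi i) ee.
  by case: ix; apply: e_uniq ix1 (iotaP x).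
have iota_surj i : exists x, i = iota x.
  apply: contrapT => nox; have := rmorph1 (chi i); rewrite -e_sum rmorph_sum big1.
    by move/eqP; rewrite eq_sym oner_eq0.
  by move=> x _; rewrite /= chiE; case: eqP => // ix; case: nox; exists x.
exists (fun x => chi (iota x)); split=> [a | x y].
  split=> [aR x | a0]; first exact: (chiR a).1.
  by apply/chiR => i; have [x ->] := iota_surj i.
rewrite chiE; case: (eqVneq x y) => [->|xy]; first by rewrite eqxx.
case: eqP => // ixy; have := rmorphM (chi (iota x)) (e x) (e y).
rewrite e_ort // rmorph0 /= iotaP ixy iotaP mulr1 => /eqP.
by rewrite eq_sym oner_eq0.
Qed.

(** There are as many orthogonal idempotents as characters, so they correspond by a permutation.
    This will be applied to the images of the stationary paths under another presentation. *)
Lemma idempotent_family_characters (f : V -> A) (chi : V -> {lrmorphism A -> k^o}) :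
  (forall a, a \in R <-> forall x, chi x a = 0) ->
  (forall x, f x * f x = f x) -> (forall x y, x != y -> f x * f y = 0) ->
  (forall x, f x != 0) ->
  exists tau : V -> V, injective tau /\ forall x y, chi x (f y) = (x == tau y)%:R.
Proof.
move=> chiR ff f_ort f0.
have f_one x : exists i, chi i (f x) = 1.
  apply: contrapT => no1; case/eqP: (f0 x).
  apply: idempotent_radical0 => //; apply/chiR => i.
  by have [//|ei] := character_idempotent (chi i) (ff x); case: no1; exists i.
have [tau tauP] := choice f_one.
have tau_ort x y z : chi z (f x) = 1 -> chi z (f y) = 1 -> x = y.
  move=> zx zy; have [//|xy] := eqVneq x y.
  have := rmorphM (chi z) (f x) (f y); rewrite f_ort // rmorph0 /= zx zy mulr1 => /eqP.
  by rewrite eq_sym oner_eq0.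
have tau_inj : injective tau.
  by move=> x y xy; apply: tau_ort (tauP x) _; rewrite xy.
exists tau; split=> // x y; case: eqP => [->|xy]; first exact: tauP.
have [//|xy1] := character_idempotent (chi x) (ff y).
have [tau' _ tauK] := injF_bij tau_inj.
have x1 : chi x (f (tau' x)) = 1 by have := tauP (tau' x); rewrite tauK.
by case: xy; rewrite -(tau_ort _ _ _ x1 xy1) tauK.
Qed.

End Characters.

(** * Peirce components of the radical modulo its square *)

Section PeirceComponents.
Variables (k : fieldType) (A : falgType k).
Local Notation R := (radical A).
Local Notation R2 := (radical A * radical A)%VS.

Lemma radical2_mull a x : x \in R2 -> a * x \in R2.
Proof.
have aE y : amull a y = a * y by rewrite lfunE.
move=> xR; rewrite -aE memv_preim; apply: subvP xR; apply/prodvP => u v uR vR.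
by rewrite -memv_preim aE mulrA memv_mul // radical_mull.
Qed.

Lemma radical2_mulr a x : x \in R2 -> x * a \in R2.
Proof.
have aE y : amulr a y = y * a by rewrite lfunE.
move=> xR; rewrite -aE memv_preim; apply: subvP xR; apply/prodvP => u v uR vR.
by rewrite -memv_preim aE -mulrA memv_mul // radical_mulr.
Qed.

Lemma radical2_sub : (R2 <= R)%VS.
Proof. by apply/prodvP => u v uR _; apply: radical_mulr. Qed.

Variables (e f : A).
Hypotheses (ee : e * e = e) (ff : f * f = f).

Lemma peirce_mem (U : {vspace A}) x : x \in U -> f * x * e \in (<[f]> * U * <[e]>)%VS.
Proof. by move=> xU; rewrite !memv_mul ?memv_line. Qed.

Lemma peirceP (U : {vspace A}) z : z \in (<[f]> * U * <[e]>)%VS ->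
  f * z = z /\ z * e = z.
Proof.
case/memv_cosetP=> w wU ->; split; last by rewrite -mulrA ee.
rewrite mulrA; congr (_ * e); apply/eqP.
have : (<[f]> * U <= lker (amull f - \1%VF))%VS.
  apply/prodvP => u v /vlineP[c ->] vU; rewrite memv_ker add_lfunE opp_lfunE id_lfunE lfunE /=.
  by rewrite -scalerAl -scalerAr mulrA ff subrr.
by move/subvP/(_ w wU); rewrite memv_ker add_lfunE opp_lfunE id_lfunE lfunE /= subr_eq0.
Qed.

Lemma peirce_sub (U : {vspace A}) : (forall a x, x \in U -> a * x \in U) ->
  (forall a x, x \in U -> x * a \in U) -> (<[f]> * U * <[e]> <= U)%VS.
Proof.
move=> Ul Ur; apply/prodvP => u v uU _; apply: Ur; apply: subvP uU.
by apply/prodvP => a b _; apply: Ul.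
Qed.

Lemma peirce_radical2 z : z \in (<[f]> * R * <[e]>)%VS -> z \in R2 ->
  z \in (<[f]> * R2 * <[e]>)%VS.
Proof.
by case/peirceP=> fz ze zR2; rewrite -ze -fz; apply: peirce_mem.
Qed.

Lemma peirce_radical2_sub : (<[f]> * R2 * <[e]> <= <[f]> * R * <[e]>)%VS.
Proof. by rewrite prodvSl // prodvSr // radical2_sub. Qed.

Lemma peirce_no_arrow r : r \in R ->
  (\dim (<[f]> * R * <[e]>)%VS - \dim (<[f]> * R2 * <[e]>)%VS)%N = 0%N ->
  f * r * e \in R2.
Proof.
move=> rR dim0; apply: (subvP (peirce_sub radical2_mull radical2_mulr)).
have -> : (<[f]> * R2 * <[e]>)%VS = (<[f]> * R * <[e]>)%VS.
  by apply/eqP; rewrite eqEdim peirce_radical2_sub /= -subn_eq0 dim0.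
exact: peirce_mem.
Qed.

(** Any element of [f R e] outside [f R^2 e] will do as [v]: the quotient is a line, which [v]
    spans. *)
Lemma peirce_arrow :
  (\dim (<[f]> * R * <[e]>)%VS - \dim (<[f]> * R2 * <[e]>)%VS)%N = 1%N ->
  exists v, [/\ v \in R, f * v = v, v * e = v, v \notin R2
    & forall r, r \in R -> exists c, f * r * e - c *: v \in R2].
Proof.
move=> dim1; set P := (<[f]> * R * <[e]>)%VS; set P2 := (<[f]> * R2 * <[e]>)%VS.
have [v vP vP2] : exists2 v, v \in P & v \notin P2.
  apply/subvPn; apply: contra_eqN dim1 => PP2.
  by rewrite (_ : (_ - _)%N = 0%N) //; apply/eqP; rewrite subn_eq0 dimvS.
have [fv ve] := peirceP vP; exists v; split=> //.
- by apply: subvP vP; apply: peirce_sub; [apply: radical_mull | apply: radical_mulr].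
- by apply: contraNN vP2; apply: peirce_radical2.
move=> r rR.
have PE : (<[v]> + P2)%VS = P.
  apply/eqP; rewrite eqEdim subv_add -memvE vP peirce_radical2_sub /=.
  have lt_dim : (\dim P2 < \dim (<[v]> + P2))%N.
    rewrite ltn_neqAle dimvS ?addvSr // andbT; apply: contraNneq vP2 => dimE.
    have -> : P2 = (<[v]> + P2)%VS by apply/eqP; rewrite eqEdim addvSr dimE /=.
    by apply: (subvP (addvSl _ _)); apply: memv_line.
  by rewrite -(subnK (dimvS peirce_radical2_sub)) dim1 add1n.
have : f * r * e \in (<[v]> + P2)%VS by rewrite PE peirce_mem.
case/memv_addP=> _ /vlineP[c ->] [w wP2 ->]; exists c.
rewrite addrC addKr; apply: subvP wP2.
exact: peirce_sub radical2_mull radical2_mulr.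
Qed.

End PeirceComponents.

(** * Morphisms from the path algebra of an acyclic quiver to [A], and a first presentation *)

Section Presentations.
Variables (k : fieldType) (A : falgType k) (Q : quiver).
Hypothesis Qacyclic : no_oriented_cycle Q.
Notation kQ := (path_alg k Q).
Notation pb := (@pbasis k Q).
Local Notation R := (radical A).
Local Notation R2 := (radical A * radical A)%VS.

Variable chi : vertex Q -> {lrmorphism A -> k^o}.
Hypothesis chiR : forall a, a \in R <-> forall x, chi x a = 0.

Section Morphism.
Variable g : {lrmorphism kQ -> A}.

(* In an acyclic quiver the square of a non-stationary path is zero. *)
Lemma path_radical u : (0 < size (parrows u))%N -> g (pb u) \in R.
Proof.
move=> u0; apply/chiR => x; apply/eqP; rewrite -sqrf_eq0 expr2 -[_ * _]rmorphM -rmorphM /=.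
rewrite pbasisM pcompN ?rmorph0 //= eq_sym; apply: contraTneq u0 => uu.
by rewrite (Qacyclic uu).
Qed.

Lemma path_radical_exp n u : size (parrows u) = n.+1 -> g (pb u) \in (R ^+ n.+1)%VS.
Proof.
elim: n u => [|n IHn] u.
  by move=> u1; rewrite expv1; apply: path_radical; rewrite u1.
case uE: (parrows u) => [|a s] //= [sn]; have [v [vs _ vaE]] := qpath_cons uE.
rewrite -(pbasis_comp k vaE) rmorphM /= expvSr memv_mul ?IHn ?vs //.
exact: path_radical.
Qed.

Lemma path_radical2 u : (1 < size (parrows u))%N -> g (pb u) \in R2.
Proof.
case uE: (parrows u) => [|a [|b s]] //= _; have [v [vs _ vaE]] := qpath_cons uE.
by rewrite -(pbasis_comp k vaE) rmorphM memv_mul // path_radical // vs.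
Qed.

Lemma supp_on_radical2 f : supp_on (fun u => 1 < size (parrows u))%N f -> g f \in R2.
Proof.
apply: (@supp_on_ind k Q A _ (fun x => x \in R2) g f) => [|u]; last exact: path_radical2.
split=> [|c x y xR yR]; first exact: mem0v.
by rewrite rpredD // memvZ.
Qed.

Lemma ker_path_power : exists n, forall f, path_power n f -> f \in ker_ideal g.
Proof.
have [n Rn] := radical_nilpotent A; exists n.+1 => f; apply => u un.
by rewrite -[_ \in _]/(g (pb u) == 0) -memv0 -Rn path_radical_exp.
Qed.

(** A Nakayama argument: approximating the factors of a product by elements of the image [B]
    approximates the product one power deeper. Hence [A = B + R ^+ n.+1] for all [n], and [R] is
    nilpotent. *)
Lemma generated_surjective : (forall a, exists f, a - g f \in R2) ->
  forall a, exists f, g f = a.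
Proof.
move=> gR2; have [r r_all] := ex_all_paths Qacyclic.
(* [B] is the image of [g], obtained as a subspace from the finitely many paths. *)
pose X := [tuple g (pb (tnth (in_tuple r) i)) | i < size r]; pose B := <<X>>%VS.
have gB f : g f \in B.
  apply: (@kQ_ind k Q A (fun x => x \in B) g f) => [|u].
    split=> [|c x y xB yB]; first exact: mem0v.
    by rewrite rpredD // memvZ.
  have /tnthP[i ->] : u \in in_tuple r by apply: r_all.
  by apply: memv_span; apply/tnthP; exists i; rewrite tnth_mktuple.
have BP b : b \in B -> exists f, g f = b.
  move=> /coord_span ->; exists (\sum_i coord X i b *: pb (tnth (in_tuple r) i)).
  rewrite linear_sum; apply: eq_bigr => i _.
  have := tnth_mktuple (fun i => g (pb (tnth (in_tuple r) i))) i.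
  by rewrite (tnth_nth 0) linearZ /= => ->.
have BB b c : b \in B -> c \in B -> b * c \in B.
  by move=> /BP[f <-] /BP[h <-]; rewrite -rmorphM; apply: gB.
have expB n : (R ^+ n.+1 <= (B :&: R ^+ n.+1) + R ^+ n.+2)%VS.
  elim: n => [|n IHn].
    apply/subvP => u uR; have [f fu] := gR2 u; apply/memv_addP.
    exists (g f); last by exists (u - g f); [rewrite expv2 | rewrite addrC subrK].
    rewrite memv_cap gB -(subKr u (g f)) expv1 rpredB //.
    exact: (subvP (radical2_sub A)).
  rewrite [X in (X <= _)%VS]expvSl; apply/prodvP => u v uR vR.
  have [f uf] := gR2 u; have gfR : g f \in R.
    by rewrite -(subKr u (g f)) rpredB //; apply: (subvP (radical2_sub A)).
  have /memv_addP[c] := subvP IHn v vR; rewrite memv_cap => /andP[cB cR] [w wR vE].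
  apply/memv_addP; exists (g f * c).
    by rewrite memv_cap BB ?gB // expvSl memv_mul.
  exists (g f * w + (u - g f) * v); last first.
    by rewrite addrA -mulrDr -vE mulrBl addrC subrK.
  apply: memvD; first by rewrite expvSl memv_mul.
  by rewrite expvSl expvSl prodvA memv_mul.
have fullB n : (fullv <= B + R ^+ n.+1)%VS.
  elim: n => [|n IHn].
    apply/subvP => u _; have [f fu] := gR2 u; apply/memv_addP.
    exists (g f); [exact: gB | exists (u - g f); last by rewrite addrC subrK].
    rewrite expv1.
    exact: (subvP (radical2_sub A)).
  apply: subv_trans IHn _; rewrite subv_add addvSl /=.
  by apply: subv_trans (expB n) _; apply: addvS; [apply: capvSl|].
have [n Rn] := radical_nilpotent A.
by move=> a; apply: BP; apply: subvP (memvf a); rewrite -[B]addv0 -Rn.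
Qed.

End Morphism.
End Presentations.

Section Existence.
Variables (k : fieldType) (A : falgType k) (Q : quiver).
Hypothesis Qacyclic : no_oriented_cycle Q.
Hypothesis Qbypass : no_double_bypass Q.
Notation kQ := (path_alg k Q).
Notation pb := (@pbasis k Q).
Local Notation R := (radical A).
Local Notation R2 := (radical A * radical A)%VS.

Variable chi : vertex Q -> {lrmorphism A -> k^o}.
Hypothesis chiR : forall a, a \in R <-> forall x, chi x a = 0.
Variable e : vertex Q -> A.
Hypothesis chiE : forall x y, chi x (e y) = (x == y)%:R.
Hypothesis eE : forall x y, e x * e y = if x == y then e x else 0.
Hypothesis e_sum : \sum_x e x = 1.
Hypothesis Qdim : forall x y,
  #|[set a : arrow Q | (asrc a == x) && (atgt a == y)]| =
  (\dim (<[e y]> * R * <[e x]>)%VS - \dim (<[e y]> * R2 * <[e x]>)%VS)%N.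

Lemma arrows_card a :
  #|[set b : arrow Q | (asrc b == asrc a) && (atgt b == atgt a)]| = 1%N.
Proof.
apply/eqP/cards1P; exists a; apply/setP => b; rewrite !inE.
apply/andP/eqP => [[/eqP bs /eqP bt] | ->]; last by rewrite !eqxx.
exact: no_parallel_arrows.
Qed.

(** An [f] in the kernel has no stationary term, since [chi x (g f)] is its coefficient at the
    stationary path at [x]. It has no arrow term either: as only one arrow [a] goes from [x] to [y],
    the element [e y * g f * e x] is the coefficient of [a] times the image of [a], modulo [R2]. *)
Lemma ker_admissible (g : {lrmorphism kQ -> A}) :
  (forall x, g (pb (stationary x)) = e x) ->
  (forall a, g (pb (arrow_path a)) \notin R2) -> admissible (ker_ideal g).
Proof.
move=> gE gR2.
have gAl a : e (atgt a) * g (pb (arrow_path a)) = g (pb (arrow_path a)).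
  by rewrite -gE -rmorphM (pbasis_tgt k (arrow_path a)).
have gAr a : g (pb (arrow_path a)) * e (asrc a) = g (pb (arrow_path a)).
  by rewrite -gE -rmorphM (pbasis_src k (arrow_path a)).
split; first exact: ker_path_power chiR _.
move=> f fker S Spath.
have gf0 : g f = 0 by apply/eqP.
have chig x : chi x (g f) = coef f (stationary x).
  pose G f := coef f (stationary x) : k^o.
  apply: (linear_basis_eq (F := fun f => chi x (g f)) (G := G)) => [c f1 f2|c f1 f2|u].
  - by rewrite !linearP.
  - by rewrite /G coefD coefZ.
  rewrite -[RHS]/(coef (pb u) (stationary x)) coef_basis.
  case uE: (parrows u) => [|b s].
    rewrite (qpath_nil uE) gE chiE eq_sym.
    suff -> : (psrc u == x) = (stationary (psrc u) == stationary x) by [].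
    by apply/eqP/eqP => [-> // | /(congr1 (@psrc Q))].
  have uR : g (pb u) \in R by apply: (path_radical Qacyclic chiR); rewrite uE.
  rewrite ((chiR _).1 uR x); case: eqP => // ux.
  by move: uE; rewrite ux.
have f1 : supp_on (fun u => 0 < size (parrows u))%N f.
  move=> u fu; case uE: (parrows u) => [|b s] //; case/eqP: fu.
  by rewrite (qpath_nil uE) -chig gf0 rmorph0.
have arrow_part a : e (atgt a) * g f * e (asrc a) - coef f (arrow_path a) *: g (pb (arrow_path a)) \in R2.
  pose G f := e (atgt a) * g f * e (asrc a) - coef f (arrow_path a) *: g (pb (arrow_path a)).
  have Gl : linear G.
    move=> c f2 f3; rewrite /G linearP mulrDr mulrDl coefD coefZ scalerDl opprD.
    by rewrite -scalerAr -scalerAl addrACA scalerBr scalerA.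
  pose GL : {linear kQ -> A} := HB.pack G (GRing.isLinear.Build _ _ _ _ _ Gl).
  apply: (@supp_on_ind k Q A _ (fun x => x \in R2) GL f _ _ f1) => [|u u0].
    by split=> [|c x y xR yR]; [exact: mem0v | rewrite rpredD // memvZ].
  rewrite /= /G coef_basis; case: eqP => [-> | ua].
    by rewrite gAl gAr scale1r subrr mem0v.
  rewrite scale0r subr0; case uE: (parrows u) u0 => [|b [|b' s]] // _.
    have ub := qpath_arrow uE; rewrite ub -(gAl b) -(gAr b) mulrA mulrA eE -!mulrA eE.
    case: eqP => [tgt_ab|]; last by rewrite mul0r mem0v.
    case: eqP => [src_ab|]; last by rewrite !mulr0 mem0v.
    by case: ua; rewrite ub; congr arrow_path; apply: (no_parallel_arrows Qbypass).
  apply: radical2_mulr; apply: radical2_mull.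
  by apply: (path_radical2 Qacyclic chiR); rewrite uE.
have f2 : supp_on (fun u => 1 < size (parrows u))%N f.
  move=> u fu; have := f1 u fu; case uE: (parrows u) => [|b [|b' s]] // _.
  case/negP: fu; rewrite (qpath_arrow uE); apply: contrapT => /negP fb.
  case/negP: (gR2 b).
  rewrite -[g _]scale1r -(mulVf fb) -scalerA memvZ //.
  by have := arrow_part b; rewrite gf0 mulr0 mul0r sub0r rpredN.
apply: (@supp_on_ind k Q kQ _ (fun x => x \in S) idfun f _ _ f2) => [|u].
  split=> [|c x y xS yS]; first exact: rpred0.
  by rewrite rpredD // -mulr_algl; apply: ideal_mull.
case uE: (parrows u) => [|a [|b s]] // _.
have [w [wE _ /(pbasis_comp k) <-]] := qpath_cons uE.
have [w' [_ w'b /(pbasis_comp k) wb]] := qpath_cons wE.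
rewrite /= -wb -mulrA; apply: ideal_mull.
case E: (pcomp (arrow_path b) (arrow_path a)) => [z|].
  rewrite (pbasis_comp k E); apply: Spath.
  by have [_ [_ _ ->]] := pcomp_Some E.
by rewrite pbasisM E rpred0.
Qed.

(** Each arrow goes to a generator of the line [e y R e x / e y R^2 e x]; together with the
    idempotents these span [A] modulo [R2]. *)
Lemma ex_presentation : exists g : {lrmorphism kQ -> A},
  [/\ forall a, exists f, g f = a,
      forall x, g (pb (stationary x)) = e x
    & forall a, g (pb (arrow_path a)) \notin R2].
Proof.
have ee x : e x * e x = e x by rewrite eE eqxx.
have exv a : exists v, [/\ v \in R, e (atgt a) * v = v, v * e (asrc a) = v, v \notin R2
    & forall r, r \in R -> exists c, e (atgt a) * r * e (asrc a) - c *: v \in R2].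
  by apply: peirce_arrow => //; rewrite -Qdim arrows_card.
have [v vP] := choice exv.
have [||a|a|g [gE gA]] := @ex_path_morphism k Q A e v; rewrite ?e_sum //.
- by have [_ _ ->] := vP a.
- by have [_ ->] := vP a.
have part_im x y r : r \in R -> exists f, e y * r * e x - g f \in R2.
  move=> rR; have [a /andP[/eqP ax /eqP ay] | noa] := pickP [pred a | (asrc a == x) && (atgt a == y)].
    have [_ _ _ _ /(_ r rR)[c]] := vP a; rewrite ax ay => cR2.
    by exists (c *: pb (arrow_path a)); rewrite linearZ /= gA.
  exists 0; rewrite linear0 subr0; apply: peirce_no_arrow => //.
  rewrite -Qdim; apply/eqP; rewrite cards_eq0; apply/eqP/setP => a; rewrite !inE.
  exact: noa.
have g_surj : forall a, exists f, g f = a.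
  apply: (generated_surjective Qacyclic) => a.
  have loc x y : exists f, e y * a * e x - g f \in R2.
    (* Subtracting [chi x a] times [e x] moves a diagonal corner into the radical; the other corners
       lie there already. *)
    pose c : k := if x == y then chi x a else 0.
    have rR : e y * a * e x - c *: e x \in R.
      apply/chiR => z; rewrite linearB linearZ /= !rmorphM /= !chiE /c.
      rewrite -[_ *: _]/(_ * _); case: (eqVneq x y) => [<- | xy].
        case: eqVneq => [->|]; last by rewrite mulr0 mulr0 subrr.
        by rewrite mul1r mulr1 subrr.
      case: (eqVneq z x) => [-> | _]; last by rewrite !mulr0 subrr.
      by rewrite (negPf xy) !mul0r subrr.
    have [f fR] := part_im x y _ rR; exists (c *: pb (stationary x) + f).
    rewrite linearD linearZ /= gE opprD addrA.
    suff <- : e y * (e y * a * e x - c *: e x) * e x = e y * a * e x - c *: e x by [].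
    rewrite mulrBr mulrBl !mulrA ee -[_ * e x * e x]mulrA ee; congr (_ - _).
    rewrite -scalerAr -scalerAl -mulrA ee eE eq_sym /c.
    by case: eqVneq => [->|]; rewrite ?scale0r.
  pose f x := projT1 (choice (loc x)).
  have fP x y : e y * a * e x - g (f x y) \in R2 := projT2 (choice (loc x)) y.
  exists (\sum_x \sum_y f x y).
  have -> : a = \sum_x \sum_y e y * a * e x.
    rewrite -{1}[a]mulr1 -e_sum mulr_sumr; apply: eq_bigr => x _.
    by rewrite -{1}[a]mul1r -e_sum !mulr_suml.
  rewrite linear_sum -sumrB; apply: rpred_sum => x _.
  by rewrite linear_sum -sumrB; apply: rpred_sum => y _; apply: fP.
have gR2 a : g (pb (arrow_path a)) \notin R2 by rewrite gA; have [] := vP a.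
by exists g.
Qed.


End Existence.

(** * Relabelling of the quiver with rescaling of the arrows *)

Section QuiverMorphism.
Variables (Q Q' : quiver) (sv : vertex Q -> vertex Q') (sa : arrow Q -> arrow Q').
Hypothesis sa_src : forall a, asrc (sa a) = sv (asrc a).
Hypothesis sa_tgt : forall a, atgt (sa a) = sv (atgt a).

Lemma is_path_map x s y : is_path x s y -> is_path (sv x) (map sa s) (sv y).
Proof.
elim: s x => [|a s IHs] x /=; first by move/eqP->.
by case/andP=> /eqP <- /IHs; rewrite sa_src sa_tgt eqxx.
Qed.

Definition qmap (u : qpath Q) : qpath Q' :=
  @QPath Q' (sv (psrc u), map sa (parrows u), sv (ptgt u)) (is_path_map (valP u)).

Lemma qmap_comp u v w : pcomp u v = Some w ->
  pcomp (qmap u) (qmap v) = Some (qmap w).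
Proof.
move=> /pcomp_Some[vu [ws wt wE]]; apply: pcomp_eq.
  by rewrite /ptgt /psrc /= -/(ptgt v) vu.
by rewrite /= ws wt wE map_cat.
Qed.

Lemma qmap_stationary x : qmap (stationary x) = stationary (sv x).
Proof. exact: qpath_eq. Qed.

Lemma qmap_arrow a : qmap (arrow_path a) = arrow_path (sa a).
Proof. by apply: qpath_eq => //; rewrite /psrc /ptgt /= ?sa_src ?sa_tgt. Qed.

Lemma qmap_inj : injective sv -> injective sa -> injective qmap.
Proof.
move=> sv_inj sa_inj u v uv; apply: qpath_eq.
- exact: sv_inj (congr1 (@psrc _) uv).
- exact: sv_inj (congr1 (@ptgt _) uv).
exact: inj_map sa_inj _ _ (congr1 (@parrows _) uv).
Qed.

End QuiverMorphism.

Section Relabelling.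
Variables (k : fieldType) (Q : quiver) (sv : vertex Q -> vertex Q) (sa : arrow Q -> arrow Q).
Hypothesis sa_src : forall a, asrc (sa a) = sv (asrc a).
Hypothesis sa_tgt : forall a, atgt (sa a) = sv (atgt a).
Hypothesis sv_inj : injective sv.
Hypothesis sa_inj : injective sa.
Variable c : arrow Q -> k.
Hypothesis c0 : forall a, c a != 0.
Notation kQ := (path_alg k Q).
Notation pb := (@pbasis k Q).
Local Notation smap := (qmap sa_src sa_tgt).

Lemma ex_relabelling : exists D : {lrmorphism kQ -> kQ},
  (forall x, D (pb (stationary x)) = pb (stationary (sv x))) /\
  (forall a, D (pb (arrow_path a)) = c a *: pb (arrow_path (sa a))).
Proof.
apply: ex_path_morphism => [x y||a|a].
- by rewrite pbasis_stationaryM (inj_eq sv_inj).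
- rewrite -[RHS](pbasis_sum1 k Q) [RHS](reindex_inj sv_inj) //.
- by rewrite -scalerAl -sa_src (pbasis_src k (arrow_path (sa a))).
- by rewrite -scalerAr -sa_tgt (pbasis_tgt k (arrow_path (sa a))).
Qed.

Variable D : {lrmorphism kQ -> kQ}.
Hypothesis DE : forall x, D (pb (stationary x)) = pb (stationary (sv x)).
Hypothesis DA : forall a, D (pb (arrow_path a)) = c a *: pb (arrow_path (sa a)).

Lemma relabelling_path u : exists2 d, d != 0 & D (pb u) = d *: pb (smap u).
Proof.
elim/qpath_ind: u => [x|a v u vaE [d d0 Dv]].
  by exists 1; rewrite ?oner_neq0 // scale1r DE qmap_stationary.
exists (d * c a); first by rewrite mulf_neq0.
rewrite -(pbasis_comp k vaE) rmorphM /= Dv DA -scalerAl -scalerAr scalerA.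
by rewrite -(qmap_arrow sa_src sa_tgt) (pbasis_comp k (qmap_comp sa_src sa_tgt vaE)).
Qed.

Fact wa_src (b : arrow (double_quiver Q)) :
  asrc (match b with inl a => inl (sa a) | inr a => inr (sa a) end : arrow (double_quiver Q))
  = sv (asrc b).
Proof. by case: b => a; [apply: sa_src | apply: sa_tgt]. Qed.

Fact wa_tgt (b : arrow (double_quiver Q)) :
  atgt (match b with inl a => inl (sa a) | inr a => inr (sa a) end : arrow (double_quiver Q))
  = sv (atgt b).
Proof. by case: b => a; [apply: sa_tgt | apply: sa_src]. Qed.

Definition wmap : walk Q -> walk Q := qmap wa_src wa_tgt.

Lemma wmap_path u : wmap (walk_of_path u) = walk_of_path (smap u).
Proof. by apply: qpath_eq => //; rewrite /parrows /= -!map_comp. Qed.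

Variables I J : ptsideal kQ.
Hypothesis IJ : forall f, (f \in I) = (D f \in J).

(** [D] sends distinct paths to nonzero multiples of distinct paths, so only the coefficients
    change. *)
Lemma minimal_relation_relabelling n (t : 'I_n -> k) (u : 'I_n -> qpath Q) :
  minimal_relation I t u ->
  exists t', minimal_relation J t' (fun i => smap (u i)).
Proof.
case=> n2 t0 u_inj tuI tu_min.
have ex_d i : exists d, d != 0 /\ D (pb (u i)) = d *: pb (smap (u i)).
  by have [d d0 dE] := relabelling_path (u i); exists d.
have [d dP] := choice ex_d; exists (fun i => t i * d i).
have DS (E : {set 'I_n}) : \sum_(i in E) (t i * d i) *: pb (smap (u i)) =
    D (\sum_(i in E) t i *: pb (u i)).
  rewrite linear_sum; apply: eq_bigr => i _.
  by rewrite linearZ /= (dP i).2 scalerA.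
split=> //.
- by move=> i; rewrite mulf_neq0 // (dP i).1.
- by move=> i j /(qmap_inj sv_inj sa_inj)/u_inj.
- by have := DS setT; under eq_bigl do rewrite inE; under [in RHS]eq_bigl do rewrite inE;
    move=> ->; rewrite -IJ.
by move=> E E0 ET; rewrite DS -IJ tu_min.
Qed.

Lemma homotopic_relabelling u v : homotopic I u v -> homotopic J (wmap u) (wmap v).
Proof.
elim=> {u v}.
- by move=> u; apply: homotopic_refl.
- by move=> u v _; apply: homotopic_sym.
- by move=> u v w _ uv _; apply: homotopic_trans.
- move=> u u' v v' w w' _ uu' _ vv' wE wE'.
  exact: homotopic_cat uu' vv' (qmap_comp _ _ wE) (qmap_comp _ _ wE').
- move=> a w wE; rewrite /wmap (qmap_stationary wa_src wa_tgt) -sa_tgt.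
  apply: homotopic_arrV; have := qmap_comp wa_src wa_tgt wE.
  by rewrite !(qmap_arrow wa_src wa_tgt).
- move=> a w wE; rewrite /wmap (qmap_stationary wa_src wa_tgt) -sa_src.
  apply: homotopic_Varr; have := qmap_comp wa_src wa_tgt wE.
  by rewrite !(qmap_arrow wa_src wa_tgt).
move=> n t u i j /minimal_relation_relabelling[t' tu'].
by rewrite !wmap_path; apply: (homotopic_rel (u := fun i => smap (u i))) tu'.
Qed.

End Relabelling.

(** * Two presentations differ by a conjugation, a relabelling and a transvection *)

Section TwoPresentations.
Variables (k : fieldType) (A : falgType k) (Q : quiver).
Hypothesis Qacyclic : no_oriented_cycle Q.
Hypothesis Qbypass : no_double_bypass Q.
Notation kQ := (path_alg k Q).
Notation pb := (@pbasis k Q).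
Local Notation R := (radical A).
Local Notation R2 := (radical A * radical A)%VS.

Variable chi : vertex Q -> {lrmorphism A -> k^o}.
Hypothesis chiR : forall a, a \in R <-> forall x, chi x a = 0.
Variable e : vertex Q -> A.
Hypothesis chiE : forall x y, chi x (e y) = (x == y)%:R.
Hypothesis eE : forall x y, e x * e y = if x == y then e x else 0.

(** The character of [kQ] that kills all arrows and is [1] on this stationary path has an ideal as
    kernel, and the ideal contains the paths of length two. *)
Lemma stationary_path_power (x : vertex Q) : ~ path_power 2 (pb (stationary x)).
Proof.
pose E y : k^o := if y == x then 1 else 0.
have [||a|a|g [gE gA]] := @ex_path_morphism k Q k^o E (fun=> 0); rewrite ?mul0r ?mulr0 //.
- move=> y z; rewrite /E; case: (eqVneq y z) => [->|yz].
    by case: eqP; rewrite ?mul1r ?mul0r.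
  case: (eqVneq y x) yz => [-> | _ _]; last by rewrite mul0r.
  by rewrite eq_sym => /negPf ->; rewrite mulr0.
- rewrite (bigD1 x) //= big1 /E ?eqxx ?addr0 // => y /negPf ->; exact: erefl.
move/(_ (ker_ideal g)) => gx.
have : pb (stationary x) \in ker_ideal g.
  apply: gx => u; case uE: (parrows u) => [|a s] // _.
  have [v [_ _ vaE]] := qpath_cons uE.
  by rewrite -[_ \in _]/(g (pb u) == 0) -(pbasis_comp k vaE) rmorphM /= gA mulr0.
by rewrite -[_ \in _]/(g _ == 0) gE /E eqxx oner_eq0.
Qed.

(** After a permutation [sv] the idempotents [f (sv x)] and [e x] agree under all characters. So
    [u = \sum_x e x * f (sv x)] is [1] modulo the radical, hence invertible, and
    [u * f (sv x) = e x * u]: conjugate [g] by [u]. *)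
Lemma ex_conjugate (J : ptsideal kQ) (g : {lrmorphism kQ -> A}) :
  (forall f, f \in J -> path_power 2 f) ->
  (forall a, exists f, g f = a) -> (forall f, (f \in J) = (g f == 0)) ->
  exists (sv : vertex Q -> vertex Q) (g' : {lrmorphism kQ -> A}),
  [/\ injective sv, forall a, exists f, g' f = a,
      forall f, (f \in J) = (g' f == 0)
    & forall x, g' (pb (stationary (sv x))) = e x].
Proof.
move=> J2 g_surj Jg; pose f x := g (pb (stationary x)).
have fE x y : f x * f y = if x == y then f x else 0.
  by rewrite /f -rmorphM pbasis_stationaryM; case: ifP => //; rewrite rmorph0.
have f0 x : f x != 0.
  apply/eqP => fx; apply: (@stationary_path_power x); apply: J2.
  by rewrite Jg; apply/eqP.
have [|||tau [tau_inj tauE]] := idempotent_family_characters (f := f) chiR.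
- by move=> x; rewrite fE eqxx.
- by move=> x y /negPf xy; rewrite fE xy.
- exact: f0.
have [sv svK tauK] := injF_bij tau_inj.
pose u := \sum_x e x * f (sv x).
have uR : 1 - u \in R.
  apply/chiR => y; rewrite rmorphB rmorph1 rmorph_sum (bigD1 y) //= big1 => [|x xy].
    by rewrite rmorphM /= chiE tauE tauK eqxx mulr1 addr0 subrr.
  by rewrite rmorphM /= chiE eq_sym (negPf xy) mul0r.
have [w [wu uw]] := radical_invertible uR; rewrite subKr in wu uw.
have uf x : u * f (sv x) = e x * u.
  have sv_inj : injective sv := can_inj tauK.
  rewrite /u mulr_suml mulr_sumr (bigD1 x) //= [RHS](bigD1 x) //=.
  rewrite big1 => [|y yx]; last by rewrite -mulrA fE (inj_eq sv_inj) (negPf yx) mulr0.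
  rewrite big1 => [|y yx]; last by rewrite mulrA eE eq_sym (negPf yx) mul0r.
  by rewrite -mulrA fE eqxx mulrA eE eqxx.
pose h z := u * g z * w.
have hL : linear h.
  by move=> c x y; rewrite /h linearP mulrDr mulrDl -scalerAr -scalerAl.
have h1 : h 1 = 1 by rewrite /h rmorph1 mulr1.
have hM : {morph h : x y / x * y}.
  by move=> x y; rewrite /h rmorphM !mulrA -[_ * w * u]mulrA wu mulr1.
pose g' : {lrmorphism kQ -> A} := HB.pack h
  (GRing.isLinear.Build _ _ _ _ _ hL) (GRing.isMonoidMorphism.Build kQ A h (h1, hM)).
exists sv, g'; split.
- exact: can_inj tauK.
- move=> a; have [z zE] := g_surj (w * a * u); exists z.
  by rewrite /= /h zE !mulrA uw mul1r -mulrA uw mulr1.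
- move=> z; rewrite Jg /= /h; apply/eqP/eqP => [->|hz]; first by rewrite mulr0 mul0r.
  have -> : g z = w * (u * g z * w) * u by rewrite !mulrA wu mul1r -mulrA wu mulr1.
  by rewrite hz mulr0 mul0r.
by move=> x; rewrite /= /h -/(f _) uf -mulrA uw mulr1.
Qed.

(** Lift [v a] and keep the paths from [sv (asrc a)] to [sv (atgt a)]. Without an arrow among them
    in the support, all would have length at least two and [v a] would lie in [R2]; the remaining
    paths are bypasses of that arrow. *)
Lemma arrow_lift (g : {lrmorphism kQ -> A}) sv (v : arrow Q -> A) a :
  injective sv -> (forall b, exists f, g f = b) ->
  (forall x, g (pb (stationary (sv x))) = e x) ->
  e (atgt a) * v a = v a -> v a * e (asrc a) = v a -> v a \notin R2 ->
  exists b : arrow Q, exists c : k, exists h : kQ,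
  [/\ asrc b = sv (asrc a), atgt b = sv (atgt a), c != 0, supp_on (bypass b) h
    & g (c *: pb (arrow_path b) + h) = v a].
Proof.
move=> sv_inj g_surj gE ev ve vR2; have [f0 f0v] := g_surj (v a).
pose P u := (psrc u == sv (asrc a)) && (ptgt u == sv (atgt a)).
pose f := ppart k P f0.
have fv : g f = v a.
  by rewrite /f ppart_ends !rmorphM /= !gE f0v ev ve.
have fP u : coef f u != 0 -> P u.
  by rewrite ppart_coef; case: ifP => // _; rewrite eqxx.
have [b /andP[/eqP bs /eqP bt] | nob] := pickP [pred b | (asrc b == sv (asrc a)) && (atgt b == sv (atgt a))].
  pose c := coef f (arrow_path b); pose h := f - c *: pb (arrow_path b).
  have hb : supp_on (bypass b) h.
    move=> u; rewrite /h -scaleNr coefD coefZ coef_basis; case: (arrow_path b =P u) => [<-|ub].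
      by rewrite mulr1 subrr eqxx.
    rewrite mulr0 addr0 => /fP/andP[/eqP us /eqP ut].
    by split=> [|/esym//]; split; rewrite ?us ?ut -?bs -?bt.
  exists b, c, h; split=> //; last by rewrite addrC subrK.
  apply: contraNneq vR2 => c0; rewrite -fv.
  apply: (supp_on_radical2 Qacyclic chiR) => u.
  have -> : f = h by rewrite /h c0 scale0r subr0.
  by move=> /hb; apply: bypass_size.
case/negP: vR2; rewrite -fv; apply: (supp_on_radical2 Qacyclic chiR) => u /fP/andP[/eqP us /eqP ut].
case uE: (parrows u) => [|b [|b' s]] //.
  have := @Qacyclic (arrow_path a); rewrite /psrc /ptgt /parrows /=.
  suff st : asrc a = atgt a by move/(_ st).
  by apply: sv_inj; rewrite -us -ut (qpath_nil uE).
have := nob b; rewrite (qpath_arrow uE) in us ut; rewrite /= -us -ut.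
by rewrite /psrc /ptgt /= !eqxx.
Qed.

End TwoPresentations.

Section Comparing.
Variables (k : fieldType) (A : falgType k) (Q : quiver).
Hypothesis Qacyclic : no_oriented_cycle Q.
Hypothesis Qbypass : no_double_bypass Q.
Notation kQ := (path_alg k Q).
Notation pb := (@pbasis k Q).
Local Notation R2 := (radical A * radical A)%VS.

Variable chi : vertex Q -> {lrmorphism A -> k^o}.
Hypothesis chiR : forall a, a \in radical A <-> forall x, chi x a = 0.
Variable e : vertex Q -> A.
Hypothesis chiE : forall x y, chi x (e y) = (x == y)%:R.
Hypothesis eE : forall x y, e x * e y = if x == y then e x else 0.
Variable g0 : {lrmorphism kQ -> A}.
Hypothesis g0E : forall x, g0 (pb (stationary x)) = e x.
Hypothesis g0R2 : forall a, g0 (pb (arrow_path a)) \notin R2.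

(** The lift of the image of [a] under [g0] is a multiple of the arrow [sa a] plus bypasses [h a].
    Pulling [h a] back by the inverse [D'] of the relabelling [D] gives [t] with
    [g \o D \o transvection tb = g0], whence [D] carries the transvected kernel to [J]. *)
Lemma presentation_compare (J : ptsideal kQ) : admissible J ->
  alg_isomorphic (quot_alg J) A ->
  exists (t : arrow Q -> kQ) (tb : transv t)
    (sv : vertex Q -> vertex Q) (sa : arrow Q -> arrow Q)
    (sa_src : forall a, asrc (sa a) = sv (asrc a))
    (sa_tgt : forall a, atgt (sa a) = sv (atgt a)),
  [/\ injective sv, injective sa & forall u v : walk Q,
    homotopic (transvected_ker g0 tb) u v ->
    homotopic J (wmap sa_src sa_tgt u) (wmap sa_src sa_tgt v)].
Proof.
case=> _ J2 /quot_isomorphic_surjection[gJ [gJ_surj gJE]].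
have [sv [g [sv_inj g_surj Jg gE]]] := ex_conjugate chiR chiE eE J2 gJ_surj gJE.
pose v a := g0 (pb (arrow_path a)).
have ev a : e (atgt a) * v a = v a.
  by rewrite -g0E -rmorphM (pbasis_tgt k (arrow_path a)).
have ve a : v a * e (asrc a) = v a.
  by rewrite -g0E -rmorphM (pbasis_src k (arrow_path a)).
have lift a := arrow_lift Qacyclic Qbypass chiR sv_inj g_surj gE (ev a) (ve a) (g0R2 a).
have [sa saP] := choice lift.
have [c cP] := choice saP.
have [h hP] := choice cP.
have sa_src a : asrc (sa a) = sv (asrc a) by have [] := hP a.
have sa_tgt a : atgt (sa a) = sv (atgt a) by have [] := hP a.
have c0 a : c a != 0 by have [] := hP a.
have hb a : supp_on (bypass (sa a)) (h a) by have [] := hP a.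
have gh a : g (c a *: pb (arrow_path (sa a)) + h a) = v a by have [] := hP a.
have sa_inj : injective sa.
  move=> a b ab; apply: (no_parallel_arrows Qbypass); apply: sv_inj.
    by rewrite -!sa_src ab.
  by rewrite -!sa_tgt ab.
have [sv' svK sv'K] := injF_bij sv_inj.
have [sa' saK sa'K] := injF_bij sa_inj.
have sa'_src b : asrc (sa' b) = sv' (asrc b) by rewrite -{2}(sa'K b) sa_src svK.
have sa'_tgt b : atgt (sa' b) = sv' (atgt b) by rewrite -{2}(sa'K b) sa_tgt svK.
have c'0 b : (c (sa' b))^-1 != 0 by rewrite invr_eq0.
have sv'_inj : injective sv' := can_inj sv'K.
have sa'_inj : injective sa' := can_inj sa'K.
have [D [DE DA]] := ex_relabelling sa_src sa_tgt sv_inj c.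
have [D' [D'E D'A]] := ex_relabelling sa'_src sa'_tgt sv'_inj (fun b => (c (sa' b))^-1).
have D'K f : D (D' f) = f.
  apply: (@eq_path_morphism k Q kQ (D \o D') idfun) => [x|a] /=.
    by rewrite D'E DE sv'K.
  by rewrite D'A linearZ /= DA sa'K scalerA mulVf // scale1r.
pose t a := D' (h a).
have tb : transv t.
  move=> a; apply: supp_on_map (hb a) => u [[us ut] ua].
  have [d d0 dE] := relabelling_path sa'_src sa'_tgt c'0 D'E D'A u.
  rewrite -[X in supp_on _ X]/(D' (pb u)) dE.
  apply: supp_onZ; apply: supp_on_basis.
  split.
    by split; rewrite /psrc /ptgt /= ?us ?ut /psrc /ptgt /= ?sa_src ?sa_tgt svK.
  have aE : arrow_path a = qmap sa'_src sa'_tgt (arrow_path (sa a)).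
    by rewrite qmap_arrow saK.
  by rewrite aE => /(qmap_inj sv'_inj sa'_inj).
exists t, tb, sv, sa, sa_src, sa_tgt; split=> //.
have gD z : g (D (transvection tb z)) = g0 z.
  pose G : {lrmorphism kQ -> A} := (g \o D) \o transvection tb.
  apply: (@eq_path_morphism k Q A G g0) => [x|a] /=.
    by rewrite transvectionE DE gE g0E.
  by rewrite transvectionA rmorphD /= DA /t D'K gh.
have IJ f : (f \in transvected_ker g0 tb) = (D f \in J).
  rewrite transvected_kerE Jg; congr (_ == 0).
  by rewrite -gD (transvectionK Qbypass) // => a; rewrite opprK.
move=> w w' ww'; exact: (homotopic_relabelling sa_src sa_tgt sv_inj sa_inj c0 DE DA IJ ww').
Qed.

Definition connected_by_walk (x y : vertex Q) := exists w : walk Q, psrc w = x /\ ptgt w = y.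

Lemma connected_by_walk_sym x y : connected_by_walk x y -> connected_by_walk y x.
Proof. by case=> w [ws wt]; exists (walk_inv w). Qed.

Lemma connected_by_walk_trans y x z :
  connected_by_walk x y -> connected_by_walk y z -> connected_by_walk x z.
Proof.
case=> w [ws wt] [w' [ws' wt']].
have [|w'' /pcomp_Some[_ [s t _]] _] := @pcompP _ w' w; first by rewrite wt ws'.
by exists w''; rewrite s t.
Qed.

Hypothesis e_sum : \sum_x e x = 1.
Hypothesis g0_surj : forall a, exists f, g0 f = a.
Hypothesis Aconnected : connected_alg A.

(** No path joins two components, so the sum of the idempotents of one component is central; it is
    nonzero, hence [1]. *)
Lemma quiver_connected x y : connected_by_walk x y.
Proof.
pose C z := `[< connected_by_walk x z >]; pose eC := \sum_(z | C z) e z.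
have Cx : C x by apply/asboolP; exists (walk1 x).
have e0 z a b : C z != C b -> e z * a * e b = 0.
  move=> zb; have [f <-] := g0_surj a.
  rewrite -!g0E -!rmorphM -ppart_ends ppart0 ?rmorph0 // => u _.
  apply/andP => -[/eqP us /eqP ut]; case/negP: zb; apply/eqP.
  have bz : connected_by_walk b z by exists (walk_of_path u).
  apply/asboolP/asboolP => [xz|xb]; last exact: connected_by_walk_trans xb bz.
  exact: connected_by_walk_trans xz (connected_by_walk_sym bz).
have eC_central a : eC * a = a * eC.
  transitivity (\sum_(z | C z) \sum_(b | C b) e z * a * e b).
    rewrite mulr_suml; apply: eq_bigr => z Cz.
    rewrite -[LHS]mulr1 -e_sum mulr_sumr [RHS]big_mkcond; apply: eq_bigr => b _.
    by case: ifP => // Cb; rewrite e0 // Cz Cb.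
  rewrite exchange_big mulr_sumr; apply: eq_bigr => b Cb.
  rewrite -[RHS]mul1r -e_sum mulr_suml [LHS]big_mkcond; apply: eq_bigr => z _.
  by rewrite mulrA; case: ifP => // Cz; rewrite e0 // Cz Cb.
have eCe z : eC * e z = if C z then e z else 0.
  rewrite mulr_suml; case: ifP => Cz.
    rewrite (bigD1 z) //= eE eqxx big1 ?addr0 // => b /andP[_ /negPf bz].
    by rewrite eE bz.
  by apply: big1 => b Cb; rewrite eE; case: eqP Cb => // ->; rewrite Cz.
have eCC : eC * eC = eC.
  by rewrite {2}/eC mulr_sumr; apply: eq_bigr => z Cz; rewrite eCe Cz.
have e_neq0 z : e z != 0.
  apply/eqP => ez; have := chiE z z; rewrite ez rmorph0 eqxx => /eqP.
  by rewrite eq_sym oner_eq0.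
have [eC0|eC1] := Aconnected eCC eC_central.
  by case/eqP: (e_neq0 x); rewrite -[RHS](mul0r (e x)) -eC0 eCe Cx.
apply: contrapT => nxy; case/eqP: (e_neq0 y).
by rewrite -[LHS]mul1r -eC1 eCe; case: ifP => // /asboolP.
Qed.

End Comparing.

(** * Composition of walks, and surjections of fundamental groups *)

Section WalkComposition.
Variables (k : fieldType) (Q : quiver) (I : ptsideal (path_alg k Q)).
Implicit Types (u v w : walk Q).

(** A total composition; the default is immaterial, since only walks with matching ends are composed
    below. *)
Definition wcat u v : walk Q := odflt u (pcomp u v).

Lemma wcat_comp u v : ptgt v = psrc u -> pcomp u v = Some (wcat u v).
Proof. by move=> vu; rewrite /wcat; have [w -> _] := pcompP vu. Qed.

Lemma wcat_src u v : ptgt v = psrc u -> psrc (wcat u v) = psrc v.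
Proof. by move=> /wcat_comp/pcomp_Some[_ []]. Qed.

Lemma wcat_tgt u v : ptgt v = psrc u -> ptgt (wcat u v) = ptgt u.
Proof. by move=> /wcat_comp/pcomp_Some[_ []]. Qed.

Lemma wcatA u v w : ptgt w = psrc v -> ptgt v = psrc u ->
  wcat u (wcat v w) = wcat (wcat u v) w.
Proof.
move=> wv vu; apply: Some_inj; have := pcompA u v w.
rewrite (wcat_comp wv) (wcat_comp vu) /= !wcat_comp //; first by rewrite wcat_src.
by rewrite wcat_tgt.
Qed.

Lemma wcat1l u : wcat (@walk1 Q (ptgt u)) u = u.
Proof. by apply: Some_inj; rewrite -wcat_comp // pcomp1l. Qed.

Lemma wcat1r u : wcat u (@walk1 Q (psrc u)) = u.
Proof. by apply: Some_inj; rewrite -wcat_comp // pcomp1r. Qed.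

Lemma homotopic_wcat u u' v v' : ptgt v = psrc u ->
  homotopic I u u' -> homotopic I v v' -> homotopic I (wcat u v) (wcat u' v').
Proof.
move=> vu uu' vv'; have [us _] := homotopic_parallel uu'.
have [_ vt] := homotopic_parallel vv'.
by apply: homotopic_cat uu' vv' (wcat_comp _) (wcat_comp _); rewrite -?us -?vt.
Qed.

Lemma wcat_inv_cancel u v : ptgt v = psrc u ->
  homotopic I (wcat (walk_inv u) (wcat u v)) v.
Proof.
move=> vu; rewrite wcatA // -[X in homotopic _ _ X]wcat1l vu.
apply: homotopic_wcat (homotopic_refl _ _); first by rewrite wcat_src.
exact: homotopic_invl (wcat_comp _).
Qed.

Lemma wcat_cancel_inv u v : ptgt v = ptgt u ->
  homotopic I (wcat u (wcat (walk_inv u) v)) v.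
Proof.
move=> vu; rewrite wcatA // -[X in homotopic _ _ X]wcat1l vu.
apply: homotopic_wcat (homotopic_refl _ _); first by rewrite wcat_src.
exact: homotopic_invr (wcat_comp _).
Qed.

Lemma wcat_inv_cancelr u v : psrc v = psrc u ->
  homotopic I (wcat (wcat v (walk_inv u)) u) v.
Proof.
move=> vu; rewrite -wcatA // -[X in homotopic _ _ X]wcat1r vu.
apply: homotopic_wcat (homotopic_refl _ _) _; first by rewrite wcat_tgt.
exact: homotopic_invl (wcat_comp _).
Qed.

End WalkComposition.

Lemma loop_mul_wcat (Q : quiver) (x0 : vertex Q) (p q : loop x0) :
  loop_walk (loop_mul p q) = wcat (loop_walk p) (loop_walk q).
Proof. by apply: Some_inj; rewrite -loop_mulE wcat_comp // loop_src loop_tgt. Qed.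

Section InducedMorphism.
Variables (k : fieldType) (Q : quiver) (I J : ptsideal (path_alg k Q)).
Variables (sv : vertex Q -> vertex Q) (sa : arrow Q -> arrow Q).
Hypothesis sa_src : forall a, asrc (sa a) = sv (asrc a).
Hypothesis sa_tgt : forall a, atgt (sa a) = sv (atgt a).
Hypothesis sv_inj : injective sv.
Hypothesis sa_inj : injective sa.
Local Notation smap := (wmap sa_src sa_tgt).
Hypothesis smap_homotopic : forall u v : walk Q,
  homotopic I u v -> homotopic J (smap u) (smap v).

Lemma wmap_src (w : walk Q) : psrc (smap w) = sv (psrc w). Proof. by []. Qed.
Lemma wmap_tgt (w : walk Q) : ptgt (smap w) = sv (ptgt w). Proof. by []. Qed.

Lemma wmap_wcat (u v : walk Q) : ptgt v = psrc u -> smap (wcat u v) = wcat (smap u) (smap v).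
Proof.
move=> vu; apply: Some_inj; rewrite -[RHS]wcat_comp; last first.
  by rewrite wmap_src wmap_tgt vu.
exact: esym (qmap_comp _ _ (wcat_comp vu)).
Qed.

Lemma wmap_surj (w : walk Q) : exists w', smap w' = w.
Proof.
have [sv' svK sv'K] := injF_bij sv_inj; have [sa' saK sa'K] := injF_bij sa_inj.
have sa'_src b : asrc (sa' b) = sv' (asrc b) by rewrite -{2}(sa'K b) sa_src svK.
have sa'_tgt b : atgt (sa' b) = sv' (atgt b) by rewrite -{2}(sa'K b) sa_tgt svK.
exists (wmap sa'_src sa'_tgt w); apply: qpath_eq.
- exact: sv'K.
- exact: sv'K.
rewrite /parrows /= -map_comp map_id_in // => -[] b _ /=; congr (_ _); exact: sa'K.
Qed.

Variables (x0 y0 : vertex Q) (gam : walk Q).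
Hypothesis gam_src : psrc gam = y0.
Hypothesis gam_tgt : ptgt gam = sv x0.

Definition conj_walk (w : walk Q) : walk Q := wcat (walk_inv gam) (wcat w gam).

Lemma conj_walk_comp (w : walk Q) : psrc w = sv x0 -> ptgt w = sv x0 ->
  ptgt gam = psrc w /\ ptgt (wcat w gam) = psrc (walk_inv gam).
Proof.
move=> ws wt; have gw : ptgt gam = psrc w by rewrite gam_tgt ws.
by split=> //; rewrite wcat_tgt // wt -gam_tgt.
Qed.

Lemma conj_walk_loop (w : walk Q) : psrc w = sv x0 -> ptgt w = sv x0 ->
  (psrc (conj_walk w) == y0) && (ptgt (conj_walk w) == y0).
Proof.
move=> ws wt; have [gw wg] := conj_walk_comp ws wt.
by rewrite /conj_walk wcat_src // wcat_src // wcat_tgt // gam_src -gam_src !eqxx.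
Qed.

Lemma conj_walk_homotopic (w w' : walk Q) : psrc w = sv x0 -> ptgt w = sv x0 ->
  homotopic J w w' -> homotopic J (conj_walk w) (conj_walk w').
Proof.
move=> ws wt ww'; have [gw wg] := conj_walk_comp ws wt.
apply: homotopic_wcat => //; first exact: homotopic_refl.
by apply: homotopic_wcat => //; apply: homotopic_refl.
Qed.

Lemma conj_walk_wcat (v w : walk Q) : psrc v = sv x0 -> ptgt v = sv x0 ->
  psrc w = sv x0 -> ptgt w = sv x0 ->
  homotopic J (conj_walk (wcat v w)) (wcat (conj_walk v) (conj_walk w)).
Proof.
move=> vs vt ws wt; have [gv vg] := conj_walk_comp vs vt.
have [gw wg] := conj_walk_comp ws wt; have wv : ptgt w = psrc v by rewrite wt vs.
have cw : ptgt (conj_walk w) = psrc (wcat v gam).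
  by rewrite wcat_src // /conj_walk wcat_tgt.
have cg : ptgt (conj_walk w) = psrc gam by rewrite /conj_walk wcat_tgt.
have -> : wcat (conj_walk v) (conj_walk w) =
    wcat (walk_inv gam) (wcat v (wcat gam (conj_walk w))).
  by rewrite [wcat v (wcat gam _)]wcatA // wcatA.
have -> : conj_walk (wcat v w) = wcat (walk_inv gam) (wcat v (wcat w gam)).
  by rewrite /conj_walk [wcat v (wcat w gam)]wcatA.
have vwg : ptgt (wcat w gam) = psrc v by rewrite wcat_tgt.
apply: homotopic_wcat; first by rewrite wcat_tgt // vt -gam_tgt.
  exact: homotopic_refl.
apply: homotopic_wcat => //; first exact: homotopic_refl.
apply: homotopic_sym; apply: wcat_cancel_inv.
by rewrite vwg vs -gam_tgt.
Qed.

Lemma smap_loop_subproof (p : loop x0) :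
  (psrc (conj_walk (smap (loop_walk p))) == y0) &&
  (ptgt (conj_walk (smap (loop_walk p))) == y0).
Proof. by apply: conj_walk_loop; rewrite ?wmap_src ?wmap_tgt ?loop_src ?loop_tgt. Qed.

Definition smap_loop (p : loop x0) : loop y0 := Loop (smap_loop_subproof p).

Local Notation G := (fundamental_group I x0).
Local Notation H := (fundamental_group J y0).

(** A loop [p] is relabelled and conjugated by [gam] into a loop at [y0]. Injective self-maps of
    finite sets being bijective, relabelling is onto walks; a loop [q] at [y0] is reached from the
    walk whose relabelling is [q] conjugated back along [gam]. *)
Lemma ex_induced_morphism : exists f : {multiplicative G -> H}, forall c, exists b, f b = c.
Proof.
pose f (c : G) : H := \pi_H (smap_loop (repr c)).
have wl (p : loop x0) : psrc (smap (loop_walk p)) = sv x0 /\ ptgt (smap (loop_walk p)) = sv x0.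
  by rewrite wmap_src wmap_tgt loop_src loop_tgt.
have fE p : f (\pi_G p) = \pi_H (smap_loop p).
  apply/eqP/pi1_eqP; apply: conj_walk_homotopic.
  - exact: (wl _).1.
  - exact: (wl _).2.
  by apply: smap_homotopic; apply/pi1_eqP; rewrite reprK.
have fM : {morph f : x y / (x * y)%g}.
  move=> c d; rewrite -[(c * d)%g]/(pi1_mul c d) -[RHS]/(pi1_mul (f c) (f d)).
  rewrite -[c]reprK -[d]reprK; move: (repr c) (repr d) => p q.
  rewrite pi1_mulE !fE pi1_mulE.
  apply/eqP/pi1_eqP; rewrite [loop_walk (loop_mul (smap_loop p) _)]loop_mul_wcat.
  rewrite -[loop_walk _]/(conj_walk (smap (loop_walk (loop_mul p q)))).
  rewrite loop_mul_wcat wmap_wcat ?loop_src ?loop_tgt //.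
  by have [ps pt] := wl p; have [qs qt] := wl q; apply: conj_walk_wcat.
pose fm : {multiplicative G -> H} := HB.pack f (monoid.isMultiplicative.Build _ _ f fM).
exists fm => c; rewrite -[c]reprK; move: (repr c) => q.
have qs := loop_src q; have qt := loop_tgt q; pose u := loop_walk q.
have ug : ptgt (walk_inv gam) = psrc u by rewrite qs -gam_src.
have gu : ptgt (wcat u (walk_inv gam)) = psrc gam by rewrite wcat_tgt // qt gam_src.
have [w wE] := wmap_surj (wcat gam (wcat u (walk_inv gam))).
have ws : psrc w = x0 by apply: sv_inj; rewrite -wmap_src wE wcat_src // wcat_src.
have wt : ptgt w = x0 by apply: sv_inj; rewrite -wmap_tgt wE wcat_tgt.
have wP : (psrc w == x0) && (ptgt w == x0) by rewrite ws wt eqxx.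
exists (\pi_G (Loop wP)); rewrite /= fE; apply/eqP/pi1_eqP.
rewrite -[loop_walk (smap_loop _)]/(conj_walk (smap w)) wE /conj_walk -[loop_walk q]/u.
have ig : ptgt gam = psrc (wcat u (walk_inv gam)) by rewrite wcat_src.
rewrite -(wcatA ig gu); apply: homotopic_trans (wcat_inv_cancel _ _) _.
  by rewrite wcat_tgt.
by apply: wcat_inv_cancelr; rewrite qs gam_src.
Qed.

End InducedMorphism.

Theorem theorem1p1 (k : fieldType) (char0 : [pchar k] =i pred0)
    (A : falgType k) (Q : quiver)
    (Abasic : basic A) (Aconnected : connected_alg A)
    (AQ : ordinary_quiver A Q)
    (Qacyclic : no_oriented_cycle Q) (Qbypass : no_double_bypass Q) :
  exists I0 : ptsideal (path_alg k Q),
    [/\ admissible I0,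
        alg_isomorphic (quot_alg I0) A
      & forall J : ptsideal (path_alg k Q),
          admissible J -> alg_isomorphic (quot_alg J) A ->
          forall x0 y0 : vertex Q,
            exists f : {multiplicative
                          fundamental_group I0 x0 -> fundamental_group J y0},
              forall c, exists b, f b = c].
Proof.
have [e [e_prim e_ort e_sum Qdim]] := AQ.
have eE x y : e x * e y = if x == y then e x else 0.
  by case: eqVneq => [->|/e_ort //]; have [] := e_prim y.
have [chi [chiR chiE]] := vertex_characters Abasic e_prim e_ort e_sum.
have [g [g_surj gE gR2]] :=
  ex_presentation Qacyclic Qbypass chiR chiE eE e_sum Qdim.
have [t [tb t_min]] := ex_minimal_transvected_ker char0 Qacyclic Qbypass g.
pose g1 : {lrmorphism path_alg k Q -> A} := g \o transvection (transvN tb).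
exists (transvected_ker g tb); split.
(* A transvection alters the image of an arrow by an element of [R2] only, as bypasses have length
   at least two. *)
- apply: (ker_admissible Qacyclic Qbypass chiR chiE eE (g := g1)) => [x|a] /=.
    by rewrite transvectionE gE.
  rewrite transvectionA rmorphB /=; apply: contraNN (gR2 a) => gaR2.
  rewrite -(subrK (g (t a)) (g _)) rpredD //.
  apply: (supp_on_radical2 Qacyclic chiR) => u /tb.
  exact: bypass_size.
- apply: (@quot_ker_isomorphic k (path_alg k Q) A g1) => a.
  have [f <-] := g_surj a; exists (transvection tb f).
  by rewrite /= (transvectionK Qbypass).
move=> J Jadm Jiso x0 y0.
have [s [sb [sv [sa [sa_src [sa_tgt [sv_inj sa_inj sJ]]]]]]] :=
  presentation_compare Qacyclic Qbypass chiR chiE eE gE gR2 Jadm Jiso.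
(* This walk carries loops at the relabelled base point [sv x0] to loops at the prescribed [y0]. *)
have [w [w_src w_tgt]] :=
  quiver_connected chiE eE gE e_sum g_surj Aconnected y0 (sv x0).
apply: (ex_induced_morphism sv_inj sa_inj _ w_src w_tgt) => u v uv.
exact/sJ/t_min.
Qed.
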